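(* In the setting and notation of the context, fix $T\in(0,T_0)$ and $\alpha\in(0,1)$. If $u\in C^\alpha([0,T];B_{H^2}(u_0,r))$, then there exists a constant $L_M>0$, depending on $\alpha$, $M_0$, $T_0$, $\Omega$, $\|v_0\|_{L^2(\Omega)}$, $\|w_0\|_{H^1(\Omega)}$, $\kappa$, $\beta_F$, $\beta_p$, such that for every $h\in(0,T]$ $$\sup_{0\le t<t+h\le T}\|[W'(u)q](t+h)-[W'(u)q](t)\|_{L^2(\Omega)\times H^1(\Omega)}\le h^\alpha L_M\sup_{t\in[0,T]}\|q(t)\|_{H^2(\Omega)}+h^\alpha\,T\,L_M\,\|q\|_{C^\alpha([0,T];H^2(\Omega))}$$ holds for all $q\in C^\alpha([0,T];B_{H^2}(\tilde u_0,r))$, where $\tilde u_0=u_0-\theta_1\in H^{2+\sigma}(\Omega)\cap H^1_0(\Omega)$.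
   Context: $\Omega\subset\mathbb R$ is an open bounded interval; $\beta_F,\beta_p,\theta_1,\theta_2>0$ are constants; $\sigma\in(0,\frac12)$; $u_0\in H^{2+\sigma}(\Omega)$, $v_0\in H^1_0(\Omega)$, $w_0\in H^2(\Omega)$ with $u_0=\theta_1$, $w_0=\theta_2$ on $\partial\Omega$ and $\kappa:=\inf_\Omega w_0>0$. $C=C(\Omega)>0$ is a constant with $\|f\|_{L^\infty(\Omega)}\le C\|f\|_{H^1(\Omega)}$ for all $f\in H^1(\Omega)$, and $r\in(0,\frac{\kappa}{2C})$ is fixed. $B_{H^2}(U,r)=\{f\in H^2(\Omega): f|_{\partial\Omega}=U|_{\partial\Omega},\ \|f-U\|_{H^2(\Omega)}\le r\}$; $C([0,T];B_{H^2}(U,r))$, resp. $C^\alpha([0,T];B_{H^2}(U,r))$, is the set of $u\in C([0,T];H^2(\Omega))$, resp. $u\in C^\alpha([0,T];H^2(\Omega))$, with $u(t)\in B_{H^2}(U,r)$ for all $t$. $\|q\|_{C^\alpha([0,T];X)}=\sup_t\|q(t)\|_X+\sup_{0\le t<t+h\le T}h^{-\alpha}\|q(t+h)-q(t)\|_X$. $\Delta_D$ is the Dirichlet Laplacian with domain $H^2(\Omega)\cap H^1_0(\Omega)$; $\{T(t)\}_{t\ge0}$, $T(t)=\begin{pmatrix}T_{11}(t)&T_{12}(t)\\ T_{21}(t)&T_{22}(t)\end{pmatrix}$, is the $C_0$-semigroup on $L^2(\Omega)\times H^1_0(\Omega)$ generated by $\mathcal A=\begin{pmatrix}0&\Delta_D\\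 1&0\end{pmatrix}$, $D(\mathcal A)=H^1_0(\Omega)\times(H^2(\Omega)\cap H^1_0(\Omega))$; $M_0=\sup_{t\ge0}\|T(t)\|_{\mathcal B(L^2(\Omega)\times H^1_0(\Omega))}$. $T_0>0$ is a fixed number such that for every $T\in(0,T_0)$ and every $u\in C([0,T];B_{H^2}(u_0,r))$ there is a unique $W(u)=(v(u),w(u))=(v,w)$ with $(v,w-\theta_2)\in C([0,T];L^2(\Omega)\times H^1_0(\Omega))$, $\sup_t\|(v(t)-v_0,w(t)-w_0)\|_{L^2(\Omega)\times H^1(\Omega)}\le r$ (which forces $w\ge\kappa/2$) and $$\begin{pmatrix}v(t)\\ w(t)\end{pmatrix}=\begin{pmatrix}0\\ \theta_2\end{pmatrix}+T(t)\begin{pmatrix}v_0\\ w_0-\theta_2\end{pmatrix}+\int_0^tT(t-s)\begin{pmatrix}-\beta_F[w(s)]^{-2}+\beta_p(u(s)-1)\\ 0\end{pmatrix}ds,\quad t\in[0,T]$$ (such $T_0$ exists). The Fréchet derivative $W'(u):C([0,T];H^2(\Omega)\cap H^1_0(\Omega))\to C([0,T];L^2(\Omega)\times H^1_0(\Omega))$ is $W'(u)q=\lim_{h\to0}\frac1h[W(u+hq)-W(u)]=(v'(u)q,w'(u)q)$; it is given by the unique solution of $$[w'(u)q](t)=\int_0^tT_{21}(t-s)\Big\{\beta_pq(s)+2\beta_F\frac{[w'(u)q](s)}{[w(u)]^3(s)}\Big\}ds,\quad [v'(u)q](t)=\int_0^tT_{11}(t-s)\Big\{\beta_pq(s)+2\beta_F\frac{[w'(u)q](s)}{[w(u)]^3(s)}\Big\}ds.$$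 *)

(* Defs.v *)
From HB Require Import structures.
From mathcomp Require Import all_boot all_order all_algebra.
From mathcomp Require Import all_classical all_reals all_analysis.
From mathcomp Require Import ess_sup_inf.

Set Implicit Arguments.
Unset Strict Implicit.
Unset Printing Implicit Defensive.
Import Order.TTheory GRing.Theory Num.Theory.
Import numFieldNormedType.Exports.
Local Open Scope classical_set_scope.
Local Open Scope ring_scope.

(** A normed space is given by a vector space [V] of representatives, the
    subset [X : set V] of the representatives of its elements and the norm
    [N : V -> R], which is a seminorm on [X]: two representatives at distance 0
    stand for the same element. The values of a path outside [0, T] are
    irrelevant. *)

Section Paths.
Context {R : realType} {V : lmodType R}.
Implicit Types (X : set V) (N : V -> R) (T alpha : R) (F G : R -> V).

Definition sup_norm N T F : \bar R :=
  ereal_sup [set (N (F t))%:E | t in `[0, T]].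

Definition C_path X N T F : Prop :=
  (forall t, 0 <= t <= T -> X (F t)) /\
  (forall t, 0 <= t <= T ->
     N (F s - F t) @[s --> within `[0, T] (nbhs t)] --> (0 : R)).

Definition holder_seminorm alpha N T F : \bar R :=
  ereal_sup [set y | exists t h, [/\ 0 <= t, 0 < h, t + h <= T &
     y = (h `^ (- alpha) * N (F (t + h) - F t))%:E]].

Definition holder_norm alpha N T F : \bar R :=
  (sup_norm N T F + holder_seminorm alpha N T F)%E.

Definition holder_path alpha X N T F : Prop :=
  C_path X N T F /\ (holder_norm alpha N T F < +oo)%E.

(** [I] is the integral of [G] over [0, t], as the limit of the Riemann sums of
    all tagged partitions. For a continuous [G] with values in a Banach space
    this is the Bochner integral. *)
Definition is_integral N G (t : R) (I : V) : Prop :=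
  forall e, 0 < e -> exists2 d, 0 < d &
    forall (n : nat) (p xi : nat -> R), p 0%N = 0 -> p n = t ->
      (forall i, (i < n)%N -> p i <= xi i <= p i.+1 /\ p i.+1 - p i < d) ->
      N (\sum_(i < n) (p i.+1 - p i) *: G (xi i) - I) < e.

End Paths.

Definition muO {R : realType} (a b : R) : set (measurableTypeR R) -> \bar R :=
  mrestr lebesgue_measure (measurable_itv `]a, b[).

HB.instance Definition _ (R : realType) (a b : R) := Measure.on (muO a b).

(** Omega = ]a, b[. Elements of L^2(Omega) are represented by Borel functions on R, of which
    only the restriction to Omega matters, up to equality a.e. *)

Section Sobolev.
Context {R : realType}.
Variables a b : R.
Implicit Types (f g : R -> R) (sigma r : R).

Local Notation mu := (muO a b).

Definition aeq f g : Prop := {ae mu, forall x, f x = g x}.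

Definition L2 : set (R -> R) := [set f | f \in Lfun mu 2%:E].
Definition normL2 f : R := fine ('N[mu]_2%:E[EFin \o f])%E.

(** C^1 and C^oo test functions with compact support in Omega define the same
    weak derivatives. *)
Definition test_function (phi : R -> R) : Prop :=
  [/\ forall x, derivable phi x 1, continuous (derive1 phi) &
      exists c d, [/\ a < c, d < b & forall x, ~~ (c <= x <= d) -> phi x = 0]].

Definition is_weak_derivative f g : Prop :=
  forall phi, test_function phi ->
    (\int[mu]_x (f x * derive1 phi x) = - \int[mu]_x (g x * phi x))%R.

(** Unique up to equality a.e. when it exists; the null function otherwise. *)
Definition weakD f : R -> R :=
  xget (fun=> 0) [set g | L2 g /\ is_weak_derivative f g].

Definition H1 : set (R -> R) :=
  [set f | L2 f /\ exists2 g, L2 g & is_weak_derivative f g].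
Definition normH1 f : R :=
  Num.sqrt (normL2 f ^+ 2 + normL2 (weakD f) ^+ 2).

Definition H2 : set (R -> R) := [set f | H1 f /\ H1 (weakD f)].
Definition normH2 f : R :=
  Num.sqrt (normL2 f ^+ 2 + normL2 (weakD f) ^+ 2 +
            normL2 (weakD (weakD f)) ^+ 2).

(** Sobolev-Slobodeckij, for 0 < sigma < 1 *)
Definition H2s sigma : set (R -> R) :=
  [set f | H2 f /\
    (\int[mu]_x \int[mu]_y
       ((weakD (weakD f) x - weakD (weakD f) y) ^+ 2 /
        `|x - y| `^ (1 + 2 * sigma))%:E < +oo)%E].

(** The boundary values of [f], i.e. the values at a and b of its continuous
    representative on [a, b], are [ya] and [yb]. *)
Definition has_trace f (ya yb : R) : Prop :=
  exists g, [/\ {within `[a, b], continuous g}, aeq f g, g a = ya & g b = yb].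

Definition H10 : set (R -> R) := [set f | H1 f /\ has_trace f 0 0].
Definition H2D : set (R -> R) := [set f | H2 f /\ H10 f].

Definition ballH2 (U : R -> R) r : set (R -> R) :=
  [set f | [/\ H2 f,
     exists ya yb, has_trace f ya yb /\ has_trace U ya yb &
     normH2 (f - U) <= r]].

Definition C_ball T U r (u : R -> R -> R) : Prop :=
  C_path H2 normH2 T u /\ (forall t, 0 <= t <= T -> ballH2 U r (u t)).

Definition holder_ball alpha T U r (u : R -> R -> R) : Prop :=
  holder_path alpha H2 normH2 T u /\
  (forall t, 0 <= t <= T -> ballH2 U r (u t)).

(** The first components range over L^2; the second ones over H^1_0 for
    elements of [L2H10], but [normL2H1], the Hilbert norm of the product, also
    measures pairs in L^2 x H^1. *)
Definition state : Type := ((R -> R) * (R -> R))%type.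

Definition L2H10 : set state := [set x | L2 x.1 /\ H10 x.2].
Definition normL2H1 (x : state) : R :=
  Num.sqrt (normL2 x.1 ^+ 2 + normH1 x.2 ^+ 2).
Definition aeq2 (x y : state) : Prop := aeq x.1 y.1 /\ aeq x.2 y.2.

Definition LaplaceD (f : R -> R) : R -> R := weakD (weakD f).

Definition domA : set state := [set x | H10 x.1 /\ H2D x.2].
Definition opA (x : state) : state := (LaplaceD x.2, x.1).

Definition op_norm (L : state -> state) : \bar R :=
  ereal_sup [set (normL2H1 (L x))%:E | x in [set x | L2H10 x /\ normL2H1 x <= 1]].

Definition bounded_linear_op (L : state -> state) : Prop :=
  [/\ forall x, L2H10 x -> L2H10 (L x),
      forall (k : R) x y, L2H10 x -> L2H10 y ->
        aeq2 (L (k *: x + y)) (k *: L x + L y) &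
      (op_norm L < +oo)%E].

Definition C0_semigroup (S : R -> state -> state) : Prop :=
  [/\ forall t, 0 <= t -> bounded_linear_op (S t),
      forall x, L2H10 x -> aeq2 (S 0 x) x,
      forall s t x, 0 <= s -> 0 <= t -> L2H10 x ->
        aeq2 (S (s + t) x) (S s (S t x)) &
      forall x, L2H10 x -> normL2H1 (S t x - x) @[t --> 0^'+] --> (0 : R)].

Definition generated_by_A (S : R -> state -> state) : Prop :=
  forall x y, L2H10 x -> L2H10 y ->
    (normL2H1 (h^-1 *: (S h x - x) - y) @[h --> 0^'+] --> (0 : R)) <->
    (domA x /\ aeq2 y (opA x)).

Section Problem.
Variables (S : R -> state -> state) (betaF betap theta2 r : R).
Variables (v0 w0 : R -> R).

Definition forcing (u w : R -> R -> R) (s : R) : state :=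
  ((fun x => - betaF * (w s x) ^- 2 + betap * (u s x - 1)), (fun=> 0)).

(** [y = (v, w)]; the integral equation is stated with [is_integral] applied to
    the difference of its two other terms. *)
Definition mild_solution T (u : R -> R -> R) (y : R -> state) : Prop :=
  let shift : state := ((fun=> 0), (fun=> theta2)) in
  let x0 : state := (v0, w0) in
  [/\ C_path L2H10 normL2H1 T (fun t => y t - shift),
      (sup_norm normL2H1 T (fun t => y t - x0)%R <= r%:E)%E &
      forall t, 0 <= t <= T ->
        is_integral normL2H1
          (fun s => S (t - s) (forcing u (fun s => (y s).2) s)) t
          (y t - shift - S t (x0 - shift))].

Definition unique_mild_solution T (u : R -> R -> R) : Prop :=
  (exists y, mild_solution T u y) /\
  (forall y z, mild_solution T u y -> mild_solution T u z ->
     forall t, 0 <= t <= T -> aeq2 (y t) (z t)).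

End Problem.

(** [D] is the Fréchet derivative at [u] of a map [W] defined on
    C([0, T]; B_(H^2)(U, r)), as a bounded linear operator from
    C([0, T]; H^2 /\ H^1_0) to C([0, T]; L^2 x H^1_0). The increments are those
    which keep [u + k] in the domain of [W]; this determines [D] for every [u]
    in the domain, including the [u] on its relative boundary. *)
Definition frechet_derivative T (U : R -> R) r (W : (R -> R -> R) -> R -> state)
    (u : R -> R -> R) (D : (R -> R -> R) -> R -> state) : Prop :=
  [/\ forall k, C_path H2D normH2 T k -> C_path L2H10 normL2H1 T (D k),
      forall (c : R) k l, C_path H2D normH2 T k -> C_path H2D normH2 T l ->
        forall t, 0 <= t <= T -> aeq2 (D (c *: k + l) t) (c *: D k t + D l t),
      exists M : R, forall k, C_path H2D normH2 T k ->
        (sup_norm normL2H1 T (D k) <= M%:E * sup_norm normH2 T k)%E &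
      forall e : R, 0 < e -> exists2 d : R, 0 < d &
        forall k, C_path H2D normH2 T k -> C_ball T U r (u + k) ->
          (sup_norm normH2 T k <= d%:E)%E ->
          (sup_norm normL2H1 T (W (u + k)%R - W u - D k)%R <=
             e%:E * sup_norm normH2 T k)%E].

End Sobolev.

(* Main.v *)
Require Import Defs.
From HB Require Import structures.
From mathcomp Require Import all_boot all_order all_algebra.
From mathcomp Require Import all_classical all_reals all_analysis.
From mathcomp Require Import ess_sup_inf measurable_realfun ring lra.

Set Implicit Arguments.
Unset Strict Implicit.
Unset Printing Implicit Defensive.
Import Order.TTheory GRing.Theory Num.Theory.
Import numFieldNormedType.Exports.
Local Open Scope classical_set_scope.
Local Open Scope ring_scope.

(** Let [W u1] and [W u2] be the mild solutions for two admissible [u1], [u2]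
    with [u1 - u2 = eta *: q]. Their difference [z] solves the linear equation
    [z t = int_0^t S (t - s) (g s) ds] whose first component of the source is
    [eta * betap * q - betaF * (w1 ^- 2 - w2 ^- 2)]. Write [z (t + h) - z t] as
    the integral of [S (h + t - s) (g s)] over [0, h] plus that of
    [S (t - s) (g (s + h) - g s)] over [0, t]. As [w1], [w2] stay above
    [kappa / 2], the size of [g] is controlled by that of [q] and [z], and its
    increments by those of [q] and [z] and by the products of [z] with the
    increments of [w1] and [w2]. Two applications of Gronwall's lemma
    ([mild_gronwall], [mild_gronwall_shift]) then give the estimate [diff_holder]
    of the increments of [z], with the factor [eta].

    The delicate point is the constant, which depends on the initial data only
    through the norms of [v0] in L^2 and of [w0] in H^1: the increments of [w1]
    may be estimated neither by the norm of the data in the domain of the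
    generator nor by the size of the forcing, which involves [u]. What helps is
    that [w] has velocity [v]: the second component of a mild solution is
    Lipschitz in L^2, with the supremum of the norm of the first component as
    constant ([mild_second_comp_lipschitz]), and this supremum is at most
    [normL2 v0 + r]. For orbits of the semigroup in the domain of the generator
    this is a mean value argument; it passes to the closure of the domain, and to
    mild solutions because the forcing acts on the second component to second
    order only. Mild solutions stay in the closure of the domain because the
    forcing has a continuous representative, which is an L^2 limit of test
    functions ([closure_dom_continuous]).

    The derivative is only tested by increments that keep [u] in its ball, and
    [u + eps *: q] may leave it. But [u0 - u + d *: q] and [u0 - u] both point
    into the ball, and their difference is [d *: q]. Hence the derivative at [q] is
    the uniform limit of difference quotients of two solutions
    ([frechet_difference]), and it inherits the estimate of [z].

    Integrals are limits of Riemann sums, and all the estimates are made on the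
    sums over equal intervals tagged by their left ends ([rsum]). Functions are
    representatives, so that identities between states hold modulo a seminorm
    ([eqN]); that the Sobolev norms are seminorms comes down to the uniqueness of
    weak derivatives ([fundamental_lemma]). *)

(** * Seminorms on spaces of representatives *)

Record seminorm_on (R : realType) (V : lmodType R) (X : set V) (N : V -> R) :
    Prop := SeminormOn {
  sn0 : X 0;
  sn_lin : forall (c : R) x y, X x -> X y -> X (c *: x + y);
  sn_tri : forall x y, X x -> X y -> N (x + y) <= N x + N y;
  sn_homo : forall (c : R) x, X x -> N (c *: x) = `|c| * N x }.

Section SeminormTheory.
Context (R : realType) (V : lmodType R) (X : set V) (N : V -> R).
Hypothesis sn : seminorm_on X N.

Lemma snZ (c : R) x : X x -> X (c *: x).
Proof. by move=> Xx; rewrite -[_ *: _]addr0; apply: (sn_lin sn) => //; exact: (sn0 sn). Qed.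

Lemma snD x y : X x -> X y -> X (x + y).
Proof. by move=> Xx Xy; rewrite -[x]scale1r; exact: (sn_lin sn). Qed.

Lemma snN x : X x -> X (- x).
Proof. by rewrite -scaleN1r; exact: snZ. Qed.

Lemma snB x y : X x -> X y -> X (x - y).
Proof. by move=> Xx Xy; apply: snD => //; exact: snN. Qed.

Lemma sn_sum n (F : 'I_n -> V) : (forall i, X (F i)) -> X (\sum_(i < n) F i).
Proof.
by move=> XF; elim/big_ind : _ => //; [exact: (sn0 sn)|exact: snD].
Qed.

Lemma sn_norm0 : N 0 = 0.
Proof. by rewrite -(scale0r 0) (sn_homo sn)// ?normr0 ?mul0r//; exact: (sn0 sn). Qed.

Lemma sn_normN x : X x -> N (- x) = N x.
Proof. by move=> Xx; rewrite -scaleN1r (sn_homo sn)// normrN1 mul1r. Qed.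

Lemma sn_ge0 x : X x -> 0 <= N x.
Proof.
move=> Xx; have := sn_tri sn Xx (snN Xx).
by rewrite subrr sn_norm0 sn_normN//; lra.
Qed.

Lemma sn_distC x y : X x -> X y -> N (x - y) = N (y - x).
Proof. by move=> Xx Xy; rewrite -sn_normN ?opprB//; exact: snB. Qed.

Lemma sn_triB x y : X x -> X y -> N (x - y) <= N x + N y.
Proof.
by move=> Xx Xy; rewrite -(sn_normN Xy); apply: (sn_tri sn) => //; exact: snN.
Qed.

Lemma sn_dist y x z : X x -> X y -> X z -> N (x - z) <= N (x - y) + N (y - z).
Proof.
move=> Xx Xy Xz; have -> : x - z = (x - y) + (y - z) by rewrite addrA subrK.
by apply: (sn_tri sn); exact: snB.
Qed.

Lemma sn_le_dist x y : X x -> X y -> N x <= N y + N (x - y).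
Proof.
move=> Xx Xy; rewrite -{1}(subrK y x) addrC.
by apply: (sn_tri sn) => //; exact: snB.
Qed.

Lemma sn_norm_sum n (F : 'I_n -> V) : (forall i, X (F i)) ->
  N (\sum_(i < n) F i) <= \sum_(i < n) N (F i).
Proof.
elim: n F => [|n IH] F XF; first by rewrite !big_ord0 sn_norm0.
rewrite !big_ord_recr/=; apply: le_trans (sn_tri sn _ _) _ => //.
  by apply: sn_sum => i.
by rewrite lerD2r IH.
Qed.

End SeminormTheory.

(** * Riemann sums *)

Section RiemannSums.
Context (R : realType) (V : lmodType R).

(** The Riemann sum on [0, t] for the [n] equal intervals, tagged by their left
    ends; the left ends make the weighted sums of the Gronwall argument
    telescope. *)
Definition rsum (t : R) (n : nat) (G : R -> V) : V :=
  \sum_(i < n) (t / n%:R) *: G (t * i%:R / n%:R).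

Lemma rsum_node (t : R) n i : 0 <= t -> (i < n)%N ->
  0 <= t * i%:R / n%:R <= t.
Proof.
move=> t0 lin; have n0 : (0 : R) < n%:R by rewrite ltr0n (leq_trans _ lin).
rewrite !mulr_ge0//= ?invr_ge0 ?ler0n//= ler_pdivrMr// ler_wpM2l// ler_nat.
exact: ltnW.
Qed.

Context (X : set V) (N : V -> R).
Hypothesis sn : seminorm_on X N.

Lemma rsum_in (t : R) n (G : R -> V) : 0 <= t -> (forall s, 0 <= s <= t -> X (G s)) ->
  X (rsum t n G).
Proof.
move=> t0 XG; apply: (sn_sum sn) => i; apply: (snZ sn); apply: XG.
exact: rsum_node.
Qed.

Lemma norm_rsum_le (t : R) n (G : R -> V) (K : R) : 0 <= t ->  0 <= K ->
  (forall s, 0 <= s <= t -> X (G s) /\ N (G s) <= K) ->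
  N (rsum t n G) <= t * K.
Proof.
move=> t0 K0 XG; case: n => [|n].
  by rewrite /rsum big_ord0 (sn_norm0 sn) mulr_ge0.
apply: le_trans (sn_norm_sum sn _) _ => [i|].
  by apply: (snZ sn); have [] := XG _ (rsum_node t0 (ltn_ord i)).
apply: (@le_trans _ _ (\sum_(i < n.+1) t / n.+1%:R * K)).
  apply: ler_sum => i _; have [XGi NGi] := XG _ (rsum_node t0 (ltn_ord i)).
  by rewrite (sn_homo sn)// ger0_norm ?divr_ge0// ler_wpM2l ?divr_ge0.
by rewrite sumr_const card_ord -[leLHS]mulr_natl mulrA [_%:R * _]mulrC divfK.
Qed.

Lemma norm_rsum (t : R) n (G : R -> V) : 0 <= t ->
  (forall s, 0 <= s <= t -> X (G s)) ->
  N (rsum t n G) <= \sum_(i < n) t / n%:R * N (G (t * i%:R / n%:R)).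
Proof.
move=> t0 XG; apply: le_trans (sn_norm_sum sn _) _ => [i|].
  by apply: (snZ sn); apply: XG; exact: rsum_node.
apply: ler_sum => i _; rewrite (sn_homo sn)//; last by apply: XG; exact: rsum_node.
by rewrite ger0_norm ?divr_ge0.
Qed.

Lemma rsumB (t : R) n (G H : R -> V) : rsum t n G - rsum t n H =
  rsum t n (fun s => G s - H s).
Proof. by rewrite /rsum -sumrB; apply: eq_bigr => i _; rewrite scalerBr. Qed.

(** Riemann sums on [0, s] and on [s, s + t] concatenate to one on
    [0, s + t] whose mesh goes to 0. *)
Lemma is_integral_rsumD (G : R -> V) (s t : R) (I : V) : 0 <= s -> 0 <= t ->
  is_integral N G (s + t) I -> forall e, 0 < e -> exists n0, forall n,
  (n0 < n)%N -> N (rsum s n G + rsum t n (fun x => G (s + x)) - I) < e.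
Proof.
move=> s0 t0 GI e e0; have [d d0 Hd] := GI e e0.
exists (Num.truncn (Num.max s t / d)) => n ltn.
have n0 : (0 < n)%N by exact: leq_ltn_trans ltn.
have nR0 : (0 : R) < n%:R by rewrite ltr0n.
have nne0 : (n%:R : R) != 0 by rewrite gt_eqF.
have mesh : Num.max s t / n%:R < d.
  rewrite ltr_pdivrMr// mulrC -ltr_pdivrMr//.
  by apply: lt_le_trans (truncnS_gt _) _; rewrite ler_nat.
have mesh_s : s / n%:R < d.
  by apply: le_lt_trans mesh; rewrite ler_pM2r ?invr_gt0// le_max lexx.
have mesh_t : t / n%:R < d.
  by apply: le_lt_trans mesh; rewrite ler_pM2r ?invr_gt0// le_max lexx orbT.
pose p i : R := if (i <= n)%N then s * i%:R / n%:R
                else s + t * (i - n)%:R / n%:R.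
have pl i : (i <= n)%N -> p i = s * i%:R / n%:R by rewrite /p => ->.
have pr i : p (n + i)%N = s + t * i%:R / n%:R.
  rewrite /p; case: ifPn => [|_]; last by rewrite addKn.
  rewrite -{2}(addn0 n) leq_add2l leqn0 => /eqP ->.
  by rewrite addn0 mulr0 mul0r addr0 mulfK.
have step_l i : (i < n)%N -> p i.+1 - p i = s / n%:R.
  move=> ltin; rewrite !pl ?(ltnW ltin)// -natr1; field.
  by [].
have step_r i : p (n + i).+1 - p (n + i)%N = t / n%:R.
  rewrite -addnS !pr -natr1; field.
  by [].
have step i : (i < n + n)%N -> 0 <= p i.+1 - p i < d.
  move=> ltin; have [ltn_i|len_i] := ltnP i n.
    by rewrite step_l// mesh_s divr_ge0.
  by rewrite -(subnKC len_i) step_r mesh_t divr_ge0.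
have p0 : p 0%N = 0 by rewrite pl// mulr0 mul0r.
have pn : p (n + n)%N = s + t by rewrite pr mulfK.
have := Hd (n + n)%N p p p0 pn; rewrite big_split_ord/=.
rewrite (_ : \sum_(i < n) _ = rsum s n G); last first.
  by apply: eq_bigr => i _; rewrite step_l// pl// ltnW.
rewrite (_ : \sum_(i < n) _ = rsum t n (fun x => G (s + x))); last first.
  by apply: eq_bigr => i _; rewrite step_r// pr.
apply => i /step /andP[pi pid]; split=> //.
by rewrite lexx/= -subr_ge0.
Qed.

Lemma is_integral_rsum (G : R -> V) (t : R) (I : V) : 0 <= t ->
  is_integral N G t I -> forall e, 0 < e -> exists n0, forall n,
  (n0 < n)%N -> N (rsum t n G - I) < e.
Proof.
move=> t0; rewrite -[X in is_integral _ _ X _](add0r t) => GI e e0.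
have [n0 Hn0] := is_integral_rsumD (lexx 0) t0 GI e0.
exists n0 => n /Hn0; rewrite {1}/rsum big1 ?add0r; last first.
  by move=> i _; rewrite mul0r scale0r.
by rewrite (_ : (fun x => _) = G)//; apply/funext => x; rewrite add0r.
Qed.

End RiemannSums.

(** * Gronwall's lemma for Riemann sums *)

Section Gronwall.
Context (R : realType).

(** In the weighted norm [sup_t expR (- l * t) * phi t] with [l = 2 * B + 1]
    the integral term is a contraction of factor 1/2. *)
Lemma gronwall_rsum (T A B K : R) (phi : R -> R) : 0 <= A -> 0 <= B ->
  (forall t, 0 <= t <= T -> 0 <= phi t <= K) ->
  (forall t, 0 <= t <= T -> forall e, 0 < e -> exists2 n : nat, (0 < n)%N &
     phi t <= A + B * \sum_(i < n) t / n%:R * phi (t * i%:R / n%:R) + e) ->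
  forall t, 0 <= t <= T -> phi t <= 2 * A * expR ((2 * B + 1) * T).
Proof.
move=> A0 B0 phiK Hphi t tT; set l := 2 * B + 1.
have l0 : 0 < l by rewrite /l; lra.
pose E := [set expR (- l * s) * phi s | s in [set s | 0 <= s <= T]].
have Eub : ubound E K.
  move=> _ [s sT <-]; have /andP[p0 pK] := phiK _ sT.
  apply: le_trans pK; rewrite ler_piMl// expR_le1.
  by have /andP[s0 _] := sT; rewrite mulNr oppr_le0 mulr_ge0// ltW.
have Esup : has_sup E.
  by split; [exists (expR (- l * t) * phi t); exists t|exists K].
set Z := sup E.
have ZE s : 0 <= s <= T -> phi s <= Z * expR (l * s).
  move=> sT; rewrite -ler_pdivrMr ?expR_gt0// -expRN mulrC -mulNr.
  by apply: ub_le_sup; [by exists K|exists s].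
have Z0 : 0 <= Z.
  have /andP[p0 _] := phiK _ tT.
  apply: le_trans (_ : expR (- l * t) * phi t <= Z).
    by rewrite mulr_ge0 ?expR_ge0.
  by apply: ub_le_sup; [by exists K|exists t].
(* A left Riemann sum of the increasing function [expR (l * _)] is at most its
   integral, by [1 + x <= expR x] on each interval. *)
have sumE s n : 0 <= s -> (0 < n)%N ->
    \sum_(i < n) s / n%:R * expR (l * (s * i%:R / n%:R)) <= expR (l * s) / l.
  move=> s0 n0; have nne0 : (n%:R : R) != 0 by rewrite pnatr_eq0 -lt0n.
  pose G (i : nat) := expR (l * (s * i%:R / n%:R)) / l.
  apply: (@le_trans _ _ (\sum_(i < n) (G i.+1 - G i))).
    apply: ler_sum => i _; rewrite /G -mulrBl ler_pdivlMr//.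
    have -> : l * (s * i.+1%:R / n%:R) =
              l * (s * i%:R / n%:R) + l * (s / n%:R).
      by rewrite -natr1; field.
    set d := l * (s / n%:R); rewrite expRD; set c := expR (l * _).
    rewrite (_ : s / n%:R * c * l = c * d); last by rewrite /d; ring.
    have : c * d <= c * (expR d - 1).
      by rewrite ler_wpM2l ?expR_ge0//; have := expR_ge1Dx d; lra.
    by rewrite mulrBr mulr1.
  rewrite -(big_mkord xpredT (fun i => G i.+1 - G i)) telescope_sumr//.
  by rewrite /G mulfK// lerBlDr lerDl divr_ge0 ?expR_ge0// ltW.
have ZA : Z <= A + Z / 2.
  apply: ge_sup => [|_ [s sT <-]]; first by case: Esup.
  apply/ler_addgt0Pr => e e0; have [n n0 Hn] := Hphi _ sT _ e0.
  have /andP[s0 sleT] := sT.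
  rewrite mulNr expRN mulrC ler_pdivrMr ?expR_gt0//.
  apply: le_trans Hn _.
  have exp1 : 1 <= expR (l * s) by rewrite -expR0 ler_expR mulr_ge0// ltW.
  have sumZ : \sum_(i < n) s / n%:R * phi (s * i%:R / n%:R) <=
              Z * (expR (l * s) / l).
    apply: le_trans (ler_wpM2l Z0 (sumE s n s0 n0)).
    rewrite mulr_sumr; apply: ler_sum => i _; rewrite mulrCA ler_wpM2l ?divr_ge0//.
    apply: ZE; have /andP[-> /= /le_trans->//] := rsum_node s0 (ltn_ord i).
  have Bl : B / l <= 2^-1 by rewrite ler_pdivrMr// /l; lra.
  have : B * (Z * (expR (l * s) / l)) <= Z / 2 * expR (l * s).
    rewrite (_ : B * _ = B / l * (Z * expR (l * s))); last by ring.
    rewrite (_ : Z / 2 * _ = 2^-1 * (Z * expR (l * s))); last by ring.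
    by rewrite ler_wpM2r// mulr_ge0 ?expR_ge0.
  have := ler_wpM2l B0 sumZ.
  have : A <= A * expR (l * s) by rewrite ler_peMr.
  have : e <= e * expR (l * s) by rewrite ler_peMr// ltW.
  lra.
apply: le_trans (ZE _ tT) _.
apply: ler_pM => //; rewrite ?expR_ge0//; first by lra.
by rewrite ler_expR ler_wpM2l ?(ltW l0)//; case/andP: tT.
Qed.

End Gronwall.

(** * Equality modulo a seminorm *)

Section EqualityModuloSeminorm.
Context (R : realType) (V : lmodType R) (X : set V) (N : V -> R).
Hypothesis sn : seminorm_on X N.

Definition eqN x y := [/\ X x, X y & N (x - y) = 0].

Lemma eqN_refl x : X x -> eqN x x.
Proof. by move=> Xx; split=> //; rewrite subrr (sn_norm0 sn). Qed.

Lemma eqN_sym x y : eqN x y -> eqN y x.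
Proof. by move=> [Xx Xy xy]; split=> //; rewrite (sn_distC sn). Qed.

Lemma eqN_trans y x z : eqN x y -> eqN y z -> eqN x z.
Proof.
move=> [Xx Xy xy] [_ Xz yz]; split=> //; apply/eqP; rewrite eq_le.
rewrite (sn_ge0 sn) ?andbT; last exact: (snB sn).
by have := sn_dist sn Xx Xy Xz; rewrite xy yz addr0.
Qed.

Lemma eqN_lin (c : R) x x' y y' : eqN x x' -> eqN y y' ->
  eqN (c *: x + y) (c *: x' + y').
Proof.
move=> [Xx Xx' xx'] [Xy Xy' yy']; split; try exact: (sn_lin sn).
rewrite opprD addrACA -scalerBr; apply/eqP; rewrite eq_le.
have X1 := snB sn Xx Xx'; have X2 := snB sn Xy Xy'.
rewrite (sn_ge0 sn) ?andbT; last exact: (sn_lin sn).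
have := sn_tri sn (snZ sn c X1) X2.
by rewrite (sn_homo sn)// xx' yy' mulr0 addr0.
Qed.

Lemma eqND x x' y y' : eqN x x' -> eqN y y' -> eqN (x + y) (x' + y').
Proof. by move=> xx' yy'; have := eqN_lin 1 xx' yy'; rewrite !scale1r. Qed.

Lemma eqNZ (c : R) x x' : eqN x x' -> eqN (c *: x) (c *: x').
Proof.
by move=> xx'; have := eqN_lin c xx' (eqN_refl (sn0 sn)); rewrite !addr0.
Qed.

Lemma eqNB x x' y y' : eqN x x' -> eqN y y' -> eqN (x - y) (x' - y').
Proof.
by move=> xx' /(eqNZ (-1)); rewrite !scaleN1r; exact: eqND.
Qed.

Lemma eqN_sum n (F G : 'I_n -> V) : (forall i, eqN (F i) (G i)) ->
  eqN (\sum_(i < n) F i) (\sum_(i < n) G i).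
Proof.
move=> FG; elim/big_rec2 : _ => [|i x y _ xy]; first exact: (eqN_refl (sn0 sn)).
exact: eqND.
Qed.

Lemma eqN_norm x y : eqN x y -> N x = N y.
Proof.
move=> [Xx Xy xy]; apply/eqP; rewrite eq_le.
have := sn_le_dist sn Xx Xy; rewrite xy addr0 => ->.
by have := sn_le_dist sn Xy Xx; rewrite (sn_distC sn)// xy addr0 => ->.
Qed.

End EqualityModuloSeminorm.

(** * Semigroups modulo a seminorm *)

Record semigroup_mod (R : realType) (V : lmodType R) (X : set V) (N : V -> R)
    (S : R -> V -> V) (M : R) : Prop := SemigroupMod {
  sg_M0 : 0 <= M;
  sg_X : forall t x, 0 <= t -> X x -> X (S t x);
  sg_lin : forall t (c : R) x y, 0 <= t -> X x -> X y ->
    N (S t (c *: x + y) - (c *: S t x + S t y)) = 0;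
  sg_le : forall t x, 0 <= t -> X x -> N (S t x) <= M * N x;
  sg_0 : forall x, X x -> N (S 0 x - x) = 0;
  sg_add : forall s t x, 0 <= s -> 0 <= t -> X x ->
    N (S (s + t) x - S s (S t x)) = 0 }.

Section SemigroupTheory.
Context (R : realType) (V : lmodType R) (X : set V) (N : V -> R).
Context (S : R -> V -> V) (M : R).
Hypothesis sn : seminorm_on X N.
Hypothesis sg : semigroup_mod X N S M.

Local Notation eqX := (eqN X N).
Let M0 := sg_M0 sg.

Lemma eq_sg_lin t (c : R) x y : 0 <= t -> X x -> X y ->
  eqX (S t (c *: x + y)) (c *: S t x + S t y).
Proof.
move=> t0 Xx Xy; split; last exact: (sg_lin sg).
  by apply: (sg_X sg) => //; exact: (sn_lin sn).
by apply: (sn_lin sn); exact: (sg_X sg).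
Qed.

Lemma eq_sg0 t : 0 <= t -> eqX (S t 0) 0.
Proof.
move=> t0; have X0 := sn0 sn; split=> //; first exact: (sg_X sg).
apply/eqP; rewrite subr0 eq_le (sn_ge0 sn) ?andbT; last exact: (sg_X sg).
by have := sg_le sg t0 X0; rewrite (sn_norm0 sn) mulr0.
Qed.

Lemma eq_sgZ t (c : R) x : 0 <= t -> X x -> eqX (S t (c *: x)) (c *: S t x).
Proof.
move=> t0 Xx; rewrite -[c *: x]addr0.
apply: (eqN_trans sn (eq_sg_lin c t0 Xx (sn0 sn))).
rewrite -[X in eqN _ _ _ X]addr0; apply: (eqND sn); last exact: eq_sg0.
by apply: (eqN_refl sn); apply: (snZ sn); exact: (sg_X sg).
Qed.

Lemma eq_sgD t x y : 0 <= t -> X x -> X y -> eqX (S t (x + y)) (S t x + S t y).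
Proof. by move=> t0 Xx Xy; have := eq_sg_lin 1 t0 Xx Xy; rewrite !scale1r. Qed.

Lemma eq_sgB t x y : 0 <= t -> X x -> X y -> eqX (S t (x - y)) (S t x - S t y).
Proof.
move=> t0 Xx Xy; have := eq_sg_lin (-1) t0 Xy Xx.
by rewrite !scaleN1r ![- _ + _]addrC.
Qed.

Lemma sg_dist t x y : 0 <= t -> X x -> X y ->
  N (S t x - S t y) <= M * N (x - y).
Proof.
move=> t0 Xx Xy; rewrite -(eqN_norm sn (eq_sgB t0 Xx Xy)).
by apply: (sg_le sg) => //; exact: (snB sn).
Qed.

Lemma eq_sg_add s t x : 0 <= s -> 0 <= t -> X x ->
  eqX (S (s + t) x) (S s (S t x)).
Proof.
move=> s0 t0 Xx; split; last exact: (sg_add sg).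
  by apply: (sg_X sg) => //; exact: addr_ge0.
by apply: (sg_X sg) => //; exact: (sg_X sg).
Qed.

Lemma eq_sg_rsum s t n (G : R -> V) : 0 <= s -> 0 <= t ->
  (forall r, 0 <= r <= t -> X (G r)) ->
  eqX (S s (rsum t n G)) (rsum t n (fun r => S s (G r))).
Proof.
move=> s0 t0 XG; rewrite /rsum.
have : forall i : 'I_n, X (t / n%:R *: G (t * i%:R / n%:R)).
  by move=> i; apply: (snZ sn); apply: XG; exact: rsum_node.
have : forall i : 'I_n, eqX (S s (t / n%:R *: G (t * i%:R / n%:R)))
      (t / n%:R *: S s (G (t * i%:R / n%:R))).
  by move=> i; apply: eq_sgZ => //; apply: XG; exact: rsum_node.
elim: (index_enum _) => [|i r IH] H XH; first by rewrite !big_nil; exact: eq_sg0.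
rewrite !big_cons; apply: (eqN_trans sn (eq_sgD s0 (XH i) _)).
  by elim/big_ind : _ => //; [exact: (sn0 sn)|exact: (snD sn)].
by apply: (eqND sn); [exact: H|exact: IH].
Qed.

End SemigroupTheory.

(** * The generator and the second component *)

Section Generator.
Context (R : realType) (V : lmodType R) (X : set V) (N : V -> R).
Context (S : R -> V -> V) (M : R) (D : set V) (A : V -> V) (P1 P2 : V -> R).
Hypothesis sn : seminorm_on X N.
Hypothesis sg : semigroup_mod X N S M.
Hypotheses (sn1 : seminorm_on X P1) (sn2 : seminorm_on X P2).
Hypothesis P1N : forall x, X x -> P1 x <= N x.
Hypothesis P2N : forall x, X x -> P2 x <= N x.
Hypothesis D_X : forall x, D x -> X x.
Hypothesis D_lin : forall (c : R) x y, D x -> D y -> D (c *: x + y).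
Hypothesis A_X : forall x, D x -> X (A x).

Definition right_derivative_at0 x y := forall e, 0 < e ->
  exists2 d, 0 < d & forall h, 0 < h < d -> N (h^-1 *: (S h x - x) - y) < e.

Hypothesis gen_dom : forall x, D x -> right_derivative_at0 x (A x).
Hypothesis dom_gen : forall x y, X x -> X y -> right_derivative_at0 x y ->
  D x /\ N (y - A x) = 0.
Hypothesis P2A : forall x, D x -> P2 (A x) = P1 x.

Local Notation eqX := (eqN X N).
Let M0 := sg_M0 sg.

Lemma eqP2 x y : eqX x y -> P2 x = P2 y.
Proof.
move=> [Xx Xy xy]; apply: (eqN_norm sn2); split=> //; apply/eqP.
by rewrite eq_le -{1}xy P2N ?(sn_ge0 sn2)//; exact: (snB sn).
Qed.

Lemma second_comp_at0 x : X x -> P2 (S 0 x - x) <= 0.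
Proof.
move=> Xx; rewrite -[leRHS](sg_0 sg Xx); apply: P2N; apply: (snB sn) => //.
exact: (sg_X sg).
Qed.

(** The difference quotients at [S t x] are the images under [S t] of those at
    [x], hence the domain is invariant and the generator commutes with [S t]. *)
Lemma dom_sg t x : 0 <= t -> D x -> D (S t x) /\ eqX (S t (A x)) (A (S t x)).
Proof.
move=> t0 Dx; have Xx := D_X Dx; have XAx := A_X Dx.
have XSx := sg_X sg t0 Xx; have XSAx := sg_X sg t0 XAx.
suff /(dom_gen XSx XSAx)[DSx SAx] : right_derivative_at0 (S t x) (S t (A x)).
  by do 2!split=> //; exact: A_X.
move=> e e0; have M10 : 0 < M + 1 by rewrite ltr_wpDl.
have [d d0 Hd] := gen_dom Dx (divr_gt0 e0 M10).
exists d => // h hd; have /andP[h0 _] := hd; have h0' := ltW h0.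
have XSh := sg_X sg h0' Xx.
have Xdq : X (h^-1 *: (S h x - x)) by apply: (snZ sn); exact: (snB sn).
have -> : N (h^-1 *: (S h (S t x) - S t x) - S t (A x)) =
          N (S t (h^-1 *: (S h x - x)) - S t (A x)).
  apply: (eqN_norm sn); apply: (eqNB sn); last exact: (eqN_refl sn).
  apply: (eqN_sym sn); apply: (eqN_trans sn (eq_sgZ sn sg _ t0 (snB sn XSh Xx))).
  apply: (eqNZ sn); apply: (eqN_trans sn (eq_sgB sn sg t0 XSh Xx)).
  apply: (eqNB sn); last exact: (eqN_refl sn).
  apply: (eqN_trans sn (eqN_sym sn (eq_sg_add sg t0 h0' Xx))).
  by rewrite addrC; exact: (eq_sg_add sg).
apply: le_lt_trans (sg_dist sn sg t0 Xdq XAx) _.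
have := Hd h hd; rewrite ltr_pdivlMr// => {}Hd.
have := sn_ge0 sn (snB sn Xdq XAx); lra.
Qed.

(** Telescoping over [S (i * k) x], the increment of the second component on
    a short interval is [k * P1 (S (i * k) x)] up to [o(k)], because the
    generator turns the second component into the first one. *)
Lemma second_comp_lipschitz_dom x h B : 0 <= h -> D x ->
  (forall s, 0 <= s <= h -> P1 (S s x) <= B) -> P2 (S h x - x) <= h * B.
Proof.
move=> h0 Dx HB; have Xx := D_X Dx; have XAx := A_X Dx.
have [->|hn0] := eqVneq h 0.
  by rewrite mul0r; exact: second_comp_at0.
have {h0 hn0} h0 : 0 < h by rewrite lt_neqAle eq_sym hn0.
apply/ler_addgt0Pr => e e0; pose e1 := e / (h * (M + 1)).
have e10 : 0 < e1 by rewrite divr_gt0// mulr_gt0// ltr_wpDl.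
have [d d0 Hd] := gen_dom Dx e10.
pose n := (Num.truncn (h / d)).+1; have nR0 : (0 : R) < n%:R by rewrite ltr0n.
have kd : h / n%:R < d.
  by rewrite ltr_pdivrMr// mulrC -ltr_pdivrMr//; exact: truncnS_gt.
set k := h / n%:R in kd; have k0 : 0 < k by exact: divr_gt0.
have XSk := sg_X sg (ltW k0) Xx.
have first_step : N (S k x - x - k *: A x) <= k * e1.
  have := Hd k; rewrite k0 kd => /(_ isT) /ltW.
  rewrite -(ler_pM2l k0) -{1}(gtr0_norm k0) -(sn_homo sn).
    by rewrite scalerBr scalerA divff ?scale1r// gt_eqF.
  by apply: (snB sn) => //; apply: (snZ sn); exact: (snB sn).
suff H i : (i <= n)%N -> P2 (S (i%:R * k) x - x) <= i%:R * k * (B + M * e1).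
  have := H n (leqnn n); rewrite /k mulrCA divff ?gt_eqF// mulr1 => /le_trans.
  have : h * (M * e1) + h * e1 = e.
    by rewrite /e1; field; rewrite !gt_eqF// ltr_wpDl.
  have : 0 < h * e1 by rewrite mulr_gt0.
  by move=> he1 hMe; apply; lra.
elim: i => [_|i IH lein].
  by rewrite !mul0r; exact: second_comp_at0.
have ik0 : 0 <= i%:R * k by rewrite mulr_ge0// ltW.
have XSi := sg_X sg ik0 Xx.
have XSi1 : X (S (i.+1%:R * k) x) by apply: (sg_X sg) => //; rewrite mulr_ge0 ?(ltW k0).
apply: le_trans (sn_dist sn2 XSi1 XSi Xx) _.
have -> : i.+1%:R * k * (B + M * e1) =
          k * (B + M * e1) + i%:R * k * (B + M * e1).
  by rewrite -natr1; ring.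
apply: lerD; last exact/IH/ltnW.
have [DSi SAi] := dom_sg ik0 Dx.
have XSAi := sg_X sg ik0 XAx.
apply: le_trans (sn_le_dist sn2 (snB sn XSi1 XSi) (snZ sn k XSAi)) _.
have XkA := snZ sn k XAx.
rewrite mulrDr; apply: lerD.
  rewrite (sn_homo sn2)// gtr0_norm// ler_wpM2l ?(ltW k0)//.
  rewrite (eqP2 SAi) P2A//; apply: HB; rewrite ik0/=.
  rewrite /k mulrA ler_pdivrMr// mulrC ler_wpM2l ?(ltW h0)// ler_nat.
  exact: ltnW.
apply: le_trans (P2N _) _; first by do ?apply: (snB sn) => //; exact: (snZ sn).
have -> : N (S (i.+1%:R * k) x - S (i%:R * k) x - k *: S (i%:R * k) (A x)) =
          N (S (i%:R * k) (S k x - x) - S (i%:R * k) (k *: A x)).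
  apply: (eqN_norm sn); apply: (eqNB sn); last first.
    by apply: (eqN_sym sn); exact: (eq_sgZ sn sg).
  apply: (eqN_sym sn); apply: (eqN_trans sn (eq_sgB sn sg ik0 XSk Xx)).
  apply: (eqNB sn); last exact: (eqN_refl sn).
  rewrite -natr1 mulrDl mul1r; apply: (eqN_sym sn).
  by apply: (eq_sg_add sg) => //; exact: ltW.
apply: le_trans (sg_dist sn sg ik0 (snB sn XSk Xx) XkA) _.
by rewrite mulrCA ler_wpM2l.
Qed.

(** The estimate of the second component extends to this closure, so that no
    density of the domain in the whole space is required. *)
Definition closure_dom : set V :=
  [set x | X x /\ forall e, 0 < e -> exists2 x', D x' & N (x - x') < e].

Local Notation clD := closure_dom.

Lemma clD_X x : clD x -> X x. Proof. by case. Qed.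

Lemma clD_dom x : D x -> clD x.
Proof.
move=> Dx; split; first exact: D_X.
by move=> e e0; exists x => //; rewrite subrr (sn_norm0 sn).
Qed.

Lemma clD_lim x : X x ->
  (forall e, 0 < e -> exists2 x', clD x' & N (x - x') < e) -> clD x.
Proof.
move=> Xx Hx; split=> // e e0.
have e20 : 0 < e / 2 by rewrite divr_gt0.
have [x' [Xx' Dx'] xx'] := Hx _ e20.
have [x2 Dx2 xx2] := Dx' _ e20; exists x2 => //.
by have := sn_dist sn Xx Xx' (D_X Dx2); lra.
Qed.

Lemma clD_lin (c : R) x y : clD x -> clD y -> clD (c *: x + y).
Proof.
move=> [Xx Dx] [Xy Dy]; split; first exact: (sn_lin sn).
move=> e e0; have c10 : 0 < `|c| + 1 by rewrite ltr_wpDl.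
have [x' Dx' xx'] := Dx (e / 2 / (`|c| + 1)) ltac:(by rewrite !divr_gt0).
have [y' Dy' yy'] := Dy (e / 2) ltac:(by rewrite !divr_gt0).
exists (c *: x' + y'); first exact: D_lin.
have Xx' := snB sn Xx (D_X Dx'); have Xy' := snB sn Xy (D_X Dy').
rewrite opprD addrACA -scalerBr.
have := sn_tri sn (snZ sn c Xx') Xy'; rewrite (sn_homo sn)//.
have : `|c| * N (x - x') <= e / 2.
  rewrite ltr_pdivlMr// in xx'; apply: le_trans (ltW xx').
  by rewrite mulrC ler_wpM2l ?lerDl// (sn_ge0 sn).
lra.
Qed.

Lemma clD_rsum t n (G : R -> V) : D 0 -> 0 <= t ->
  (forall s, 0 <= s <= t -> clD (G s)) -> clD (rsum t n G).
Proof.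
move=> D0 t0 DG; have cl0 := clD_dom D0.
rewrite /rsum; elim/big_ind : _ => // [x y Dx Dy|i _].
  by rewrite -[x]scale1r; exact: clD_lin.
rewrite -[_ *: _]addr0; apply: clD_lin => //.
by apply: DG; exact: rsum_node.
Qed.

Lemma clD_sg t x : 0 <= t -> clD x -> clD (S t x).
Proof.
move=> t0 [Xx Dx]; split; first exact: (sg_X sg).
move=> e e0; have M10 : 0 < M + 1 by rewrite ltr_wpDl.
have [x' Dx' xx'] := Dx _ (divr_gt0 e0 M10); exists (S t x').
  by have [] := dom_sg t0 Dx'.
have Xx' := D_X Dx'; apply: le_lt_trans (sg_dist sn sg t0 Xx Xx') _.
rewrite ltr_pdivlMr// in xx'.
have := sn_ge0 sn (snB sn Xx Xx'); lra.
Qed.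

Lemma second_comp_lipschitz x h B : 0 <= h -> clD x ->
  (forall s, 0 <= s <= h -> P1 (S s x) <= B) -> P2 (S h x - x) <= h * B.
Proof.
move=> h0 [Xx Dx] HB; apply/ler_addgt0Pr => e e0.
pose K := h * M + M + 1; have K0 : 0 < K.
  by rewrite /K ltr_wpDl// addr_ge0// mulr_ge0.
have [x' Dx' xx'] := Dx _ (divr_gt0 e0 K0); have Xx' := D_X Dx'.
set d := N (x - x') in xx'; have d0 : 0 <= d by rewrite (sn_ge0 sn)//; exact: (snB sn).
have H : P2 (S h x' - x') <= h * (B + M * d).
  apply: second_comp_lipschitz_dom => // s sh; have /andP[s0 _] := sh.
  have XS := sg_X sg s0 Xx; have XS' := sg_X sg s0 Xx'.
  apply: le_trans (sn_le_dist sn1 XS' XS) _; apply: lerD; first exact: HB.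
  apply: le_trans (P1N (snB sn XS' XS)) _.
  by rewrite (sn_distC sn)//; exact: (sg_dist sn sg).
have XS := sg_X sg h0 Xx; have XS' := sg_X sg h0 Xx'.
have dS : P2 (S h x - S h x') <= M * d.
  apply: le_trans (P2N (snB sn XS XS')) _; exact: (sg_dist sn sg).
have dx : P2 (x' - x) <= d.
  by rewrite (sn_distC sn2)//; apply: P2N; exact: (snB sn).
have := sn_dist sn2 XS XS' Xx; have := sn_dist sn2 XS' Xx' Xx.
have : d * K <= e by rewrite -ler_pdivlMr// ltW.
rewrite /K; lra.
Qed.

Section MildSolution.
Context (T F B : R) (f y : R -> V) (x0 : V).
Hypotheses (D0 : D 0) (clx0 : clD x0).
Hypothesis clf : forall s, 0 <= s <= T -> clD (f s).
Hypothesis fF : forall s, 0 <= s <= T -> N (f s) <= F.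
Hypothesis f2 : forall s, 0 <= s <= T -> P2 (f s) = 0.
Hypothesis Xy : forall t, 0 <= t <= T -> X (y t).
Hypothesis yB : forall t, 0 <= t <= T -> P1 (y t) <= B.
Hypothesis mild : forall t, 0 <= t <= T ->
  is_integral N (fun s => S (t - s) (f s)) t (y t - S t x0).

Let clX x : clD x -> X x := @clD_X x.
Let Xf s : 0 <= s <= T -> X (f s). Proof. by move=> /clf/clX. Qed.

(** A mild solution can be restarted at time [t], the integral over [t, t + k]
    being expressed by Riemann sums since it need not exist on its own. *)
Lemma mild_restart t k : 0 <= t -> 0 <= k -> t + k <= T ->
  forall e, 0 < e -> exists n : nat,
  N (y (t + k) - (S k (y t) + rsum k n (fun s => S (k - s) (f (t + s))))) < e.
Proof.
move=> t0 k0 tkT e e0.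
have tT : 0 <= t <= T by rewrite t0 (le_trans _ tkT)// lerDl.
have tk0 : 0 <= t + k by exact: addr_ge0.
have tkT' : 0 <= t + k <= T by rewrite tk0.
pose e1 := e / (M + 1).
have M10 : 0 < M + 1 by rewrite ltr_wpDl.
have e10 : 0 < e1 by rewrite divr_gt0.
have [n1 H1] := is_integral_rsumD t0 k0 (mild tkT') e10.
have [n2 H2] := is_integral_rsum t0 (mild tT) e10.
pose n := (maxn n1 n2).+1; exists n.
have {}H1 := H1 n ltac:(by rewrite ltnS leq_maxl).
have {}H2 := H2 n ltac:(by rewrite ltnS leq_maxr).
set R1 := rsum t n _ in H1; set R2 := rsum k n _ in H1; set R1' := rsum t n _ in H2.
have -> : rsum k n (fun s => S (k - s) (f (t + s))) = R2.
  by apply: eq_bigr => i _ /=; congr (_ *: S _ _); ring.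
have Xfs s : 0 <= s <= t -> X (f s).
  by move=> /andP[s0 st]; apply: Xf; rewrite s0 (le_trans st)//; case/andP: tT.
have XG s : 0 <= s <= t -> X (S (t - s) (f s)).
  by move=> st; apply: (sg_X sg); [rewrite subr_ge0; case/andP: st|exact: Xfs].
have XR1' : X R1' by exact: (rsum_in sn).
have XR2 : X R2.
  apply: (rsum_in sn) => // s /andP[s0 sk].
  rewrite opprD addrACA subrr add0r; apply: (sg_X sg); first by rewrite subr_ge0.
  by apply: Xf; rewrite addr_ge0//= (le_trans _ tkT)// lerD2l.
have R1E : eqX R1 (S k R1').
  apply: (eqN_sym sn); apply: (eqN_trans sn (eq_sg_rsum sn sg n k0 t0 XG)).
  apply: (eqN_sum sn) => i; apply: (eqNZ sn).
  have it := rsum_node t0 (ltn_ord i); set s := t * i%:R / n%:R in it *.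
  rewrite [t + k]addrC -addrA; apply: (eqN_sym sn); apply: (eq_sg_add sg) => //.
    by rewrite subr_ge0; case/andP: it.
  exact: Xfs.
have Xx0 := clX clx0.
have Xyt := Xy tT; have Xytk := Xy tkT'.
have XSx0 := sg_X sg t0 Xx0; have XStk := sg_X sg tk0 Xx0.
have XSR1' := sg_X sg k0 XR1'; have XR1 : X R1 by case: R1E.
have XSy := sg_X sg k0 Xyt.
have H3 : N (S k (y t) - S (t + k) x0 - R1) <= M * e1.
  have -> : N (S k (y t) - S (t + k) x0 - R1) =
            N (S k (y t - S t x0) - S k R1').
    apply: (eqN_norm sn); apply: (eqNB sn) => //.
    apply: (eqN_sym sn); apply: (eqN_trans sn (eq_sgB sn sg k0 Xyt XSx0)).
    apply: (eqNB sn); first exact: (eqN_refl sn).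
    by apply: (eqN_sym sn); rewrite addrC; exact: (eq_sg_add sg).
  apply: le_trans (sg_dist sn sg k0 (snB sn Xyt XSx0) XR1') _.
  by rewrite (sn_distC sn) ?ler_wpM2l ?(ltW H2)//; exact: (snB sn).
have -> : y (t + k) - (S k (y t) + R2) =
   (y (t + k) - S (t + k) x0 - (R1 + R2)) - (S k (y t) - S (t + k) x0 - R1).
  set p := y (t + k) - _; set a := S k (y t); set b := S (t + k) x0 in p *.
  rewrite [- (a - b - R1)]opprB [R1 - _]addrC addrACA [- (R1 + R2)]opprD.
  rewrite [- R1 - R2 + R1]addrAC addNr add0r /p opprB addrA subrK.
  by rewrite opprD addrA.
have XI := snB sn Xytk XStk.
apply: le_lt_trans (sn_triB sn (snB sn XI _) (snB sn (snB sn XSy XStk) XR1)) _.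
  exact: (snD sn).
rewrite (sn_distC sn)//; last exact: (snD sn).
have : (M + 1) * e1 = e by rewrite /e1 mulrCA divff ?mulr1// gt_eqF.
lra.
Qed.

(** On a short step, the orbit of [y t] has a first component within [k * M * F]
    of that of [y], and the forcing, which has no second component itself, needs
    the time [k] to build one: both errors are of second order in [k]. *)
Lemma mild_second_comp_step t k : 0 <= t -> 0 <= k -> t + k <= T ->
  P2 (y (t + k) - y t) <= k * (B + 2 * (k * (M * F))).
Proof.
move=> t0 k0 tkT; have tT : 0 <= t <= T.
  by rewrite t0 (le_trans _ tkT)// lerDl.
have F0 : 0 <= F.
  by apply: le_trans (fF tT); apply: (sn_ge0 sn); exact: Xf.
have tk0 : 0 <= t + k by exact: addr_ge0.
have tkT' : 0 <= t + k <= T by rewrite tk0.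
have Xyt := Xy tT; have Xytk := Xy tkT'.
have fts s : 0 <= s <= k -> 0 <= t + s <= T.
  by move=> /andP[s0 sk]; rewrite addr_ge0//= (le_trans _ tkT)// lerD2l.
have XSf s r : 0 <= s <= k -> 0 <= r <= s -> X (S (s - r) (f (t + r))).
  move=> /andP[s0 sk] /andP[r0 rs]; apply: (sg_X sg); first by rewrite subr_ge0.
  by apply/Xf/fts; rewrite r0 (le_trans rs).
have SfF s r : 0 <= s <= k -> 0 <= r <= s ->
    N (S (s - r) (f (t + r))) <= M * F.
  move=> /andP[s0 sk] /andP[r0 rs].
  have ft : 0 <= t + r <= T by apply: fts; rewrite r0 (le_trans rs).
  apply: le_trans (sg_le sg _ (Xf ft)) _; first by rewrite subr_ge0.
  by rewrite ler_wpM2l// fF.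
have P1S s : 0 <= s <= k -> P1 (S s (y t)) <= B + k * (M * F).
  move=> sk; have /andP[s0 slek] := sk.
  apply/ler_addgt0Pr => e e0.
  have [n Hn] := mild_restart t0 s0 (le_trans (lerD (lexx t) slek) tkT) e0.
  set R2 := rsum s n _ in Hn.
  have XR2 : X R2 by apply: (rsum_in sn) => // r rs; exact: XSf.
  have XS := sg_X sg s0 Xyt; have Xyts := Xy (fts s sk).
  have R2le : P1 R2 <= s * (M * F).
    apply: (norm_rsum_le sn1); rewrite ?mulr_ge0// => r rs; split; first exact: XSf.
    apply: le_trans (P1N (XSf s r sk rs)) _; exact: SfF.
  have skF : s * (M * F) <= k * (M * F) by rewrite ler_wpM2r// mulr_ge0.
  have -> : S s (y t) = y (t + s) - R2 - (y (t + s) - (S s (y t) + R2)).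
    by rewrite opprB addrC addrA subrK addrK.
  have XD : X (y (t + s) - (S s (y t) + R2)).
    by apply: (snB sn) => //; exact: (snD sn).
  apply: le_trans (sn_triB sn1 (snB sn Xyts XR2) XD) _.
  have := sn_triB sn1 Xyts XR2; have := P1N XD; have := yB (fts s sk); lra.
have XS := sg_X sg k0 Xyt.
have clyt : clD (y t).
  apply: clD_lim => // e e0; have [n0 /(_ n0.+1 (ltnSn _)) Hn] :=
    is_integral_rsum t0 (mild tT) e0.
  set Q := rsum _ _ _ in Hn.
  have clQ : clD Q.
    apply: clD_rsum => // s /andP[s0 st]; apply: clD_sg; first by rewrite subr_ge0.
    by apply: clf; rewrite s0 (le_trans st)//; case/andP: tT.
  exists (Q + S t x0).
    by rewrite -[Q]scale1r; apply: clD_lin => //; exact: clD_sg.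
  have XStx0 : X (S t x0) by apply: (sg_X sg) => //; exact: clX.
  rewrite (sn_distC sn)//; last by apply: (snD sn) => //; exact: clX.
  by rewrite opprB addrA in Hn; rewrite [_ + S t x0 - _]addrAC addrAC in Hn *.
have H1 := second_comp_lipschitz k0 clyt P1S.
apply/ler_addgt0Pr => e e0; have [n Hn] := mild_restart t0 k0 tkT e0.
set R2 := rsum k n _ in Hn.
have kk : 0 <= k <= k by rewrite k0/=.
have XR2 : X R2 by apply: (rsum_in sn) => // r rs; exact: XSf.
have H2 : P2 R2 <= k * (k * (M * F)).
  apply: (norm_rsum_le sn2); rewrite ?mulr_ge0// => r rs; split; first exact: XSf.
  have /andP[r0 rk] := rs; have ft := fts r rs; have Xft := Xf ft.
  have kr0 : 0 <= k - r by rewrite subr_ge0.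
  have XSr := XSf k r kk rs.
  apply: le_trans (sn_le_dist sn2 XSr Xft) _; rewrite f2// add0r.
  apply: le_trans (second_comp_lipschitz (B := M * F) kr0 (clf ft) _) _.
    move=> s /andP[s0 _]; apply: le_trans (P1N (sg_X sg s0 Xft)) _.
    by apply: le_trans (sg_le sg s0 Xft) _; rewrite ler_wpM2l// fF.
  by rewrite ler_wpM2r ?mulr_ge0// gerBl.
have XSR := snD sn XS XR2.
have := sn_dist sn2 Xytk XSR Xyt; have := P2N (snB sn Xytk XSR).
have : P2 (S k (y t) + R2 - y t) <= P2 (S k (y t) - y t) + P2 R2.
  by rewrite addrAC; apply: (sn_tri sn2) => //; exact: (snB sn).
lra.
Qed.

(** The second component of a mild solution moves with speed at most the size
    of the first one, whatever the size of the forcing: the forcing enters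
    [mild_second_comp_step] to second order, hence drops out when [0, h] is cut
    into ever shorter steps. *)
Lemma mild_second_comp_lipschitz t h : 0 <= t -> 0 <= h -> t + h <= T ->
  P2 (y (t + h) - y t) <= h * B.
Proof.
move=> t0 h0 thT; have tT : 0 <= t <= T.
  by rewrite t0 (le_trans _ thT)// lerDl.
have F0 : 0 <= F.
  by apply: le_trans (fF tT); apply: (sn_ge0 sn); exact: Xf.
apply/ler_addgt0Pr => e e0.
pose K := 2 * (h * (h * (M * F))).
pose n := (Num.truncn (K / e)).+1; have nR0 : (0 : R) < n%:R by rewrite ltr0n.
have Kn : K / n%:R <= e.
  by rewrite ler_pdivrMr// mulrC -ler_pdivrMr//; apply: ltW; exact: truncnS_gt.
pose k := h / n%:R; have k0 : 0 <= k by exact: divr_ge0.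
have ikh i : (i <= n)%N -> i%:R * k <= h.
  move=> lein; rewrite /k mulrCA ler_piMr// ler_pdivrMr// mul1r ler_nat.
  exact: lein.
have Xyi i : (i <= n)%N -> X (y (t + i%:R * k)).
  move=> lein; apply: Xy; rewrite addr_ge0 ?mulr_ge0//=.
  by apply: le_trans thT; rewrite lerD2l ikh.
suff H i : (i <= n)%N ->
    P2 (y (t + i%:R * k) - y t) <= i%:R * (k * (B + 2 * (k * (M * F)))).
  have := H n (leqnn n).
  rewrite (_ : n%:R * k = h); last by rewrite /k mulrCA divff ?mulr1// gt_eqF.
  rewrite (_ : n%:R * _ = h * B + K / n%:R); first lra.
  by rewrite /K /k; field; rewrite gt_eqF.
elim: i => [_|i IH lein].
  by rewrite !mul0r addr0 subrr (sn_norm0 sn2).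
have Xyt := Xy tT; have lein' := ltnW lein.
apply: le_trans (sn_dist sn2 (Xyi _ lein) (Xyi _ lein') Xyt) _.
rewrite -[X in _ <= X * _]natr1 mulrDl mul1r addrC.
apply: lerD; first exact: IH.
rewrite -natr1 mulrDl mul1r addrA; apply: mild_second_comp_step => //.
  by rewrite addr_ge0 ?mulr_ge0.
apply: le_trans thT; rewrite -addrA lerD2l.
by have := ikh _ lein; rewrite -natr1 mulrDl mul1r.
Qed.

End MildSolution.
End Generator.

(** * Growth and increments of solutions of the linear equation *)

Lemma is_integralB (R : realType) (V : lmodType R) (X : set V) (N : V -> R)
    (sn : seminorm_on X N) (G1 G2 G : R -> V) (t : R) (I1 I2 I : V) :
  (forall s, 0 <= s <= t -> eqN X N (G1 s - G2 s) (G s) /\ X (G1 s) /\ X (G2 s)) ->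
  X I1 -> X I2 -> eqN X N (I1 - I2) I ->
  is_integral N G1 t I1 -> is_integral N G2 t I2 -> is_integral N G t I.
Proof.
move=> GG XI1 XI2 II H1 H2 e e0; have e20 : 0 < e / 2 by rewrite divr_gt0.
have [d1 d10 {}H1] := H1 _ e20; have [d2 d20 {}H2] := H2 _ e20.
exists (Num.min d1 d2) => [|n p xi p0 pn pxi]; first by rewrite lt_min d10.
have mono i : (i <= n)%N -> 0 <= p i.
  elim: i => [_|i IH lein]; first by rewrite p0.
  have [/andP[pi pi1] _] := pxi _ lein.
  by apply: le_trans (IH (ltnW lein)) _; exact: le_trans pi1.
have mono' i : (i <= n)%N -> p (n - i)%N <= t.
  elim: i => [_|i IH lein]; first by rewrite subn0 pn.
  have lt1 : (n - i.+1 < n)%N by rewrite ltn_subrL (leq_trans _ lein).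
  have [/andP[pi pi1] _] := pxi _ lt1.
  apply: le_trans (IH (ltnW lein)); rewrite -(subnSK lein).
  exact: le_trans pi1.
have xit i : (i < n)%N -> 0 <= xi i <= t.
  move=> ltin; have [/andP[pi pi1] _] := pxi _ ltin.
  rewrite (le_trans (mono _ (ltnW ltin)) pi)/= (le_trans pi1)//.
  by have := mono' _ (leq_subr i.+1 n); rewrite subKn.
have {}H1 := H1 n p xi p0 pn _; have {}H2 := H2 n p xi p0 pn _.
have {}H1 : N (\sum_(i < n) (p i.+1 - p i) *: G1 (xi i) - I1) < e / 2.
  by apply: H1 => i /pxi [? ]; rewrite lt_min => /andP[].
have {}H2 : N (\sum_(i < n) (p i.+1 - p i) *: G2 (xi i) - I2) < e / 2.
  by apply: H2 => i /pxi [? ]; rewrite lt_min => /andP[].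
have XG i : (i < n)%N -> X (G1 (xi i)) /\ X (G2 (xi i)).
  by move=> /xit /GG [].
have XS1 : X (\sum_(i < n) (p i.+1 - p i) *: G1 (xi i) - I1).
  apply: (snB sn) => //; apply: (sn_sum sn) => i; apply: (snZ sn).
  by have [] := XG _ (ltn_ord i).
have XS2 : X (\sum_(i < n) (p i.+1 - p i) *: G2 (xi i) - I2).
  apply: (snB sn) => //; apply: (sn_sum sn) => i; apply: (snZ sn).
  by have [] := XG _ (ltn_ord i).
rewrite -(eqN_norm sn (x := (\sum_(i < n) (p i.+1 - p i) *: G1 (xi i) - I1) -
  (\sum_(i < n) (p i.+1 - p i) *: G2 (xi i) - I2))).
  by have := sn_triB sn XS1 XS2; lra.
rewrite opprD addrACA -opprD -sumrB; apply: (eqNB sn) => //.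
apply: (eqN_sum sn) => i; rewrite -scalerBr; apply: (eqNZ sn).
by have [] := GG _ (xit _ (ltn_ord i)).
Qed.

Section Perturbation.
Context (R : realType) (V : lmodType R) (X : set V) (N : V -> R).
Context (S : R -> V -> V) (M : R) (T K b : R) (g z : R -> V).
Hypothesis sn : seminorm_on X N.
Hypothesis sg : semigroup_mod X N S M.
Hypothesis b0 : 0 <= b.
Hypothesis Xg : forall s, 0 <= s <= T -> X (g s).
Hypothesis Xz : forall s, 0 <= s <= T -> X (z s).
Hypothesis zK : forall s, 0 <= s <= T -> N (z s) <= K.
Hypothesis z_mild : forall t, 0 <= t <= T ->
  is_integral N (fun s => S (t - s) (g s)) t (z t).

Let M0 := sg_M0 sg.

Lemma affine_rsum_le (a t : R) n (G : R -> V) (phi : R -> R) : 0 <= t ->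
  (forall s, 0 <= s <= t -> X (G s)) ->
  (forall s, 0 <= s <= t -> N (G s) <= a + b * phi s) ->
  N (rsum t n (fun s => S (t - s) (G s))) <=
  t * (M * `|a|) + M * b * \sum_(i < n) t / n%:R * phi (t * i%:R / n%:R).
Proof.
move=> t0 XG Ga.
have ts s : 0 <= s <= t -> 0 <= t - s by rewrite subr_ge0 => /andP[].
apply: le_trans (norm_rsum sn _ t0 _) _ => [s st|].
  by apply: (sg_X sg); [exact: ts|exact: XG].
case: n => [|n].
  by rewrite !big_ord0 mulr0 addr0 !mulr_ge0.
apply: (@le_trans _ _ (\sum_(i < n.+1) (t / n.+1%:R * (M * `|a|) +
    M * b * (t / n.+1%:R * phi (t * i%:R / n.+1%:R))))).
  apply: ler_sum => i _; have it := rsum_node t0 (ltn_ord i).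
  set s := t * i%:R / _ in it *.
  apply: (@le_trans _ _ (t / n.+1%:R * (M * (a + b * phi s)))).
    rewrite ler_wpM2l ?divr_ge0//; apply: le_trans (sg_le sg (ts _ it) (XG _ it)) _.
    by rewrite ler_wpM2l// Ga.
  rewrite !mulrDr (_ : M * b * _ = t / n.+1%:R * (M * (b * phi s))); last by ring.
  by rewrite lerD2r ler_wpM2l ?divr_ge0// ler_wpM2l// ler_norm.
rewrite big_split/= mulr_sumr lerD2r sumr_const card_ord.
by rewrite -[leLHS]mulr_natl mulrA [_%:R * _]mulrC divfK.
Qed.

Lemma mild_gronwall (a : R) : 0 <= a ->
  (forall s, 0 <= s <= T -> N (g s) <= a + b * N (z s)) ->
  forall t, 0 <= t <= T ->
  N (z t) <= 2 * (T * (M * a)) * expR ((2 * (M * b) + 1) * T).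
Proof.
move=> a0 ga t tT; have T0 : 0 <= T by case/andP: tT => /le_trans; exact.
apply: (@gronwall_rsum _ T _ _ K (fun s => N (z s))) => //; rewrite ?mulr_ge0//.
  by move=> s sT; rewrite zK// (sn_ge0 sn)//; exact: Xz.
move=> {tT}{}t tT e e0; have /andP[t0 tleT] := tT.
have [n0 /(_ n0.+1 (ltnSn _)) Hn] := is_integral_rsum t0 (z_mild tT) e0.
exists n0.+1 => //.
have sT s : 0 <= s <= t -> 0 <= s <= T.
  by move=> /andP[-> /=] /le_trans; exact.
have H := affine_rsum_le n0.+1 t0 (fun s st => Xg (sT s st))
  (fun s st => ga s (sT s st)).
set Q := rsum _ _ _ in Hn H.
have XQ : X Q.
  apply: (rsum_in sn) => // s st; apply: (sg_X sg); last exact/Xg/sT.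
  by rewrite subr_ge0; case/andP: st.
have := sn_le_dist sn (Xz tT) XQ; rewrite (sn_distC sn)//; last exact: Xz.
have : t * (M * `|a|) <= T * (M * a).
  by rewrite ger0_norm// ler_wpM2r// mulr_ge0.
lra.
Qed.

(** The integral over [0, h] is bounded by its length; the one over [0, t] is
    fed into Gronwall's lemma for the increments [z (s + h) - z s]. *)
Lemma mild_gronwall_shift (h G a : R) : 0 <= h <= T -> 0 <= G -> 0 <= a ->
  (forall s, 0 <= s <= T -> N (g s) <= G) ->
  (forall s, 0 <= s -> s + h <= T ->
     N (g (s + h) - g s) <= a + b * N (z (s + h) - z s)) ->
  forall t, 0 <= t -> t + h <= T ->
  N (z (t + h) - z t) <=
    2 * (h * (M * G) + T * (M * a)) * expR ((2 * (M * b) + 1) * T).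
Proof.
move=> /andP[h0 hT] G0 a0 gG ga t t0 thT.
have T0 : 0 <= T by exact: le_trans hT.
have shT s : 0 <= s <= T - h -> [/\ 0 <= s, s + h <= T, 0 <= s <= T &
    0 <= s + h <= T].
  move=> /andP[s0 sTh]; have sT : s + h <= T by lra.
  by rewrite s0 sT addr_ge0//=; split=> //; lra.
have XD s : 0 <= s <= T - h -> X (z (s + h) - z s).
  by move=> /shT[_ _ s1 s2]; apply: (snB sn); exact: Xz.
pose A := h * (M * G) + T * (M * a).
have A0 : 0 <= A by rewrite addr_ge0 ?mulr_ge0.
apply: (@le_trans _ _ (2 * A * expR ((2 * (M * b) + 1) * (T - h)))); last first.
  rewrite ler_wpM2l ?mulr_ge0// ler_expR ler_wpM2l ?gerBl//.
  by rewrite addr_ge0 ?mulr_ge0.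
apply: (@gronwall_rsum _ (T - h) _ _ (K + K)
  (fun s => N (z (s + h) - z s))) => //; rewrite ?mulr_ge0//; last first.
- by rewrite t0/= lerBrDr.
- move=> {thT}{}t {t0} tTh e e0.
  have [t0 thT tT thT'] := shT _ tTh.
  have e20 : 0 < e / 2 by rewrite divr_gt0.
  have I1 := z_mild thT'; rewrite [t + h]addrC in I1.
  have [n1 H1] := is_integral_rsumD h0 t0 I1 e20.
  have [n2 H2] := is_integral_rsum t0 (z_mild tT) e20.
  pose n := (maxn n1 n2).+1; exists n => //.
  have {}H1 := H1 n ltac:(by rewrite ltnS leq_maxl).
  have {}H2 := H2 n ltac:(by rewrite ltnS leq_maxr).
  set R1 := rsum h n _ in H1; set R2 := rsum t n _ in H1.
  set R2' := rsum t n _ in H2.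
  have R2E : R2 = rsum t n (fun s => S (t - s) (g (s + h))).
    apply: eq_bigr => i _; rewrite [h + _ * _ / _]addrC.
    by congr (_ *: S _ _); ring.
  have tsT s : 0 <= s <= t -> 0 <= s <= T - h.
    move=> /andP[-> /= st]; apply: le_trans st _; lra.
  have Xg1 s : 0 <= s <= t -> X (g (s + h)).
    by move=> /tsT/shT[_ _ _]; exact: Xg.
  have Xg2 s : 0 <= s <= t -> X (g s).
    by move=> /tsT/shT[_ _ + _]; exact: Xg.
  have ts s : 0 <= s <= t -> 0 <= t - s by rewrite subr_ge0 => /andP[].
  have XR2 : X R2.
    by rewrite R2E; apply: (rsum_in sn) => // s st; apply: (sg_X sg); [exact: ts|exact: Xg1].
  have XR2' : X R2'.
    by apply: (rsum_in sn) => // s st; apply: (sg_X sg); [exact: ts|exact: Xg2].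
  have XGs s : 0 <= s <= h -> X (S (h + t - s) (g s)).
    move=> /andP[s0 sh]; apply: (sg_X sg); first lra.
    by apply: Xg; rewrite s0 (le_trans sh).
  have XR1 : X R1 by exact: (rsum_in sn).
  have R1le : N R1 <= h * (M * G).
    apply: (norm_rsum_le sn) => //; first exact: mulr_ge0.
    move=> s sh; split; first exact: XGs.
    have /andP[s0 slh] := sh; have sT : 0 <= s <= T by rewrite s0 (le_trans slh).
    apply: le_trans (sg_le sg _ (Xg sT)) _; first lra.
    by rewrite ler_wpM2l// gG.
  have R2le : N (R2 - R2') <= t * (M * `|a|) + M * b * \sum_(i < n) t / n%:R *
      N (z (t * i%:R / n%:R + h) - z (t * i%:R / n%:R)).
    have -> : N (R2 - R2') =
        N (rsum t n (fun s => S (t - s) (g (s + h) - g s))).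
      rewrite R2E rsumB; apply: (eqN_norm sn); apply: (eqN_sum sn) => i.
      have it := rsum_node t0 (ltn_ord i).
      apply: (eqNZ sn); apply: (eqN_sym sn); apply: (eq_sgB sn sg).
      - exact: ts.
      - exact: Xg1.
      - exact: Xg2.
    apply: (@affine_rsum_le a t n (fun s => g (s + h) - g s)
      (fun s => N (z (s + h) - z s))) => // s st.
      by apply: (snB sn); [exact: Xg1|exact: Xg2].
    by have [? ? _ _] := shT _ (tsT _ st); exact: ga.
  have Xzt := Xz tT; have Xzth := Xz thT'.
  have tT' : t * (M * `|a|) <= T * (M * a).
    rewrite ger0_norm// ler_wpM2r ?mulr_ge0//; lra.
  rewrite [h + t]addrC in H1.
  have XR12 := snD sn XR1 XR2; have XR22 := snB sn XR2 XR2'.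
  have X1 := snB sn Xzth XR12; have X2 := snB sn XR2' Xzt.
  rewrite /=; have -> : z (t + h) - z t =
      (z (t + h) - (R1 + R2)) + (R1 + (R2 - R2')) + (R2' - z t).
    rewrite [R1 + (R2 - R2')]addrA [_ - (R1 + R2) + _]addrA subrK addrA.
    by rewrite subrK.
  apply: le_trans (sn_tri sn (snD sn X1 (snD sn XR1 XR22)) X2) _.
  have := sn_tri sn X1 (snD sn XR1 XR22); have := sn_tri sn XR1 XR22.
  rewrite (sn_distC sn XR12)// in H1; rewrite /A; lra.
- move=> s sTh; have [_ _ sT shT'] := shT _ sTh.
  rewrite (sn_ge0 sn)/=; last exact: XD.
  by apply: le_trans (sn_triB sn (Xz shT') (Xz sT)) _; rewrite lerD ?zK.
Qed.

End Perturbation.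

(** * Lebesgue measure on a bounded interval *)

Section MeasureOnInterval.
Context {R : realType}.
Variables a b : R.
Local Notation mu := (muO a b).
Local Notation leb := (@lebesgue_measure R).

Lemma muOE A : mu A = leb (A `&` `]a, b[). Proof. by []. Qed.

Lemma muO_setT_fin : (mu setT < +oo)%E.
Proof.
rewrite muOE setTI; have := @lebesgue_measure_itv R `]a, b[.
by move=> ->; case: ifP => // _; rewrite -EFinB ltry.
Qed.

Lemma muO_fin_num : mu setT \is a fin_num.
Proof. by rewrite ge0_fin_numE ?measure_ge0// muO_setT_fin. Qed.

Lemma muO_setT_gt0 : a < b -> (0 < mu setT)%E.
Proof.
move=> ab; rewrite muOE setTI.
have := @lebesgue_measure_itv R `]a, b[; rewrite /= lte_fin ab => ->.
by rewrite -EFinB lte_fin subr_gt0.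
Qed.

Lemma ae_muOP (P : R -> Prop) :
  {ae mu, forall x, P x} <-> {ae leb, forall x, a < x < b -> P x}.
Proof.
split=> -[A [mA A0 PA]].
  exists (A `&` `]a, b[); split; [exact: measurableI|exact: A0|].
  move=> x /= /not_implyP[xab nP]; split; first exact: PA.
  by rewrite in_itv.
exists (A `|` ~` `]a, b[); split.
- by apply: measurableU => //; apply: measurableC; exact: measurable_itv.
- have mI : measurable (`]a, b[ : set (measurableTypeR R)) by exact: measurable_itv.
  rewrite muOE setIUl setICl setU0.
  apply/eqP; rewrite -measure_le0 -A0.
  by apply: le_measure; rewrite ?inE//; exact: measurableI.
- move=> x /= nP; have [xab|] := boolP (a < x < b); [left|right].
    by apply: PA => /= /(_ xab).
  by rewrite in_itv/=; exact/negP.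
Qed.

Lemma ae_imp (P Q : R -> Prop) : (forall x, P x -> Q x) ->
  {ae mu, forall x, P x} -> {ae mu, forall x, Q x}.
Proof. by move=> PQ; apply: (@filterS _ _ (ae_filter_ringOfSetsType mu)). Qed.

Lemma ae_imp2 (P Q S : R -> Prop) : (forall x, P x -> Q x -> S x) ->
  {ae mu, forall x, P x} -> {ae mu, forall x, Q x} -> {ae mu, forall x, S x}.
Proof. by move=> PQ; apply: (@filterS2 _ _ (ae_filter_ringOfSetsType mu)). Qed.

Lemma aeqP f g : aeq a b f g <-> {ae leb, forall x, a < x < b -> f x = g x}.
Proof. exact: ae_muOP. Qed.

(** [muO a b] is a measure on the whole line that only charges the interval. *)
Lemma integral_muO (f : measurableTypeR R -> R) : measurable_fun [set: measurableTypeR R] f ->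
  (\int[mu]_x (f x)%:E = \int[leb]_(x in `]a, b[) (f x)%:E)%E.
Proof.
move=> mf; have mI : measurable (`]a, b[ : set (measurableTypeR R)) by exact: measurable_itv.
have mEf : measurable_fun [set: measurableTypeR R] (EFin \o f) by exact/measurable_EFinP.
transitivity (\int[mu]_(x in `]a, b[) (f x)%:E)%E; last first.
  apply: eq_measure_integral => A mA AI.
  by rewrite -[LHS]/(leb (A `&` `]a, b[)) setIidl.
rewrite [RHS]integral_mkcond; apply: ae_eq_integral => //.
  by apply/(measurable_restrictT _ mI); exact: measurable_funS mEf.
apply/ae_muOP; apply: nearW => x xab _.
by rewrite patchE mem_set//= in_itv.
Qed.

Lemma Rintegral_muO (f : measurableTypeR R -> R) : measurable_fun [set: measurableTypeR R] f ->
  \int[mu]_x f x = \int[leb]_(x in `]a, b[) f x.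
Proof. by move=> mf; rewrite /Rintegral integral_muO. Qed.

End MeasureOnInterval.

(** * Square integrable functions *)

Section SquareIntegrable.
Context {R : realType}.
Variables a b : R.
Local Notation mu := (muO a b).
Local Notation leb := (@lebesgue_measure R).
Local Notation mR := (measurableTypeR R).
Local Notation L2 := (L2 a b).
Local Notation normL2 := (normL2 a b).
Implicit Types f g : mR -> R.

Let le12 : (1 <= 2%:E :> \bar R)%E. Proof. exact: lee1n 2. Qed.

Lemma L2P f : L2 f <-> measurable_fun [set: mR] f /\
  ('N[mu]_2%:E[EFin \o f] < +oo)%E.
Proof.
rewrite /Defs.L2/= inE; split; first by move=> /andP[]; rewrite !inE.
by move=> [mf lf]; apply/andP; rewrite !inE.
Qed.

Lemma L2_measurable f : L2 f -> measurable_fun [set: mR] f.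
Proof. by move=> /L2P[]. Qed.

Lemma EFin_normL2 f : L2 f -> ((normL2 f)%:E = 'N[mu]_2%:E[EFin \o f])%E.
Proof.
by move=> /L2P[_ lf]; rewrite fineK// ge0_fin_numE// Lnorm_ge0.
Qed.

Lemma L2_lin (c : R) f g : L2 f -> L2 g -> L2 (c *: f + g).
Proof. by move=> Lf Lg; have [_ H] := Lfun_submod_closed mu le12; exact: H. Qed.

Lemma L2_cst0 : L2 (0 : R -> R).
Proof. by have [] := Lfun_submod_closed mu le12. Qed.

Lemma normL2D f g : L2 f -> L2 g -> normL2 (f + g) <= normL2 f + normL2 g.
Proof.
move=> Lf Lg; have := L2_lin 1 Lf Lg; rewrite scale1r => Lfg.
rewrite -lee_fin EFinD !EFin_normL2//.
by apply: minkowski_EFin; rewrite ?ler1n//; exact: L2_measurable.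
Qed.

Lemma normL2Z (c : R) f : L2 f -> normL2 (c *: f) = `|c| * normL2 f.
Proof.
move=> Lf; have := L2_lin c Lf L2_cst0; rewrite addr0 => Lcf.
apply: EFin_inj; rewrite EFinM !EFin_normL2//.
exact: (LnormZ (Lfun_Sub le12 Lf)).
Qed.

Lemma normL2_ge0 f : 0 <= normL2 f.
Proof. by rewrite /Defs.normL2 fine_ge0// Lnorm_ge0. Qed.

Lemma L2_seminorm : seminorm_on L2 normL2.
Proof.
by split; [exact: L2_cst0|exact: L2_lin|exact: normL2D|exact: normL2Z].
Qed.

Lemma normL2_sqr f : L2 f ->
  ((normL2 f ^+ 2)%:E = \int[mu]_x (f x ^+ 2)%:E)%E.
Proof.
move=> Lf; rewrite -powR_mulrn ?normL2_ge0// -poweR_EFin EFin_normL2//.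
rewrite poweR_Lnorm//; apply: eq_integral => x _ /=.
by rewrite powR_mulrn// real_normK// num_real.
Qed.

Lemma L2_dom (c : R) f g : 0 <= c -> measurable_fun [set: mR] f -> L2 g ->
  {ae mu, forall x, `|f x| <= c * `|g x|} -> L2 f /\ normL2 f <= c * normL2 g.
Proof.
move=> c0 mf Lg fg.
have Lcg : L2 (c *: g) by have := L2_lin c Lg L2_cst0; rewrite addr0.
have mcg := L2_measurable Lcg.
have mpow (h : mR -> R) : measurable_fun [set: mR] h ->
    measurable_fun [set: mR] (fun x => `| (EFin \o h) x | `^ 2)%E.
  move=> mh; apply/(@measurable_EFinP _ _ _ _ (fun x => `|h x| `^ 2)).
  apply: (@measurableT_comp _ _ _ _ _ _ (fun x : R => x `^ 2)) => //.
  exact: measurableT_comp.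
have H : ('N[mu]_2%:E[EFin \o f] <= 'N[mu]_2%:E[EFin \o (c *: g)%R])%E.
  rewrite unlock /Lnorm gt0_ler_poweR//.
  - by rewrite in_itv/= leey integral_ge0// => x _; exact: poweR_ge0.
  - by rewrite in_itv/= leey integral_ge0// => x _; exact: poweR_ge0.
  apply: ae_ge0_le_integral => //.
  - by move=> x _; exact: poweR_ge0.
  - exact: mpow.
  - by move=> x _; exact: poweR_ge0.
  - exact: mpow.
  - apply: ae_imp fg => x fgx _ /=; rewrite lee_fin.
    rewrite !powR_mulrn// lerXn2r ?nnegrE//.
    by rewrite normrM (ger0_norm c0).
have Lf : L2 f.
  by apply/L2P; split=> //; apply: le_lt_trans H _; have [] := (L2P _).1 Lcg.
split=> //; rewrite -lee_fin -[in leRHS](ger0_norm c0) -normL2Z//.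
by rewrite !EFin_normL2.
Qed.

Lemma ae_dom1 f g : aeq a b f g -> {ae mu, forall x, `|f x| <= 1 * `|g x|}.
Proof. by apply: ae_imp => x ->; rewrite mul1r. Qed.

Lemma aeq_sym f g : aeq a b f g -> aeq a b g f.
Proof. by apply: ae_imp => x ->. Qed.

Lemma aeq_refl f : aeq a b f f.
Proof. exact: nearW. Qed.

Lemma aeq_normL2 f g : L2 f -> L2 g -> aeq a b f g -> normL2 f = normL2 g.
Proof.
move=> Lf Lg fg; apply/eqP; rewrite eq_le.
have [_] := L2_dom ler01 (L2_measurable Lf) Lg (ae_dom1 fg).
have [_] := L2_dom ler01 (L2_measurable Lg) Lf (ae_dom1 (aeq_sym fg)).
by rewrite !mul1r => -> ->.
Qed.

Lemma L2_cst (c : R) : L2 (cst c).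
Proof.
apply/L2P; split; first exact: measurable_cst.
have H : ('N[mu]_2%:E[EFin \o cst 1%R] < +oo)%E.
  rewrite (_ : EFin \o cst 1%R = cst 1%E)// Lnorm_cst1 poweR_lty//.
  exact: muO_setT_fin.
have L1 : L2 (cst 1) by apply/L2P; split=> //; exact: measurable_cst.
have : L2 (c *: (cst 1 : R -> R) + 0) by apply: L2_lin => //; exact: L2_cst0.
move=> /L2P[_]; apply: le_lt_trans; rewrite le_eqVlt; apply/orP; left; apply/eqP.
congr Lnorm; apply/funext => x /=.
by rewrite addr0 -[(c *: _) x]/(c * 1) mulr1.
Qed.

Lemma L2_bounded (c : R) f : measurable_fun [set: mR] f ->
  {ae mu, forall x, `|f x| <= c} -> L2 f.
Proof.
move=> mf fc; have c0 : 0 <= `|c| by [].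
apply: (L2_dom c0 mf (L2_cst 1) _).1.
apply: ae_imp fc => x /le_trans; apply.
by rewrite normr1 mulr1 ler_norm.
Qed.

Lemma continuous_measurableR f : continuous (f : R -> R) -> measurable_fun [set: mR] f.
Proof. by move=> cf; exact: continuous_measurable_fun. Qed.

Lemma continuous_bounded_itv f : continuous (f : R -> R) ->
  exists2 K : R, 0 <= K & forall x, a <= x <= b -> `|f x| <= K.
Proof.
move=> cf; have [K [_ HK]] := @compact_bounded R R (f @` `[a, b])
  (continuous_compact (continuous_subspaceT cf) (@segment_compact R a b)).
exists (`|K| + 1) => [|x xab]; first by rewrite addr_ge0.
apply: (HK (`|K| + 1)); last by exists x; rewrite //= in_itv.
by rewrite (le_lt_trans (ler_norm _))// ltrDl.
Qed.

Lemma ae_itv (P : R -> Prop) : (forall x, a < x < b -> P x) -> {ae mu, forall x, P x}.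
Proof. by move=> HP; apply/ae_muOP; exact: nearW. Qed.

Lemma continuous_L2 f : continuous (f : R -> R) -> L2 f.
Proof.
move=> cf; have [K K0 HK] := continuous_bounded_itv cf.
apply: (@L2_bounded K); first exact: continuous_measurableR.
by apply: ae_itv => x /andP[ax xb]; apply: HK; rewrite !ltW.
Qed.

Lemma L2M_integrable f g : L2 f -> L2 g ->
  mu.-integrable [set: mR] (fun x => (f x * g x)%:E).
Proof. by move=> Lf Lg; apply/Lfun1_integrable; exact: Lfun2_mul_Lfun1. Qed.

End SquareIntegrable.

(** * Bounded pointwise convergence *)

Section BoundedPointwise.
Context {R : realType}.
Variables a b : R.
Local Notation mu := (muO a b).
Local Notation leb := (@lebesgue_measure R).
Local Notation mR := (measurableTypeR R).
Local Notation L2 := (L2 a b).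
Local Notation normL2 := (normL2 a b).

(** Both the integral against an L^2 function and the L^2 norm pass to the limit
    under this convergence. *)
Definition bp_cvg (t_ : nat -> mR -> R) (t : mR -> R) := exists K : R,
  [/\ forall n, measurable_fun [set: mR] (t_ n), measurable_fun [set: mR] t,
      forall n x, a < x < b -> `|t_ n x| <= K &
      forall x, a < x < b -> t_ n x @[n --> \oo] --> t x].

Lemma bp_cvg_int (f : mR -> R) t_ t : L2 f -> bp_cvg t_ t ->
  (\int[mu]_x (f x * t_ n x))%R @[n --> \oo] --> (\int[mu]_x (f x * t x))%R.
Proof.
move=> Lf [K [mt_ mt tK tt]]; have mf := L2_measurable Lf.
have LK : mu.-integrable [set: mR] (fun x => (f x * K)%:E).
  exact: (L2M_integrable Lf (L2_cst a b K)).
have m_ n : measurable_fun [set: mR] (fun x => (f x * t_ n x)%:E).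
  by apply/measurable_EFinP; exact: measurable_funM.
have m : measurable_fun [set: mR] (fun x => (f x * t x)%:E).
  by apply/measurable_EFinP; exact: measurable_funM.
have cv : {ae mu, forall x, setT x ->
    (f x * t_ n x)%:E @[n --> \oo] --> (f x * t x)%:E}.
  apply: ae_itv => x xab _; apply: cvg_EFin; first exact: nearW.
  exact: (cvgM (cvg_cst _) (tt x xab)).
have dom : {ae mu, forall x n, setT x ->
    (`|(f x * t_ n x)%:E| <= `|(f x * K)%:E|)%E}.
  apply: ae_itv => x xab n _; rewrite !abse_EFin lee_fin !normrM ler_wpM2l//.
  exact: le_trans (tK n x xab) (ler_norm _).
have [it _ ct] := dominated_convergence measurableT m_ m cv (integrable_abse LK) dom.
rewrite /Rintegral; apply: fine_cvg.
rewrite fineK; first exact: ct.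
by apply: integrable_fin_num.
Qed.

Lemma bp_cvg_normL2 (g : mR -> R) t_ t : L2 g -> bp_cvg t_ t ->
  (forall n, L2 (fun x => g x * t_ n x - g x * t x)) /\
  forall e, 0 < e -> exists N, forall n, (N <= n)%N ->
    normL2 (fun x => g x * t_ n x - g x * t x) < e.
Proof.
move=> Lg [K [mt_ mt tK tt]]; have mg := L2_measurable Lg.
have K0 x : a < x < b -> 0 <= K by move=> /(tK 0%N); exact: le_trans.
have tK' x : a < x < b -> `|t x| <= K.
  move=> xab.
  have tx : `|t_ n x| @[n --> \oo] --> `|t x| by apply: cvg_norm; exact: tt.
  rewrite -(cvg_lim (@Rhausdorff R) tx); apply: limr_le; first by apply/cvg_ex; exists `|t x|.
  by apply: nearW => n; exact: tK.
have gt n x : a < x < b -> `|g x * t_ n x - g x * t x| <= `|K + K| * `|g x|.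
  move=> xab; rewrite -mulrBr normrM mulrC ler_wpM2r//.
  rewrite (ger0_norm (addr_ge0 (K0 x xab) (K0 x xab))).
  by apply: le_trans (ler_normB _ _) _; rewrite lerD ?tK ?tK'.
have md n : measurable_fun [set: mR] (fun x => g x * t_ n x - g x * t x).
  by apply: measurable_funB; exact: measurable_funM.
have Ld n : L2 (fun x => g x * t_ n x - g x * t x).
  by apply: (L2_dom (normr_ge0 (K + K)) (md n) Lg _).1; apply: ae_itv; exact: gt.
split=> // e e0.
have ig2 : mu.-integrable [set: mR] (fun x => (((K + K) * g x) ^+ 2)%:E).
  apply: (Lfun2_integrable_sqr (f := (K + K) *: g)).
  by have := L2_lin (K + K) Lg (L2_cst0 a b); rewrite addr0.
have csq x : a < x < b ->
    (g x * t_ n x - g x * t x) ^+ 2 @[n --> \oo] --> (0 : R).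
  move=> xab.
  have H : g x * t_ n x - g x * t x @[n --> \oo] --> (0 : R).
    rewrite -(subrr (g x * t x)); apply: cvgB; last exact: cvg_cst.
    exact: (cvgM (cvg_cst _) (tt x xab)).
  by have := cvgM H H; rewrite mulr0; exact.
have m_ n : measurable_fun [set: mR]
    (fun x => ((g x * t_ n x - g x * t x) ^+ 2)%:E).
  by apply/measurable_EFinP; exact: measurable_funX.
have cv : {ae mu, forall x, setT x ->
    ((g x * t_ n x - g x * t x) ^+ 2)%:E @[n --> \oo] --> 0%E}.
  apply: ae_itv => x xab _; apply: cvg_EFin; first exact: nearW.
  exact: csq.
have dom : {ae mu, forall x n, setT x ->
    (`|((g x * t_ n x - g x * t x) ^+ 2)%:E| <= (((K + K) * g x) ^+ 2)%:E)%E}.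
  apply: ae_itv => x xab n _; rewrite abse_EFin lee_fin normrX.
  rewrite -[leRHS]real_normK ?num_real// lerXn2r ?nnegrE// normrM.
  exact: gt.
have [_ _ ct] := dominated_convergence measurableT m_ (measurable_cst _) cv ig2 dom.
rewrite integral0 in ct.
have ct' := (cvgrPdist_lt _ _).1 (fine_cvg ct) _ (exprn_gt0 2 e0).
have [N _ HN] := ct'.
exists N => n Nn; have := HN n Nn.
rewrite /= sub0r normrN -normL2_sqr//= ger0_norm ?sqr_ge0//.
by rewrite ltr_sqr ?nnegrE// ?normL2_ge0// ltW.
Qed.

End BoundedPointwise.

(** * Approximation by test functions *)

Section TestFunctions.
Context {R : realType}.
Variables a b : R.
Local Notation mu := (muO a b).
Local Notation leb := (@lebesgue_measure R).
Local Notation mR := (measurableTypeR R).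
Local Notation L2 := (L2 a b).
Local Notation normL2 := (normL2 a b).

Lemma continuous_cpt_bounded (tau : R -> R) (c d : R) : continuous tau ->
  (forall x, ~~ (c <= x <= d) -> tau x = 0) ->
  exists2 K : R, 0 <= K & forall x, `|tau x| <= K.
Proof.
move=> ct t0; have [K K0 HK] := continuous_bounded_itv c d ct.
exists K => // x; have [|/t0->] := boolP (c <= x <= d); first exact: HK.
by rewrite normr0.
Qed.

Lemma cpt_primitive (tau : R -> R) (c d : R) : continuous tau ->
  (forall x, ~~ (c <= x <= d) -> tau x = 0) ->
  exists P : R -> R, forall x : R, is_derive x (1 : R) P (tau x).
Proof.
move=> ct t0; exists (fun x => \int[leb]_(t in `]-oo, x]) tau t) => x.
have mcd : measurable (`[c, d] : set mR) by exact: measurable_itv.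
have tauE : EFin \o tau = (EFin \o tau) \_ `[c, d].
  apply/funext => y; rewrite patchE; case: ifPn => //.
  by rewrite notin_setE /= in_itv/= => /negP/t0 ->.
have it : leb.-integrable [set: mR] (EFin \o tau).
  rewrite tauE; apply/(integrable_mkcond _ mcd).
  apply: continuous_compact_integrable; first exact: segment_compact.
  exact: continuous_subspaceT.
have mI : measurable (`]-oo, x + 1] : set mR) by exact: measurable_itv.
have xlt : x < x + 1 by rewrite ltrDl.
have iI : leb.-integrable `]-oo, x + 1] (EFin \o tau).
  exact: (integrableS measurableT mI (@subsetT _ _) it).
have [|dP P'] := continuous_FTC1 xlt iI _ (ct x); first by rewrite ltNyr.
by split; [exact: dP|rewrite -derive1E].
Qed.

(** The approximants are the mean values [(P (x + h) - P x) / h] of [tau] over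
    short intervals, for a primitive [P] of [tau]. By the mean value theorem they
    take values of [tau] at nearby points, which gives at once the bound, the
    support and the convergence. *)
Lemma test_function_approx (tau : R -> R) (c d : R) : a < c -> d < b -> continuous tau ->
  (forall x, ~~ (c <= x <= d) -> tau x = 0) ->
  exists2 t_ : nat -> R -> R, (forall n, test_function a b (t_ n)) &
    bp_cvg a b t_ tau.
Proof.
move=> ac db ct t0; have [K K0 HK] := continuous_cpt_bounded ct t0.
have [P dP] := cpt_primitive ct t0.
pose d0 := (c - a) / 2; have d00 : 0 < d0 by rewrite divr_gt0// subr_gt0.
pose del n := d0 / n.+1%:R.
have del0 n : 0 < del n by rewrite divr_gt0.
have deld n : del n <= d0 by rewrite ler_pdivrMr// ler_peMr ?(ltW d00)// ler1n.
pose t_ n x := (del n)^-1 * (P (x + del n) - P x).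
have cP : continuous P.
  by move=> x; apply/differentiable_continuous/derivable1_diffP; have [] := dP x.
have mvt n x : exists2 y, x <= y <= x + del n & t_ n x = tau y.
  have [||y] := @MVT_segment R P tau x (x + del n).
  - by rewrite lerDl ltW.
  - exact: continuous_subspaceT.
  - rewrite in_itv/= => xy Py; exists y => //.
    by rewrite /t_ Py [x + _]addrC addrK mulrCA mulVf ?mulr1// gt_eqF.
have dt n x : is_derive x (1 : R) (t_ n) ((del n)^-1 * (tau (x + del n) - tau x)).
  have dsh : is_derive x (1 : R) (fun y => P (y + del n)) (tau (x + del n)).
    have d1 : is_derive (x + del n) (1 : R) P (tau (x + del n)) by [].
    have d2 : is_derive x (1 : R) (fun y => y + del n) 1.
      by rewrite -[X in is_derive _ _ _ X]addr0; exact: is_deriveD.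
    have := @is_derive1_comp R P (fun y => y + del n) x _ _ d1 d2.
    by rewrite mulr1.
  have dx := dP x.
  have HB := is_deriveB dsh dx. exact: (is_deriveZ (del n)^-1 HB).
exists t_ => [n|].
  split.
  - by move=> x; have [] := dt n x.
  - rewrite (_ : derive1 (t_ n) = fun x => (del n)^-1 * (tau (x + del n) - tau x)).
      move=> x; apply: cvgM; first exact: cvg_cst.
      apply: cvgB; last exact: ct.
      apply: continuous_comp; last exact: ct.
      by apply: cvgD; [exact: cvg_id|exact: cvg_cst].
    by apply/funext => x; rewrite derive1E; apply: derive_val.
  - exists (c - d0), d; split=> //; first by rewrite /d0; lra.
    move=> x xcd; have [y /andP[xy yx] ->] := mvt n x.
    apply: t0; apply: contra xcd => /andP[cy yd].
    have := deld n; lra.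
exists K; split.
- move=> n; apply: continuous_measurableR => x; apply/differentiable_continuous.
  by apply/derivable1_diffP; have [] := dt n x.
- exact: continuous_measurableR.
- by move=> n x _; have [y _ ->] := mvt n x.
move=> x _; apply/cvgrPdist_lt => e e0.
have /nbhs_ballP[eta /= eta0 Heta] : nbhs x [set t | `|tau x - tau t| < e].
  exact: ((cvgrPdist_lt _ _).1 (ct x) e e0).
exists (Num.truncn (d0 / eta)) => // n /= Nn.
have [y /andP[xy yx] ->] := mvt n x.
apply: Heta; rewrite /ball/= ler0_norm ?subr_le0// opprB.
apply: le_lt_trans (_ : del n < _); first lra.
rewrite /del ltr_pdivrMr// mulrC -ltr_pdivrMr//.
by apply: lt_le_trans (truncnS_gt _) _; rewrite ler_nat ltnS.
Qed.

(** Of height 1 and vanishing at distance [n.+1^-1] from the ends of [c, d], so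
    that its support stays inside the interval also when [c, d] is the whole
    closure of the interval. *)
Definition trapezoid (c d : R) n x : R :=
  Num.min 1 (Num.max 0 (Num.min (n.+1%:R * (x - c) - 1) (n.+1%:R * (d - x) - 1))).

Lemma trapezoid_continuous (c d : R) n : continuous (trapezoid c d n).
Proof.
have cl (u v : R) : continuous (fun x : R => u * x + v).
  by move=> x; apply: cvgD; [apply: cvgM; [exact: cvg_cst|exact: cvg_id]|exact: cvg_cst].
have cmin (f g : R -> R) : continuous f -> continuous g ->
    continuous (fun x => Num.min (f x) (g x)).
  by move=> cf cg x; exact: (continuous_min (cf x) (cg x)).
have cmax (f g : R -> R) : continuous f -> continuous g ->
    continuous (fun x => Num.max (f x) (g x)).
  by move=> cf cg x; exact: (continuous_max (cf x) (cg x)).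
apply: (cmin _ _); first exact: cst_continuous.
apply: (cmax _ _); first exact: cst_continuous.
apply: (cmin _ _).
  rewrite (_ : (fun x => _) = (fun x => n.+1%:R * x + (- n.+1%:R * c - 1)))//.
  by apply/funext => x; ring.
rewrite (_ : (fun x => _) = (fun x => - n.+1%:R * x + (n.+1%:R * d - 1)))//.
by apply/funext => x; ring.
Qed.

Lemma trapezoid_support (c d : R) n (x : R) :
  ~~ (c + n.+1%:R^-1 <= x <= d - n.+1%:R^-1) -> trapezoid c d n x = 0.
Proof.
move=> H; rewrite /trapezoid; have n0 : (0 : R) < n.+1%:R by [].
suff Hm : Num.min (n.+1%:R * (x - c) - 1) (n.+1%:R * (d - x) - 1) <= 0.
  by rewrite max_l// min_r.
rewrite ge_min !subr_le0 ![_.+1%:R * _]mulrC -!ler_pdivlMr// !mul1r.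
move: H; rewrite negb_and -!ltNge; move: (n.+1%:R^-1) => u.
by move=> /orP[?|?]; apply/orP; [left|right]; lra.
Qed.

Lemma trapezoid_bp_cvg (c d : R) : a <= c -> d <= b ->
  bp_cvg a b (trapezoid c d) (\1_(`]c, d[) : mR -> R).
Proof.
move=> ac db; exists 1; split.
- by move=> n; apply: continuous_measurableR; exact: trapezoid_continuous.
- by apply: measurable_indic; exact: measurable_itv.
- move=> n x _; rewrite /trapezoid ger0_norm ?le_min ?ler01 ?le_max ?lexx//.
  by rewrite ge_min lexx.
- move=> x xab; rewrite indicE; have [xcd|xcd] := boolP (c < x < d); last first.
    rewrite memNset; last by rewrite /= in_itv/=; exact/negP.
    apply: cvg_near_cst; apply: nearW => n; apply: trapezoid_support.
    have : 0 < (n.+1%:R : R)^-1 by [].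
    move: (n.+1%:R^-1) => u u0; apply: contra xcd => /andP[cx xd].
    by apply/andP; split; lra.
  rewrite mem_set ?/= ?in_itv//=.
  have /andP[cx xd] := xcd.
  pose m := Num.min (x - c) (d - x).
  have m0 : 0 < m by rewrite lt_min !subr_gt0 cx.
  apply: cvg_near_cst; exists (Num.truncn (2 / m)) => // n /= Nn.
  have n2 : 2 <= n.+1%:R * m.
    rewrite -ler_pdivrMr//; apply: ltW; apply: lt_le_trans (truncnS_gt _) _.
    by rewrite ler_nat ltnS.
  have n1 u : m <= u -> 1 <= n.+1%:R * u - 1.
    by move=> mu_; have : n.+1%:R * m <= n.+1%:R * u by [rewrite ler_wpM2l]; lra.
  have : 1 <= Num.min (n.+1%:R * (x - c) - 1) (n.+1%:R * (d - x) - 1).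
    by rewrite le_min !n1// ge_min lexx ?orbT.
  by move=> H; rewrite /trapezoid (max_r (le_trans ler01 H)) (min_l H).
Qed.

End TestFunctions.

(** * Weak derivatives *)

Section WeakDerivative.
Context {R : realType}.
Variables a b : R.
Local Notation mu := (muO a b).
Local Notation leb := (@lebesgue_measure R).
Local Notation mR := (measurableTypeR R).
Local Notation L2 := (L2 a b).
Local Notation normL2 := (normL2 a b).
Local Notation test := (test_function a b).
Local Notation wd := (is_weak_derivative a b).

Lemma test_continuous (phi : R -> R) : test phi -> continuous phi.
Proof.
by move=> [dphi _ _] x; apply/differentiable_continuous/derivable1_diffP.
Qed.

Lemma test_L2 (phi : R -> R) : test phi -> L2 phi.
Proof. by move=> /test_continuous; exact: continuous_L2. Qed.

Lemma test_derive_L2 (phi : R -> R) : test phi -> L2 (derive1 phi).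
Proof. by move=> [_ c1 _]; exact: continuous_L2. Qed.

(** [h] is orthogonal to the test functions, hence to the trapezoids, hence to
    the indicators of intervals: its primitive vanishes, and so does [h] by
    Lebesgue's differentiation theorem. *)
Lemma fundamental_lemma (h : mR -> R) : L2 h ->
  (forall phi, test phi -> \int[mu]_x (h x * phi x) = 0) -> aeq a b h 0.
Proof.
move=> Lh h0; have mh := L2_measurable Lh.
have ht (tau : R -> R) c d : a < c -> d < b -> continuous tau ->
    (forall x, ~~ (c <= x <= d) -> tau x = 0) -> \int[mu]_x (h x * tau x) = 0.
  move=> ac db ct t0; have [t_ tt tc] := test_function_approx ac db ct t0.
  have := bp_cvg_int Lh tc => H.
  have H0 : (fun n => \int[mu]_x (h x * t_ n x)) = cst 0.
    by apply/funext => n; exact: h0.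
  rewrite H0 in H; apply: (cvg_unique _ H (cvg_cst _)); exact: Rhausdorff.
have hI d : d <= b -> \int[mu]_x (h x * \1_(`]a, d[) x) = 0.
  move=> db; have H := bp_cvg_int Lh (trapezoid_bp_cvg (lexx a) db).
  have H0 : (fun n => \int[mu]_x (h x * trapezoid a d n x)) = cst 0.
    apply/funext => n; have n0 : 0 < (n.+1%:R : R)^-1 by [].
    apply: (ht _ (a + n.+1%:R^-1) (d - n.+1%:R^-1)).
    - by rewrite ltrDl.
    - by rewrite ltrBlDr (le_lt_trans db)// ltrDl.
    - exact: trapezoid_continuous.
    - by move=> x; exact: trapezoid_support.
  rewrite H0 in H; apply: (cvg_unique _ H (cvg_cst _)); exact: Rhausdorff.
have mI : measurable (`]a, b[ : set mR) by exact: measurable_itv.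
pose hh := h \_ `]a, b[.
have mhh : measurable_fun [set: mR] hh.
  by apply/(measurable_restrictT _ mI); exact: measurable_funS mh.
have ihh : leb.-integrable [set: mR] (EFin \o hh).
  have -> : EFin \o hh = (EFin \o h) \_ `]a, b[ by rewrite restrict_EFin.
  apply/(integrable_mkcond _ mI); apply/integrableP; split.
    by apply/measurable_EFinP; exact: measurable_funS mh.
  have /integrableP[_] : mu.-integrable [set: mR] (EFin \o h).
    apply/Lfun1_integrable; apply: Lfun_subset12; last exact: Lh.
    exact: muO_fin_num.
  under [in X in X -> _]eq_integral do rewrite abse_EFin.
  rewrite (@integral_muO R a b (fun x => `|h x|)).
    by under eq_integral do rewrite abse_EFin.
  exact: measurableT_comp.
(* The primitive of [h], extended by 0, vanishes identically. *)
pose F x := \int[leb]_(t in `]-oo, x]) hh t.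
have F0 x : F x = 0.
  rewrite /F -Rintegral_itv_bndo_bndc; last first.
    apply: (integrableS measurableT _ (@subsetT _ _) ihh); exact: measurable_itv.
  have xb : Num.min x b <= b by rewrite ge_min lexx orbT.
  have := hI _ xb; rewrite Rintegral_muO; last first.
    apply: measurable_funM => //; apply: measurable_indic; exact: measurable_itv.
  rewrite Rintegral_mkcond [X in _ -> X = _]Rintegral_mkcond => <-.
  apply: eq_Rintegral => y _; rewrite /hh !patchE indicE.
  have inE' (A : set R) (p : bool) : (A y <-> p) -> (y \in A) = p.
    move=> Ap; apply/idP/idP => [/set_mem/Ap//|/Ap]; exact: mem_set.
  rewrite (inE' `]-oo, x[%classic (y < x)); last by rewrite /= in_itv/=.
  rewrite (inE' `]a, b[%classic (a < y < b)); last by rewrite /= in_itv/=.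
  rewrite (inE' `]a, Num.min x b[%classic (a < y < Num.min x b)); last by rewrite /= in_itv/=.
  rewrite lt_min; case: (y < x); case: (a < y); case: (y < b);
    by rewrite ?mulr1 ?mulr0.
have lhh : locally_integrable [set: R] hh.
  exact: open_integrable_locally openT ihh.
have iyy y : leb.-integrable `]-oo, y] (EFin \o hh).
  apply: (integrableS measurableT _ (@subsetT _ _) ihh); exact: measurable_itv.
have := FTC1Ny iyy lhh => HF.
apply/aeqP; apply: (@filterS _ _ (ae_filter_ringOfSetsType leb)) HF.
move=> x [_ F'] xab.
have : hh x = 0.
  rewrite -F' (_ : (fun x => _) = cst 0); last by apply/funext => y; exact: F0.
  by rewrite derive1_cst.
by rewrite /hh patchE mem_set//= in_itv.
Qed.

Lemma aeq_Rintegral (f g : mR -> R) : measurable_fun [set: mR] f ->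
  measurable_fun [set: mR] g -> aeq a b f g ->
  \int[mu]_x f x = \int[mu]_x g x.
Proof.
move=> mf mg fg; congr fine; apply: ae_eq_integral => //.
- exact/measurable_EFinP.
- exact/measurable_EFinP.
- by apply: ae_imp fg => x /= -> _.
Qed.

Lemma wd_lin (c : R) f f' g g' : L2 f -> L2 f' -> L2 g -> L2 g' ->
  wd f f' -> wd g g' -> wd (c *: f + g) (c *: f' + g').
Proof.
move=> Lf Lf' Lg Lg' wf wg phi tphi.
have Lp := test_L2 tphi; have Lp' := test_derive_L2 tphi.
have int_lin (u v p : mR -> R) : L2 u -> L2 v -> L2 p ->
    \int[mu]_x ((c *: u + v) x * p x) =
    c * \int[mu]_x (u x * p x) + \int[mu]_x (v x * p x).
  move=> Lu Lv Lpp; have iu := L2M_integrable Lu Lpp; have iv := L2M_integrable Lv Lpp.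
  rewrite -RintegralZl// -RintegralD//; last exact: (integrableZl measurableT c iu).
  apply: eq_Rintegral => x _; rewrite -[LHS]/((c * u x + v x) * p x).
  by rewrite mulrDl mulrA.
by rewrite !int_lin// wf// wg// mulrN opprD.
Qed.

Lemma wd_unique f g1 g2 : L2 g1 -> L2 g2 -> wd f g1 -> wd f g2 -> aeq a b g1 g2.
Proof.
move=> L1 L2' w1 w2; have Lg : L2 (g1 - g2).
  by have := L2_lin (-1) L2' L1; rewrite scaleN1r addrC.
have : aeq a b (g1 - g2) 0.
  apply: fundamental_lemma => // phi tphi; have Lp := test_L2 tphi.
  have := w1 phi tphi; rewrite w2// => /oppr_inj H.
  transitivity (\int[mu]_x (g1 x * phi x) - \int[mu]_x (g2 x * phi x)).
    rewrite -RintegralB//; try exact: L2M_integrable.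
    by apply: eq_Rintegral => x _ /=; rewrite -mulrBl.
  by rewrite H subrr.
by apply: ae_imp => x /eqP; rewrite subr_eq0 => /eqP.
Qed.

Lemma wd_aeq f1 f2 g : L2 f1 -> L2 f2 -> aeq a b f1 f2 -> wd f1 g -> wd f2 g.
Proof.
move=> L1 L2' f12 w phi tphi; rewrite -w//.
have mp := L2_measurable (test_derive_L2 tphi).
apply: aeq_Rintegral.
- by apply: measurable_funM => //; exact: L2_measurable L2'.
- by apply: measurable_funM => //; exact: L2_measurable L1.
by apply: ae_imp f12 => x /= ->.
Qed.

Hypothesis ab : a < b.

Lemma wd_C1 (F f : R -> R) : (forall x : R, derivable F x 1) -> continuous f ->
  derive1 F = f -> wd F f.
Proof.
move=> dF cf F'; have cF : continuous F.
  by move=> x; apply/differentiable_continuous/derivable1_diffP.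
move=> phi tphi; have cphi := test_continuous tphi.
have [dphi cphi' [c [d [ac db phi0]]]] := tphi.
have drv (G : R -> R) : (forall x : R, derivable G x 1) -> derivable_oo_LRcontinuous G a b.
  move=> dG; have cG : continuous G.
    by move=> x; apply/differentiable_continuous/derivable1_diffP.
  split=> //; [exact: (cvg_at_right_filter (cG a))|exact: (cvg_at_left_filter (cG b))].
have := @Rintegration_by_parts R F phi f (derive1 phi) a b ab
  (continuous_subspaceT cf) (drv F dF) ltac:(by rewrite F') (continuous_subspaceT cphi')
  (drv phi dphi) ltac:(by []).
rewrite !phi0; [|by rewrite negb_and -!ltNge ac|by rewrite negb_and -!ltNge db orbT].
rewrite !mulr0 subrr sub0r => H.
have oo (g : R -> R) : continuous g -> \int[mu]_x g x = \int[leb]_(x in `[a, b]) g x.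
  move=> cg; rewrite Rintegral_muO; last exact: continuous_measurableR.
  have iab : leb.-integrable `[a, b] (EFin \o g).
    apply: continuous_compact_integrable; first exact: segment_compact.
    exact: continuous_subspaceT.
  rewrite Rintegral_itv_obnd_cbnd ?Rintegral_itv_bndo_bndc//.
    by apply: integrableS iab => //; exact: subset_itv_co_cc.
  by apply: integrableS iab => //; exact: subset_itv_oo_cc.
rewrite !oo//; move=> x; apply: cvgM; by [exact: cF|exact: cphi'|exact: cphi|exact: cf].
Qed.

Lemma test_wd (phi : R -> R) : test phi -> wd phi (derive1 phi).
Proof. by move=> [dphi cphi' _]; exact: (wd_C1 dphi cphi' erefl). Qed.

Lemma cst_wd (c : R) : wd (cst c) 0.
Proof.
apply: wd_C1 => //; first exact: cst_continuous.
by apply/funext => x; rewrite derive1_cst.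
Qed.

(** Cut off by trapezoids to reach compact support, then regularize. *)
Lemma continuous_test_dense (g : R -> R) e : continuous g -> 0 < e ->
  exists2 phi, test phi & normL2 (g - phi) < e.
Proof.
move=> cg e0; have Lg := continuous_L2 a b cg.
have e20 : 0 < e / 2 by rewrite divr_gt0.
have [LD /(_ _ e20)[n /(_ n (leqnn n))]] :=
  bp_cvg_normL2 Lg (trapezoid_bp_cvg (lexx a) (lexx b)).
have {}LD := LD n; set D := (fun x => _) in LD * => ltD.
pose tau x := g x * trapezoid a b n x.
have ct : continuous tau by move=> x; apply: cvgM; [exact: cg|exact: trapezoid_continuous].
have n0 : 0 < (n.+1%:R : R)^-1 by [].
have [||||t_ tt tc] := @test_function_approx R a b tau (a + n.+1%:R^-1) (b - n.+1%:R^-1).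
- by rewrite ltrDl.
- by rewrite ltrBlDr ltrDl.
- exact: ct.
- by move=> x /trapezoid_support; rewrite /tau => ->; rewrite mulr0.
have [LE /(_ _ e20)[k /(_ k (leqnn k))]] := bp_cvg_normL2 (L2_cst a b 1) tc.
have {}LE := LE k; set E := (fun x => _) in LE * => ltE.
exists (t_ k) => //; have sn := L2_seminorm a b.
have Lgt : L2 (g - t_ k) by apply: (snB sn) => //; exact: test_L2.
rewrite (@aeq_normL2 _ a b _ (- (D + E))) ?(sn_normN sn)//.
- by apply: le_lt_trans (sn_tri sn LD LE) _; lra.
- exact: (snD sn).
- by apply: (snN sn); exact: (snD sn).
- apply: ae_itv => x xab; rewrite -[LHS]/(g x - t_ k x).
  rewrite -[RHS]/(- ((g x * trapezoid a b n x - g x * \1_(`]a, b[) x) +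
    (1 * t_ k x - 1 * tau x))).
  by rewrite indicE mem_set ?/= ?in_itv//= /tau; ring.
Qed.

End WeakDerivative.

(** * Construction of seminorms *)

Section SeminormConstructions.
Context (R : realType) (V : lmodType R).

Lemma sqrt_sum_sqr_tri (x y x' y' : R) : 0 <= x -> 0 <= y -> 0 <= x' -> 0 <= y' ->
  Num.sqrt ((x + x') ^+ 2 + (y + y') ^+ 2) <=
  Num.sqrt (x ^+ 2 + y ^+ 2) + Num.sqrt (x' ^+ 2 + y' ^+ 2).
Proof.
move=> x0 y0 x'0 y'0; set u := Num.sqrt (x ^+ 2 + _); set v := Num.sqrt (x' ^+ 2 + _).
have u2 : u ^+ 2 = x ^+ 2 + y ^+ 2 by rewrite sqr_sqrtr// addr_ge0 ?sqr_ge0.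
have v2 : v ^+ 2 = x' ^+ 2 + y' ^+ 2 by rewrite sqr_sqrtr// addr_ge0 ?sqr_ge0.
have u0 : 0 <= u by exact: sqrtr_ge0.
have v0 : 0 <= v by exact: sqrtr_ge0.
rewrite -[leRHS]ger0_norm ?addr_ge0// -sqrtr_sqr ler_wsqrtr//.
rewrite !sqrrD u2 v2.
suff : x * x' + y * y' <= u * v by lra.
rewrite -[leRHS]ger0_norm ?mulr_ge0// -[leLHS]ger0_norm; last first.
  by rewrite addr_ge0// mulr_ge0.
rewrite -ler_sqr ?nnegrE// !real_normK ?num_real// exprMn u2 v2.
have := sqr_ge0 (x * y' - y * x'); lra.
Qed.

Lemma seminorm_sqrt_sum_sqr (X : set V) (P Q : V -> R) : seminorm_on X P ->
  seminorm_on X Q -> seminorm_on X (fun x => Num.sqrt (P x ^+ 2 + Q x ^+ 2)).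
Proof.
move=> sP sQ; split.
- exact: (sn0 sP).
- exact: (sn_lin sP).
- move=> x y Xx Xy; have Xxy := snD sP Xx Xy.
  apply: le_trans (sqrt_sum_sqr_tri _ _ _ _); rewrite ?(sn_ge0 sP)// ?(sn_ge0 sQ)//.
  have sqr_tri M : seminorm_on X M -> M (x + y) ^+ 2 <= (M x + M y) ^+ 2.
    move=> sM; rewrite lerXn2r ?nnegrE ?(sn_ge0 sM)// ?addr_ge0 ?(sn_ge0 sM)//.
    exact: (sn_tri sM).
  by rewrite ler_wsqrtr// lerD// sqr_tri.
- move=> c x Xx; rewrite (sn_homo sP)// (sn_homo sQ)// !exprMn -mulrDr.
  by rewrite sqrtrM ?sqr_ge0// sqrtr_sqr normr_id.
Qed.

Lemma seminorm_sub (X Y : set V) (N : V -> R) : seminorm_on X N -> Y `<=` X ->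
  Y 0 -> (forall (c : R) x y, Y x -> Y y -> Y (c *: x + y)) -> seminorm_on Y N.
Proof.
move=> sn YX Y0 Yl; split=> //.
- by move=> x y /YX ? /YX ?; exact: (sn_tri sn).
- by move=> c x /YX ?; exact: (sn_homo sn).
Qed.

Lemma seminorm_eq (X : set V) (N N' : V -> R) : seminorm_on X N ->
  N =1 N' -> seminorm_on X N'.
Proof. by move=> sn /funext <-. Qed.

(** [L] is only additive and homogeneous up to the seminorm, as weak
    differentiation is. *)
Lemma seminorm_comp (W : lmodType R) (X : set V) (Y : set W) (N : W -> R)
    (L : V -> W) : seminorm_on Y N -> X 0 ->
  (forall (c : R) x y, X x -> X y -> X (c *: x + y)) ->
  (forall x, X x -> Y (L x)) ->
  (forall (c : R) x y, X x -> X y -> N (L (c *: x + y)) = N (c *: L x + L y)) ->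
  seminorm_on X (N \o L).
Proof.
move=> sn X0 Xl XY Ll.
have L0 : N (L 0) = 0.
  apply/eqP; rewrite eq_le (sn_ge0 sn (XY _ X0)) andbT.
  have := Ll (-1) 0 0 X0 X0.
  rewrite scaler0 addr0 scaleN1r addNr => ->.
  by rewrite (sn_norm0 sn).
have LZ (c : R) x : X x -> N (L (c *: x)) = `|c| * N (L x).
  move=> Xx; have := Ll c x 0 Xx X0; rewrite addr0 => ->.
  have Y1 := XY _ Xx; have Y0 := XY _ X0; have Yc := snZ sn c Y1.
  rewrite -(sn_homo sn)//; apply: (eqN_norm sn); split=> //.
    exact: (snD sn).
  by rewrite addrAC subrr add0r.
split=> //= x y Xx Xy; have := Ll 1 x y Xx Xy; rewrite !scale1r => ->.
by apply: (sn_tri sn); exact: XY.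
Qed.

End SeminormConstructions.

(** * Sobolev spaces and boundary values *)

Section SobolevSpaces.
Context {R : realType}.
Variables a b : R.
Hypothesis ab : a < b.
Local Notation mu := (muO a b).
Local Notation mR := (measurableTypeR R).
Local Notation L2 := (L2 a b).
Local Notation normL2 := (normL2 a b).
Local Notation H1 := (H1 a b).
Local Notation normH1 := (normH1 a b).
Local Notation H2 := (H2 a b).
Local Notation normH2 := (normH2 a b).
Local Notation H10 := (H10 a b).
Local Notation H2D := (H2D a b).
Local Notation weakD := (weakD a b).
Local Notation trace := (has_trace a b).
Local Notation wd := (is_weak_derivative a b).
Local Notation aeq := (aeq a b).
Implicit Types f g : R -> R.

Let sn := L2_seminorm a b.

Lemma weakDP f : H1 f -> L2 (weakD f) /\ wd f (weakD f).
Proof.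
move=> [Lf [g Lg w]]; have := @xgetPex _ (fun=> 0) [set g | L2 g /\ wd f g].
by apply; exists g.
Qed.

Lemma H1_L2 f : H1 f -> L2 f. Proof. by case. Qed.

Lemma weakD_L2 f : H1 f -> L2 (weakD f). Proof. by move=> /weakDP[]. Qed.

Lemma weakD_wd f g : L2 f -> L2 g -> wd f g -> H1 f /\ aeq (weakD f) g.
Proof.
move=> Lf Lg w; have Hf : H1 f by split=> //; exists g.
by split=> //; have [Ld wD] := weakDP Hf; exact: wd_unique w.
Qed.

(** An equality of functions and not only almost everywhere, since the same
    predicate is passed to the choice operator. *)
Lemma weakD_aeq f g : L2 f -> L2 g -> aeq f g -> weakD f = weakD g.
Proof.
move=> Lf Lg fg; rewrite /Defs.weakD; congr xget.
apply/seteqP; split=> h [Lh w]; split=> //.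
  exact: wd_aeq fg w.
by apply: wd_aeq (aeq_sym fg) w.
Qed.

Lemma H1_aeq f g : L2 f -> L2 g -> aeq f g -> H1 f -> H1 g.
Proof.
move=> Lf Lg fg [_ [h Lh w]]; split=> //; exists h => //.
exact: wd_aeq fg w.
Qed.

Lemma H1_weakD_lin (c : R) f g : H1 f -> H1 g -> H1 (c *: f + g) /\
  aeq (weakD (c *: f + g)) (c *: weakD f + weakD g).
Proof.
move=> Hf Hg; have [Lf' wf] := weakDP Hf; have [Lg' wg] := weakDP Hg.
apply: weakD_wd; first by apply: L2_lin; exact: H1_L2.
  exact: L2_lin.
by apply: wd_lin => //; exact: H1_L2.
Qed.

Lemma H1_0 : H1 0.
Proof.
have L0 := L2_cst0 a b.
have [] := @weakD_wd 0 0 L0 L0 _ => //.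
exact: cst_wd.
Qed.

Lemma H1_seminorm : seminorm_on H1 normH1.
Proof.
have Hl (c : R) f g : H1 f -> H1 g -> H1 (c *: f + g).
  by move=> Hf Hg; have [] := H1_weakD_lin c Hf Hg.
apply: (seminorm_sqrt_sum_sqr (P := normL2) (Q := normL2 \o weakD)).
  by apply: (seminorm_sub sn) => //; [exact: H1_L2|exact: H1_0].
apply: (seminorm_comp sn) => //.
- exact: H1_0.
- exact: weakD_L2.
- move=> c f g Hf Hg; have [Hfg E] := H1_weakD_lin c Hf Hg.
  apply: aeq_normL2 E; first exact: weakD_L2.
  by apply: L2_lin; exact: weakD_L2.
Qed.

Lemma H2_H1 f : H2 f -> H1 f. Proof. by case. Qed.

Lemma H2_weakD_lin (c : R) f g : H2 f -> H2 g -> H2 (c *: f + g) /\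
  aeq (weakD (weakD (c *: f + g))) (c *: weakD (weakD f) + weakD (weakD g)).
Proof.
move=> [Hf Hf'] [Hg Hg']; have [Hfg E] := H1_weakD_lin c Hf Hg.
have [Hfg' E'] := H1_weakD_lin c Hf' Hg'.
have L1 := weakD_L2 Hfg; have L3 := H1_L2 Hfg'.
split; last by rewrite (weakD_aeq L1 L3 E).
by split; [exact: Hfg|exact: (H1_aeq L3 L1 (aeq_sym E) Hfg')].
Qed.

Lemma H2_0 : H2 0.
Proof.
have L0 := L2_cst0 a b.
have [H0 E] := @weakD_wd 0 0 L0 L0 (cst_wd ab 0).
by split=> //; exact: (H1_aeq L0 (weakD_L2 H0) (aeq_sym E) H1_0).
Qed.

Lemma H2_seminorm : seminorm_on H2 normH2.
Proof.
have Hl (c : R) f g : H2 f -> H2 g -> H2 (c *: f + g).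
  by move=> Hf Hg; have [] := H2_weakD_lin c Hf Hg.
have s1 : seminorm_on H2 normH1.
  by apply: (seminorm_sub H1_seminorm) => //; [exact: H2_H1|exact: H2_0].
have s2 : seminorm_on H2 (normL2 \o (weakD \o weakD)).
  apply: (seminorm_comp sn) => //.
  - exact: H2_0.
  - by move=> f [_]; exact: weakD_L2.
  - move=> c f g Hf Hg; have [[_ Hfg] E] := H2_weakD_lin c Hf Hg.
    apply: aeq_normL2 E; first exact: weakD_L2.
    by apply: L2_lin; apply: weakD_L2; [case: Hf|case: Hg].
apply: seminorm_eq (seminorm_sqrt_sum_sqr s1 s2) _ => f.
by rewrite /Defs.normH1 sqr_sqrtr// addr_ge0 ?sqr_ge0.
Qed.

Lemma normL2_le_H1 f : normL2 f <= normH1 f.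
Proof.
rewrite -[leLHS]ger0_norm ?normL2_ge0// -sqrtr_sqr ler_wsqrtr// lerDl.
exact: sqr_ge0.
Qed.

Lemma normL2_le_H2 f : normL2 f <= normH2 f.
Proof.
rewrite -[leLHS]ger0_norm ?normL2_ge0// -sqrtr_sqr ler_wsqrtr// -addrA lerDl.
by rewrite addr_ge0 ?sqr_ge0.
Qed.

Lemma cst_H2 (c : R) : H2 (cst c).
Proof.
have Lc := L2_cst a b c; have L0 := L2_cst0 a b.
have [H0 E] := weakD_wd Lc L0 (cst_wd ab c).
by split=> //; exact: (H1_aeq L0 (weakD_L2 H0) (aeq_sym E) H1_0).
Qed.

Lemma trace_lin (c : R) f g ya yb za zb : trace f ya yb -> trace g za zb ->
  trace (c *: f + g) (c * ya + za) (c * yb + zb).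
Proof.
move=> [F [cF fF Fa Fb]] [G [cG gG Ga Gb]]; exists (c *: F + G); split.
- move=> x; apply: cvgD; last exact: cG.
  by apply: cvgM; [exact: cvg_cst|exact: cF].
- by apply: ae_imp2 fF gG => x fx gx; rewrite -[LHS]/(c * f x + g x) fx gx.
- by rewrite -Fa -Ga.
- by rewrite -Fb -Gb.
Qed.

Lemma trace_cst (c : R) : trace (cst c) c c.
Proof.
by exists (cst c); split=> //; [move=> x; exact: cvg_cst|exact: aeq_refl].
Qed.

Lemma H10_lin (c : R) f g : H10 f -> H10 g -> H10 (c *: f + g).
Proof.
move=> [Hf tf] [Hg tg]; split; first by have [] := H1_weakD_lin c Hf Hg.
by have := trace_lin c tf tg; rewrite mulr0 addr0.
Qed.

Lemma H10_0 : H10 0.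
Proof. by split; [exact: H1_0|exact: trace_cst]. Qed.

Lemma H2D_lin (c : R) f g : H2D f -> H2D g -> H2D (c *: f + g).
Proof.
move=> [Hf tf] [Hg tg]; split; last exact: H10_lin.
by have [] := H2_weakD_lin c Hf Hg.
Qed.

Lemma H2D_0 : H2D 0.
Proof. by split; [exact: H2_0|exact: H10_0]. Qed.

Lemma test_H10 (phi : R -> R) : test_function a b phi -> H10 phi.
Proof.
move=> tp; have Lp := test_L2 tp; have Lp' := test_derive_L2 tp.
split; first by have [] := weakD_wd Lp Lp' (test_wd ab tp).
have cp := test_continuous tp; have [_ _ [c [d [ac db p0]]]] := tp.
exists phi; split.
- exact: continuous_subspaceT.
- exact: aeq_refl.
- by apply: p0; rewrite negb_and -!ltNge ac.
- by apply: p0; rewrite negb_and -!ltNge db orbT.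
Qed.

(** Two continuous functions that agree almost everywhere near an end point
    agree there, since every neighbourhood of it has positive measure. *)
Lemma trace_unique f ya yb za zb : trace f ya yb -> trace f za zb ->
  ya = za /\ yb = zb.
Proof.
move=> [F [cF fF Fa Fb]] [G [cG gG Ga Gb]].
pose D x := F x - G x.
have cD : {within `[a, b], continuous D}.
  by move=> x; apply: cvgB; [exact: cF|exact: cG].
have [N [mN N0 HN]] : {ae (@lebesgue_measure R), forall x, a < x < b -> D x = 0}.
  apply/ae_muOP; apply: ae_imp2 fF gG => x Fx Gx.
  by rewrite /D -Fx -Gx subrr.
have D0 u v : a <= u -> u < v -> v <= b -> exists2 x, u < x < v & D x = 0.
  move=> au uv vb; apply: contrapT => H.
  have sub : `]u, v[%classic `<=` N.
    move=> x /=; rewrite in_itv/= => /andP[ux xv]; apply: HN => /= Hx.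
    apply: H; exists x; first by rewrite ux.
    by apply: Hx; rewrite (le_lt_trans au)//= (lt_le_trans xv).
  have muv : ((@lebesgue_measure R) `]u, v[%classic <= 0)%E.
    by rewrite -N0; apply: le_measure; rewrite ?inE//; exact: measurable_itv.
  move: muv; have := @lebesgue_measure_itv R `]u, v[; rewrite /= lte_fin uv => ->.
  by rewrite -EFinB lee_fin leNgt subr_gt0 uv.
have end0 e : (e = a) \/ (e = b) -> D e = 0.
  move=> eab; apply/eqP; rewrite -normr_le0 leNgt; apply/negP => De.
  have eI : `[a, b]%classic e.
    by rewrite /= in_itv/=; case: eab => ->; rewrite lexx ltW.
  have cDe := (subspace_continuousP _ _).1 cD e eI.
  have /nbhs_ballP[eta /= eta0 Heta] :
      nbhs e [set t | `[a, b]%classic t -> `|D e - D t| < `|D e|].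
    exact: ((cvgrPdist_lt _ _).1 cDe _ De).
  have [x xab [xe xD]] : exists2 x, a < x < b & `|e - x| < eta /\ D x = 0.
    pose k := Num.min eta (b - a); have k0 : 0 < k by rewrite lt_min eta0 subr_gt0.
    have [keta kba] : k <= eta /\ k <= b - a by rewrite /k !ge_min !lexx orbT.
    case: eab => ->.
    - have [||x /andP[ax xk] xD] := D0 a (a + k) (lexx a); first lra; first lra.
      exists x; first by apply/andP; split; lra.
      by split=> //; rewrite ler0_norm; lra.
    - have [|||x /andP[ax xk] xD] := D0 (b - k) b; first lra; first lra; first lra.
      exists x; first by apply/andP; split; lra.
      by split=> //; rewrite ger0_norm; lra.
  have := Heta x; rewrite /ball/= xD subr0 ltxx => H.
  suff : false by []; apply: H => //.
  by rewrite in_itv/=; case/andP: xab => *; rewrite !ltW.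
have := end0 a (or_introl erefl); have := end0 b (or_intror erefl).
by rewrite /D Fa Fb Ga Gb => /subr0_eq-> /subr0_eq->.
Qed.

End SobolevSpaces.

(** * The state space and its semigroup *)

Lemma cvg0_at_right0P (R : realType) (phi : R -> R) :
  (forall h, 0 < h -> 0 <= phi h) ->
  phi h @[h --> 0^'+] --> (0 : R) <->
  forall e, 0 < e -> exists2 d, 0 < d & forall h, 0 < h < d -> phi h < e.
Proof.
move=> phi0; split=> [H e e0|H].
  have /nbhs_ballP[d /= d0 Hd] : nbhs (0 : R) [set h | 0 < h -> `|0 - phi h| < e].
    exact: ((cvgrPdist_lt _ _).1 H _ e0).
  exists d => // h /andP[h0 hd]; have := Hd h.
  rewrite /ball/= sub0r normrN gtr0_norm// sub0r normrN => /(_ hd h0).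
  by rewrite ger0_norm// phi0.
apply/cvgrPdist_lt => e e0; have [d d0 Hd] := H e e0.
suff : nbhs (0 : R) [set h | 0 < h -> `|0 - phi h| < e] by [].
apply/nbhs_ballP; exists d => // h; rewrite /ball/= sub0r normrN => hd h0.
rewrite sub0r normrN ger0_norm ?phi0// Hd// h0/=.
by rewrite gtr0_norm in hd.
Qed.

Section StateSpace.
Context {R : realType}.
Variables a b : R.
Hypothesis ab : a < b.
Local Notation L2 := (L2 a b).
Local Notation normL2 := (normL2 a b).
Local Notation H1 := (H1 a b).
Local Notation normH1 := (normH1 a b).
Local Notation L2H10 := (L2H10 a b).
Local Notation N := (normL2H1 a b).
Local Notation weakD := (weakD a b).
Local Notation state := (@state R).

Definition L2H1 : set state := [set x | L2 x.1 /\ H1 x.2].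

Definition comp1 (x : state) : R := normL2 x.1.
Definition comp2 (x : state) : R := normL2 x.2.

Lemma L2H1_seminorm : seminorm_on L2H1 N.
Proof.
have sn1 := L2_seminorm a b; have sn2 := H1_seminorm ab.
have X0 : L2H1 0 by split; [exact: (sn0 sn1)|exact: (sn0 sn2)].
have Xl (c : R) x y : L2H1 x -> L2H1 y -> L2H1 (c *: x + y).
  by move=> [? ?] [? ?]; split; [exact: (sn_lin sn1)|exact: (sn_lin sn2)].
apply: (seminorm_sqrt_sum_sqr (P := normL2 \o fst) (Q := normH1 \o snd)).
  by apply: (seminorm_comp sn1) => // x [].
by apply: (seminorm_comp sn2) => // x [].
Qed.

Lemma L2H10_L2H1 x : L2H10 x -> L2H1 x. Proof. by move=> [? []]. Qed.

Lemma L2H10_0 : L2H10 0.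
Proof. by split; [exact: L2_cst0|exact: H10_0]. Qed.

Lemma L2H10_lin (c : R) x y : L2H10 x -> L2H10 y -> L2H10 (c *: x + y).
Proof. by move=> [? ?] [? ?]; split; [exact: L2_lin|exact: H10_lin]. Qed.

Lemma L2H10_seminorm : seminorm_on L2H10 N.
Proof.
apply: (seminorm_sub L2H1_seminorm); last exact: L2H10_lin.
  by move=> x; exact: L2H10_L2H1.
exact: L2H10_0.
Qed.

Lemma comp1_seminorm : seminorm_on L2H1 comp1.
Proof.
apply: (seminorm_comp (L2_seminorm a b) (L := fst)) => //.
- exact: (sn0 L2H1_seminorm).
- exact: (sn_lin L2H1_seminorm).
- by move=> x [].
Qed.

Lemma comp2_seminorm : seminorm_on L2H1 comp2.
Proof.
apply: (seminorm_comp (L2_seminorm a b) (L := snd)) => //.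
- exact: (sn0 L2H1_seminorm).
- exact: (sn_lin L2H1_seminorm).
- by move=> x [_ /H1_L2].
Qed.

Lemma comp1_seminorm10 : seminorm_on L2H10 comp1.
Proof.
apply: (seminorm_sub comp1_seminorm); last exact: L2H10_lin.
  by move=> x; exact: L2H10_L2H1.
exact: L2H10_0.
Qed.

Lemma comp2_seminorm10 : seminorm_on L2H10 comp2.
Proof.
apply: (seminorm_sub comp2_seminorm); last exact: L2H10_lin.
  by move=> x; exact: L2H10_L2H1.
exact: L2H10_0.
Qed.

Lemma comp1_le x : comp1 x <= N x.
Proof.
rewrite -[leLHS]ger0_norm ?normL2_ge0// -sqrtr_sqr ler_wsqrtr// lerDl.
exact: sqr_ge0.
Qed.

Lemma normH1_le x : normH1 x.2 <= N x.
Proof.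
rewrite -[leLHS]ger0_norm ?sqrtr_ge0// -sqrtr_sqr ler_wsqrtr// lerDr.
exact: sqr_ge0.
Qed.

Lemma comp2_le x : comp2 x <= N x.
Proof. by apply: le_trans (normH1_le x); exact: normL2_le_H1. Qed.

Lemma norm_comp1 f : N (f, 0 : R -> R) = normL2 f.
Proof.
rewrite /normL2H1/= (sn_norm0 (H1_seminorm ab)) expr0n/= addr0.
by rewrite sqrtr_sqr ger0_norm// normL2_ge0.
Qed.

Lemma aeq_normH1 f g : H1 f -> H1 g -> aeq a b f g -> normH1 f = normH1 g.
Proof.
move=> [Lf _] [Lg _] fg.
by rewrite /Defs.normH1 (weakD_aeq Lf Lg fg) (aeq_normL2 Lf Lg fg).
Qed.

Lemma aeq2_eqN x y : L2H10 x -> L2H10 y -> aeq2 a b x y -> eqN L2H10 N x y.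
Proof.
move=> Xx Xy [xy1 xy2]; split=> //.
have [L1 H1x] := L2H10_L2H1 (snB L2H10_seminorm Xx Xy).
rewrite -(sn_norm0 L2H1_seminorm) /normL2H1.
have [L0 H0] := sn0 L2H1_seminorm.
have sub0 (u v : R -> R) : aeq a b u v -> aeq a b (u - v) 0.
  by apply: ae_imp => t; rewrite -[(u - v) t]/(u t - v t) => ->; rewrite subrr.
by rewrite (aeq_normL2 L1 L0 (sub0 _ _ xy1)) (aeq_normH1 H1x H0 (sub0 _ _ xy2)).
Qed.

Section Semigroup.
Context (S : R -> state -> state) (M0 : R).
Hypothesis C0S : C0_semigroup a b S.
Hypothesis normS :
  ereal_sup [set op_norm a b (S t) | t in [set t | 0 <= t]] = M0%:E.

Let sn := L2H10_seminorm.

Lemma op_norm_unit t x : 0 <= t -> L2H10 x -> N x <= 1 -> N (S t x) <= M0.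
Proof.
move=> t0 Xx x1; rewrite -lee_fin -normS.
apply: le_trans (_ : (op_norm a b (S t) <= _)%E).
  by apply: ereal_sup_ubound; exists x.
by apply: ereal_sup_ubound; exists t.
Qed.

(** The bound on the unit ball extends by scaling [x] by any number above its
    norm, which may vanish. *)
Lemma semigroupP : semigroup_mod L2H10 N S M0.
Proof.
have [bS S0 SD _] := C0S.
have XS t x : 0 <= t -> L2H10 x -> L2H10 (S t x).
  by move=> /bS[H _ _]; exact: H.
have linS t (c : R) x y : 0 <= t -> L2H10 x -> L2H10 y ->
    eqN L2H10 N (S t (c *: x + y)) (c *: S t x + S t y).
  move=> t0 Xx Xy; apply: aeq2_eqN.
  - by apply: XS => //; exact: (sn_lin sn).
  - by apply: (sn_lin sn); exact: XS.
  - by have [_ H _] := bS t t0; exact: H.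
have M00 : 0 <= M0.
  have X0 := sn0 sn; apply: le_trans (op_norm_unit (lexx 0) X0 _).
    by apply: (sn_ge0 sn); exact: XS.
  by rewrite (sn_norm0 sn).
have S_0 t : 0 <= t -> eqN L2H10 N (S t 0) 0.
  move=> t0; have X0 := sn0 sn; have := linS t (-1) 0 0 t0 X0 X0.
  by rewrite scaler0 addr0 scaleN1r addNr.
split=> //.
- by move=> t c x y t0 Xx Xy; have [] := linS t c x y t0 Xx Xy.
- move=> t x t0 Xx; apply/ler_addgt0Pr => e e0.
  have M10 : 0 < M0 + 1 by rewrite ltr_wpDl.
  pose c := N x + e / (M0 + 1).
  have ed0 : 0 < e / (M0 + 1) by exact: divr_gt0.
  have c0 : 0 < c by rewrite /c ltr_wpDl// (sn_ge0 sn).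
  have Xcx := snZ sn c^-1 Xx.
  have : N (S t (c^-1 *: x)) <= M0.
    apply: op_norm_unit => //; rewrite (sn_homo sn)// gtr0_norm ?invr_gt0//.
    by rewrite ler_pdivrMl// mulr1 /c lerDl ltW.
  have E : eqN L2H10 N (S t (c^-1 *: x)) (c^-1 *: S t x).
    have := linS t c^-1 x 0 t0 Xx (sn0 sn); rewrite addr0 => /(eqN_trans sn); apply.
    rewrite -[X in eqN _ _ _ X]addr0; apply: (eqND sn); last exact: S_0.
    by apply: (eqN_refl sn); apply: (snZ sn); exact: XS.
  rewrite (eqN_norm sn E) (sn_homo sn); last exact: XS.
  rewrite gtr0_norm ?invr_gt0// ler_pdivrMl// mulrC => /le_trans; apply.
  rewrite /c mulrDr lerD2l mulrCA ler_piMr ?(ltW e0)//.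
  by rewrite ler_pdivrMr// mul1r lerDl.
- by move=> x Xx; have [] := aeq2_eqN (XS _ _ (lexx 0) Xx) Xx (S0 x Xx).
- move=> s t x s0 t0 Xx.
  have [] := aeq2_eqN _ _ (SD s t x s0 t0 Xx) => //.
    by apply: XS => //; exact: addr_ge0.
  exact: (XS s _ s0 (XS t x t0 Xx)).
Qed.

Hypothesis genA : generated_by_A a b S.
Local Notation domA := (domA a b).
Local Notation opA := (opA a b).

Lemma domA_L2H10 x : domA x -> L2H10 x.
Proof. by move=> [[[L1 _] _] [_ ?]]. Qed.

Lemma opA_L2H10 x : domA x -> L2H10 (opA x).
Proof. by move=> [? [[_ /weakD_L2 ?] _]]. Qed.

Lemma domA_lin (c : R) x y : domA x -> domA y -> domA (c *: x + y).
Proof. by move=> [? ?] [? ?]; split; [exact: H10_lin|exact: H2D_lin]. Qed.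

Lemma domA_0 : domA 0.
Proof. by split; [exact: H10_0|exact: H2D_0]. Qed.

Lemma diffq_ge0 x y h : L2H10 x -> L2H10 y -> 0 < h ->
  0 <= N (h^-1 *: (S h x - x) - y).
Proof.
move=> Xx Xy h0; apply: (sn_ge0 sn); apply: (snB sn) => //.
apply: (snZ sn); apply: (snB sn) => //.
exact: (sg_X semigroupP (ltW h0)).
Qed.

Lemma domA_gen x : domA x -> right_derivative_at0 N S x (opA x).
Proof.
move=> Dx; have Xx := domA_L2H10 Dx; have XA := opA_L2H10 Dx.
apply/cvg0_at_right0P; first by move=> h; exact: diffq_ge0.
by apply/(genA Xx XA); split=> //; split; exact: aeq_refl.
Qed.

Lemma gen_domA x y : L2H10 x -> L2H10 y -> right_derivative_at0 N S x y ->
  domA x /\ N (y - opA x) = 0.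
Proof.
move=> Xx Xy H; have [Dx yA] : domA x /\ aeq2 a b y (opA x).
  apply/(genA Xx Xy).
  by apply/cvg0_at_right0P; [move=> h; exact: diffq_ge0|exact: H].
by split=> //; have [] := aeq2_eqN Xy (opA_L2H10 Dx) yA.
Qed.

End Semigroup.

(** A function with a continuous representative is an L^2 limit of test
    functions, which vanish at the boundary although it need not. *)
Lemma closure_dom_continuous (f F : R -> R) : L2 f -> {within `[a, b], continuous F} ->
  aeq a b f F -> closure_dom L2H10 N (domA a b) (f, 0).
Proof.
move=> Lf cF fF; split; first by split=> //; exact: H10_0.
move=> e e0.
have [G [FG cG]] : exists G : R -> R, {in `[a, b]%classic, F =1 G} /\ continuous G.
  have [K [_ HK]] := @compact_bounded R R (F @` `[a, b])
    (continuous_compact cF (@segment_compact R a b)).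
  have K0 : 0 < `|K| + 1 by rewrite ltr_wpDl.
  have clo : closed (`[a, b]%classic : set R) by exact: itv_closed.
  have bd x : `[a, b]%classic x -> `|F x| <= `|K| + 1.
    move=> xab; apply: (HK (`|K| + 1)); last by exists x.
    by rewrite (le_lt_trans (ler_norm _))// ltrDl.
  have [G [FG cG _]] :=
    continuous_bounded_extension (@pseudometric_normal R R) clo K0 cF bd.
  by exists G.
have [phi tphi Hphi] := continuous_test_dense a b cG e0.
exists (phi, 0); first by split; [exact: test_H10|exact: H2D_0].
have sn := L2_seminorm a b.
rewrite -[(f, 0) - _]/((f - phi, 0 - 0) : state) subrr norm_comp1.
have Lphi := test_L2 tphi; have LG := continuous_L2 a b cG.
rewrite (@aeq_normL2 _ a b _ (G - phi))//; [exact: (snB sn)|exact: (snB sn)|].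
apply/aeqP; move: fF => /aeqP; apply: (@filterS _ _ (ae_filter_ringOfSetsType _)).
move=> x fF xab; have /andP[ax xb] := xab.
rewrite -[LHS]/(f x - phi x) -[RHS]/(G x - phi x) fF// FG//.
by rewrite inE/= in_itv/= !ltW.
Qed.

End StateSpace.

(** * The inverse square nonlinearity *)

Section InverseSquare.
Context {R : realType}.
Variable k : R.
Hypothesis k0 : 0 < k.
Implicit Types w z : R.

Lemma inv_bound w : k <= w -> 0 <= w^-1 <= k^-1.
Proof.
move=> kw; have w0 : 0 < w by exact: lt_le_trans kw.
by rewrite invr_ge0 ltW//= lef_pV2.
Qed.

Lemma inv_lipschitz w w' : k <= w -> k <= w' ->
  `|w'^-1 - w^-1| <= k^-1 ^+ 2 * `|w' - w|.
Proof.
move=> kw kw'; have w0 : 0 < w by exact: lt_le_trans kw.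
have w'0 : 0 < w' by exact: lt_le_trans kw'.
have -> : w'^-1 - w^-1 = w'^-1 * w^-1 * (w - w').
  by field; rewrite !gt_eqF.
rewrite normrM distrC ler_wpM2r// expr2.
have /andP[i0 ik] := inv_bound kw; have /andP[i'0 i'k] := inv_bound kw'.
by rewrite ger0_norm ?mulr_ge0// ler_pM.
Qed.

Lemma invsq_lipschitz w w' : k <= w -> k <= w' ->
  `|w' ^- 2 - w ^- 2| <= 2 * k^-1 ^+ 3 * `|w' - w|.
Proof.
move=> kw kw'; rewrite -!exprVn subr_sqr normrM.
have /andP[i0 ik] := inv_bound kw; have /andP[i'0 i'k] := inv_bound kw'.
rewrite [X in _ * X]ger0_norm ?addr_ge0//.
have -> : 2 * k^-1 ^+ 3 * `|w' - w| = k^-1 ^+ 2 * `|w' - w| * (k^-1 + k^-1) by ring.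
by apply: ler_pM; rewrite ?addr_ge0// ?inv_lipschitz// lerD.
Qed.

(** The four point inequality behind the Hölder estimate of the nonlinear term:
    the increment of [w1 ^- 2 - w2 ^- 2] is controlled by the increment of the
    difference [w1 - w2] and, to second order, by the increments of [w1], [w2]. *)
Lemma invsq_second_difference w1 w2 w1' w2' :
  k <= w1 -> k <= w2 -> k <= w1' -> k <= w2' ->
  `|(w1' ^- 2 - w2' ^- 2) - (w1 ^- 2 - w2 ^- 2)| <=
  2 * k^-1 ^+ 3 * `|(w1' - w2') - (w1 - w2)| +
  3 * k^-1 ^+ 4 * (`|w1' - w1| + `|w2' - w2|) * `|w1' - w2'|.
Proof.
move=> kw1 kw2 kw1' kw2'.
have p w : k <= w -> w != 0 by move=> kw; rewrite gt_eqF// (lt_le_trans k0).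
pose i1 := w1^-1; pose i2 := w2^-1; pose j1 := w1'^-1; pose j2 := w2'^-1.
have -> : (w1' ^- 2 - w2' ^- 2) - (w1 ^- 2 - w2 ^- 2) =
   - (i1 * i2 * (i1 + i2) * ((w1' - w2') - (w1 - w2)) +
     ((j1 ^+ 2 - i1 ^+ 2) * j2 + i1 ^+ 2 * (j2 - i2) + (j1 - i1) * j2 ^+ 2 +
      i1 * (j2 ^+ 2 - i2 ^+ 2)) * (w1' - w2')).
  by rewrite /i1 /i2 /j1 /j2; field; rewrite !p.
have /andP[i10 i1k] := inv_bound kw1; have /andP[i20 i2k] := inv_bound kw2.
have /andP[j10 j1k] := inv_bound kw1'; have /andP[j20 j2k] := inv_bound kw2'.
have K0 : 0 <= k^-1 by rewrite invr_ge0 ltW.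
rewrite normrN; apply: le_trans (ler_normD _ _) _; rewrite !normrM.
apply: lerD; rewrite ler_wpM2r//.
  rewrite !ger0_norm ?addr_ge0//.
  have -> : 2 * k^-1 ^+ 3 = k^-1 * k^-1 * (k^-1 + k^-1) by ring.
  by rewrite ler_pM ?mulr_ge0 ?addr_ge0// ?ler_pM// lerD.
have d1 := inv_lipschitz kw1 kw1'; have d2 := inv_lipschitz kw2 kw2'.
have s1 := invsq_lipschitz kw1 kw1'; have s2 := invsq_lipschitz kw2 kw2'.
rewrite -!exprVn -/i1 -/i2 -/j1 -/j2 in s1 s2 d1 d2.
have -> : 3 * k^-1 ^+ 4 * (`|w1' - w1| + `|w2' - w2|) =
  2 * k^-1 ^+ 3 * `|w1' - w1| * k^-1 + k^-1 ^+ 2 * (k^-1 ^+ 2 * `|w2' - w2|) +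
  k^-1 ^+ 2 * `|w1' - w1| * k^-1 ^+ 2 + k^-1 * (2 * k^-1 ^+ 3 * `|w2' - w2|).
  by ring.
have sq u : 0 <= u -> u <= k^-1 -> `|u ^+ 2| <= k^-1 ^+ 2.
  by move=> u0 uk; rewrite ger0_norm ?exprn_ge0// lerXn2r ?nnegrE.
apply: le_trans (ler_normD _ _) _; apply: lerD; last first.
  by rewrite normrM ler_pM// ger0_norm.
apply: le_trans (ler_normD _ _) _; apply: lerD; last first.
  by rewrite normrM ler_pM// sq.
apply: le_trans (ler_normD _ _) _; apply: lerD; last first.
  by rewrite normrM ler_pM// sq.
by rewrite normrM ler_pM// ger0_norm.
Qed.

End InverseSquare.

(** * Domination in L^2 *)

Section DominationL2.
Context {R : realType}.
Variables a b : R.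
Local Notation mu := (muO a b).
Local Notation mR := (measurableTypeR R).
Local Notation L2 := (L2 a b).
Local Notation normL2 := (normL2 a b).

Lemma L2_norm (f : mR -> R) : L2 f ->
  L2 (fun x => `|f x|) /\ normL2 (fun x => `|f x|) <= normL2 f.
Proof.
move=> Lf; rewrite -[leRHS]mul1r; apply: L2_dom => //.
  by apply: measurableT_comp => //; exact: L2_measurable Lf.
by apply: ae_itv => x _; rewrite mul1r normr_id.
Qed.

(** Three terms are what the increments of the source of the linear equation
    require. *)
Lemma L2_dom3 (f g1 g2 g3 : mR -> R) (c1 c2 c3 : R) :
  measurable_fun [set: mR] f -> L2 g1 -> L2 g2 -> L2 g3 ->
  0 <= c1 -> 0 <= c2 -> 0 <= c3 ->
  {ae mu, forall x, `|f x| <= c1 * `|g1 x| + c2 * `|g2 x| + c3 * `|g3 x|} ->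
  L2 f /\ normL2 f <= c1 * normL2 g1 + c2 * normL2 g2 + c3 * normL2 g3.
Proof.
move=> mf Lg1 Lg2 Lg3 c10 c20 c30 H; have sn := L2_seminorm a b.
have [L1 N1] := L2_norm Lg1; have [L2' N2] := L2_norm Lg2.
have [L3 N3] := L2_norm Lg3.
pose n1 x := `|g1 x|; pose n2 x := `|g2 x|; pose n3 x := `|g3 x|.
pose g : R -> R := c1 *: n1 + c2 *: n2 + c3 *: n3.
have Lc1 : L2 (c1 *: n1) := snZ sn c1 L1.
have Lc2 : L2 (c2 *: n2) := snZ sn c2 L2'.
have Lc3 : L2 (c3 *: n3) := snZ sn c3 L3.
have Lg : L2 g by do 2!apply: (snD sn) => //.
have [] := L2_dom ler01 mf Lg _.
  apply: ae_imp H => x /le_trans; apply; rewrite mul1r.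
  exact: ler_norm.
move=> Lf /le_trans Hf; split=> //; apply: Hf; rewrite mul1r.
apply: le_trans (sn_tri sn (snD sn Lc1 Lc2) Lc3) _.
have := sn_tri sn Lc1 Lc2.
rewrite !(sn_homo sn)// !ger0_norm//.
have := ler_wpM2l c10 N1; have := ler_wpM2l c20 N2; have := ler_wpM2l c30 N3.
by rewrite -/n1 -/n2 -/n3; lra.
Qed.

Lemma Noo_ae (f : mR -> R) (c : R) : a < b ->
  ('N[mu]_+oo[EFin \o f] <= c%:E)%E -> {ae mu, forall x, `|f x| <= c}.
Proof.
move=> ab; rewrite unlock muO_setT_gt0// => /ess_supP.
by apply: ae_imp => x /=; rewrite lee_fin.
Qed.

Lemma ess_inf_ae (f : mR -> R) (c : R) :
  ess_inf mu (EFin \o f) = c%:E -> {ae mu, forall x, c <= f x}.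
Proof.
move=> H; have /ess_infP : (c%:E <= ess_inf mu (EFin \o f))%E by rewrite H.
by apply: ae_imp => x /=; rewrite lee_fin.
Qed.

Lemma ae_cst (P : Prop) : a < b -> {ae mu, forall x : R, P} -> P.
Proof.
move=> ab [A [mA A0 HA]]; apply: contrapT => nP.
have AT : A = setT by apply/seteqP; split=> // x _; apply: HA.
by have := muO_setT_gt0 ab; rewrite -AT A0 ltxx.
Qed.

Lemma measurable_invr : measurable_fun [set: mR] (@GRing.inv R : mR -> R).
Proof.
have m0 : measurable ([set 0] : set mR) by exact: measurable_set1.
rewrite -(setUv [set 0 : mR]); apply/measurable_funU => //.
  exact: measurableC.
split; first exact: measurable_fun_set1.
apply: open_continuous_measurable_fun.
  by apply: closed_openC; exact: closed_eq.
by move=> x; rewrite inE/= => /eqP x0; exact: inv_continuous.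
Qed.

Lemma measurable_invsq (w : mR -> R) : measurable_fun [set: mR] w ->
  measurable_fun [set: mR] (fun x => w x ^- 2).
Proof.
move=> mw; apply: (measurableT_comp measurable_invr).
exact: measurable_funX.
Qed.

End DominationL2.

(** * Mild solutions and their differences *)

Section HolderConstant.
Context {R : realType}.
Variables (alpha kappa betaF betap M0 Tmax V Cs : R).

(** [Tmax] bounds the length of the time interval, [V] the norm of the first
    component of the solutions, and [Cs] is a Sobolev constant. *)
Definition growth_const : R :=
  expR ((2 * (M0 * (betaF * (2 * (kappa / 2)^-1 ^+ 3))) + 1) * Tmax).

(** The bound of [diff_le] for the difference of two solutions. *)
Definition lipschitz_const : R := 2 * (Tmax * (M0 * betap)) * growth_const.

Definition holder_const : R :=
  2 * (Tmax `^ (1 - alpha) *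
         (M0 * (betap + betaF * (2 * (kappa / 2)^-1 ^+ 3) * lipschitz_const)) +
       Tmax `^ (1 - alpha) *
         (Tmax * (M0 * (betaF * (3 * (kappa / 2)^-1 ^+ 4 *
           (Cs * lipschitz_const)) * (2 * V)))) +
       M0 * betap) * growth_const.

End HolderConstant.

Section MildSolutions.
Context {R : realType}.
Variables (a b kappa betaF betap theta2 r T C M0 : R).
Variables (u0 v0 w0 : R -> R) (S : R -> @state R -> @state R).
Local Notation mu := (muO a b).
Local Notation mR := (measurableTypeR R).
Local Notation L2 := (L2 a b).
Local Notation normL2 := (normL2 a b).
Local Notation H1 := (H1 a b).
Local Notation normH1 := (normH1 a b).
Local Notation L2H10 := (L2H10 a b).
Local Notation N := (normL2H1 a b).
Local Notation comp1 := (comp1 a b).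
Local Notation comp2 := (comp2 a b).
Local Notation mild := (mild_solution a b S betaF betap theta2 r v0 w0 T).
Local Notation shift := (((fun=> 0), (fun=> theta2)) : @state R).
Local Notation x0 := ((v0, w0) : @state R).

Hypothesis ab : a < b.
Hypotheses (kappa0 : 0 < kappa) (betaF0 : 0 < betaF) (betap0 : 0 < betap).
Hypothesis (T0 : 0 <= T).
Hypothesis Hu0 : H2 a b u0.
Hypothesis Hv0 : H10 a b v0.
Hypothesis Hw0 : H2 a b w0.
Hypothesis tw0 : has_trace a b w0 theta2 theta2.
Hypothesis inf_w0 : ess_inf mu (EFin \o w0) = kappa%:E.
Hypothesis C0 : 0 < C.
Hypothesis sobolev : forall f, H1 f ->
  ('N[mu]_+oo[EFin \o f] <= (C * normH1 f)%:E)%E.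
Hypothesis r_bound : 0 < r < kappa / (2 * C).
Hypothesis C0S : C0_semigroup a b S.
Hypothesis genA : generated_by_A a b S.
Hypothesis normS :
  ereal_sup [set op_norm a b (S t) | t in [set t | 0 <= t]] = M0%:E.

Let sn := L2H10_seminorm ab.
Let sg := semigroupP ab C0S normS.
Let k := kappa / 2.
Let k0 : 0 < k. Proof. by rewrite divr_gt0. Qed.

Lemma initial_state_dom : domA a b (x0 - shift).
Proof.
have Hw : H2 a b (w0 - cst theta2).
  exact: (snB (H2_seminorm ab) Hw0 (cst_H2 ab theta2)).
have tw : has_trace a b (w0 - cst theta2) 0 0.
  have := trace_lin (-1) (trace_cst a b theta2) tw0.
  by rewrite mulN1r addNr scaleN1r addrC.
have -> : x0 - shift = (v0, w0 - cst theta2) :> @state R.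
  by rewrite -[LHS]/((v0 - 0, w0 - cst theta2) : @state R) subr0.
split; first exact: Hv0.
by split; [exact: Hw|split; [exact: (H2_H1 Hw)|exact: tw]].
Qed.

(** Both bounds hold almost everywhere on an interval of positive length. *)
Lemma kappa_le : kappa <= C * normH1 w0.
Proof.
apply: (ae_cst ab); have := ess_inf_ae inf_w0.
have := Noo_ae ab (sobolev (H2_H1 Hw0)).
apply: ae_imp2 => x w1 w2; apply: le_trans w2 _.
exact: le_trans (ler_norm _) w1.
Qed.

(** The radius is thereby bounded in terms of [w0] alone, although the given
    Sobolev constant is arbitrary. *)
Lemma radius_lt : r < normH1 w0 / 2.
Proof.
have /andP[_] := r_bound; rewrite ltr_pdivlMr ?mulr_gt0// => H.
have := kappa_le => H'; rewrite ltr_pdivlMr// -(ltr_pM2l C0).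
have -> : C * (r * 2) = r * (2 * C) by ring.
exact: lt_le_trans H H'.
Qed.

Section OneSolution.
Variables (u : R -> R -> R) (y : R -> @state R).
Hypothesis Cu : C_ball a b T u0 r u.
Hypothesis my : mild u y.

Lemma mild_shift_L2H10 t : 0 <= t <= T -> L2H10 (y t - shift).
Proof. by move=> tT; have [[H _] _ _] := my; exact: H. Qed.

Lemma mild_dist_initial t : 0 <= t <= T -> L2H10 (y t - x0) /\ N (y t - x0) <= r.
Proof.
move=> tT; split.
  have -> : y t - x0 = (y t - shift) - (x0 - shift) by rewrite opprB addrA subrK.
  apply: (snB sn); first exact: mild_shift_L2H10.
  exact: (domA_L2H10 initial_state_dom).
have [_ H _] := my; rewrite -lee_fin; apply: le_trans H.
by apply: ereal_sup_ubound; exists t => //=; rewrite in_itv.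
Qed.

(** [r < kappa / (2 * C)] keeps [w] within [kappa / 2] of [w0] uniformly. *)
Lemma comp2_lower_bound t : 0 <= t <= T -> {ae mu, forall x, k <= (y t).2 x}.
Proof.
move=> tT; have [/L2H10_L2H1[_ H1d] Nr] := mild_dist_initial tT.
have := Noo_ae ab (sobolev H1d); have := ess_inf_ae inf_w0.
apply: ae_imp2 => x w0x dx.
have H : C * normH1 (y t - x0).2 <= k.
  apply: le_trans (_ : C * r <= _).
    by rewrite ler_wpM2l ?(ltW C0)//; apply: le_trans Nr; exact: normH1_le.
  have /andP[_ /ltW] := r_bound; rewrite ler_pdivlMr ?mulr_gt0// => H.
  by rewrite /k ler_pdivlMr// mulrC mulrA [_ * r]mulrC.
have {}dx : `|(y t).2 x - w0 x| <= k by exact: le_trans dx H.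
by move: dx; rewrite ler_norml /k => /andP[]; lra.
Qed.

Lemma comp2_L2 t : 0 <= t <= T -> L2 (y t).2.
Proof.
move=> /mild_shift_L2H10[_ [[Lw _] _]].
have -> : (y t).2 = (y t - shift).2 + cst theta2.
  by apply/funext => x; rewrite -[RHS]/((y t).2 x - theta2 + theta2) subrK.
exact: (snD (L2_seminorm a b) Lw (L2_cst a b theta2)).
Qed.

Lemma comp1_bound t : 0 <= t <= T -> comp1 (y t - shift) <= normL2 v0 + r.
Proof.
move=> tT; have [[L1 _] Nr] := mild_dist_initial tT.
have snL := L2_seminorm a b; have Lv0 : L2 v0 by exact: H1_L2 Hv0.1.
have Xy := mild_shift_L2H10 tT; have [Ly _] := Xy.
have := sn_le_dist snL Ly Lv0.
rewrite (_ : (y t - shift).1 - v0 = (y t - x0).1); last first.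
  by apply/funext => x; rewrite -[LHS]/((y t).1 x - 0 - v0 x) subr0.
move=> /le_trans; apply; rewrite lerD2l; apply: le_trans Nr.
exact: (comp1_le a b (y t - x0)).
Qed.

Let c1 := normL2 (cst 1).

Lemma ball_normL2_le s : 0 <= s <= T -> L2 (u s) /\ normL2 (u s) <= normL2 u0 + r.
Proof.
move=> sT; have [_ /(_ s sT)[Hu _ Nu]] := Cu.
have Lu := H1_L2 (H2_H1 Hu); have Lu0 := H1_L2 (H2_H1 Hu0).
split=> //; have := sn_le_dist (L2_seminorm a b) Lu Lu0.
have := normL2_le_H2 a b (u s - u0); lra.
Qed.

Lemma forcing_L2 s : 0 <= s <= T ->
  L2 (forcing betaF betap u (fun s => (y s).2) s).1 /\
  normL2 (forcing betaF betap u (fun s => (y s).2) s).1 <=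
  (betaF * k^-1 ^+ 2 + betap) * c1 + betap * (normL2 u0 + r).
Proof.
move=> sT; have [Lu Nu] := ball_normL2_le sT; have Lw := comp2_L2 sT.
have L1 := L2_cst a b 1.
have kk : 0 <= betaF * k^-1 ^+ 2 + betap.
  by rewrite addr_ge0 ?(ltW betap0)// mulr_ge0 ?(ltW betaF0)// exprn_ge0// invr_ge0 ltW.
have [] := @L2_dom3 _ a b (forcing betaF betap u (fun s => (y s).2) s).1
  (cst 1) (u s) (cst 1) (betaF * k^-1 ^+ 2 + betap) betap 0 _ L1 Lu L1 kk
  (ltW betap0) (lexx 0) _.
- apply: measurable_funD; apply: measurable_funM => //.
    by apply: measurable_invsq; exact: L2_measurable Lw.
  by apply: measurable_funB => //; exact: L2_measurable Lu.
- apply: ae_imp (comp2_lower_bound sT) => x kw /=.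
  rewrite normr1 !mulr1 addr0.
  have /andP[i0 ik] := inv_bound k0 kw.
  have H : ((y s).2 x) ^- 2 <= k^-1 ^+ 2.
    by rewrite -exprVn lerXn2r ?nnegrE// invr_ge0 ltW.
  have H0 : 0 <= ((y s).2 x) ^- 2 by rewrite -exprVn exprn_ge0.
  apply: le_trans (ler_normD _ _) _; rewrite -addrA; apply: lerD.
    by rewrite normrM normrN (gtr0_norm betaF0) ger0_norm// ler_wpM2l// ltW.
  rewrite normrM (gtr0_norm betap0).
  have Hu1 : `|u s x - 1| <= `|u s x| + 1.
    by rewrite (le_trans (ler_normB _ _))// normr1.
  by have := ler_wpM2l (ltW betap0) Hu1; lra.
- move=> Lf Nf; split=> //; apply: le_trans Nf _.
  by rewrite mul0r addr0 lerD2l ler_wpM2l// ltW.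
Qed.

Lemma forcing_closure s : 0 <= s <= T -> closure_dom L2H10 N (domA a b)
  (forcing betaF betap u (fun s => (y s).2) s).
Proof.
move=> sT; have [Lf _] := forcing_L2 sT.
have [_ [_ [gw [cgw wgw _ _]]]] := mild_shift_L2H10 sT.
have [_ /(_ s sT)[_ [ya [yb [[gu [cgu ugu _ _]] _]]] _]] := Cu.
(* The truncation at [k] makes the representative continuous everywhere. *)
pose F x := - betaF * (Num.max (gw x + theta2) k) ^- 2 + betap * (gu x - 1).
apply: (closure_dom_continuous ab (F := F) Lf).
- move=> x; have cm : {for x, continuous
      ((fun x => Num.max (gw x + theta2) k) : subspace `[a, b] -> R)}.
    apply: (@continuous_max _ (subspace `[a, b]) (fun x => gw x + theta2) (fun=> k)).
      by apply: cvgD; [exact: cgw|exact: cvg_cst].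
    exact: cvg_cst.
  have m0 : Num.max (gw x + theta2) k != 0 by rewrite gt_eqF// lt_max k0 orbT.
  apply: cvgD; apply: cvgM; try exact: cvg_cst.
    apply: (@cvgV _ _ (nbhs (x : subspace `[a, b])) _
      (fun x => Num.max (gw x + theta2) k ^+ 2)).
      by rewrite expf_neq0.
    exact: (cvgM cm cm).
  by apply: cvgB; [exact: cgu|exact: cvg_cst].
- have Hw : {ae mu, forall x, (y s).2 x = Num.max (gw x + theta2) k}.
    apply: ae_imp2 wgw (comp2_lower_bound sT) => x.
    rewrite -[(y s - shift).2 x]/((y s).2 x - theta2) => <- kw.
    by rewrite subrK max_l.
  by apply: ae_imp2 Hw ugu => x wx ux /=; rewrite /F -wx -ux.
Qed.

(** The bound on the velocity does not involve [u0], since the forcing does not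
    enter the Lipschitz constant. *)
Lemma comp2_lipschitz t h : 0 <= t -> 0 <= h -> t + h <= T ->
  normL2 ((y (t + h)).2 - (y t).2) <= h * (normL2 v0 + r).
Proof.
move=> t0 h0 thT.
have [_ _ my3] := my.
have f2 s : comp2 (forcing betaF betap u (fun s => (y s).2) s) = 0.
  exact: (sn_norm0 (L2_seminorm a b)).
have := @mild_second_comp_lipschitz R _ L2H10 N S M0 (domA a b) (opA a b) comp1 comp2
  sn sg (comp1_seminorm10 ab) (comp2_seminorm10 ab) (fun x _ => comp1_le a b x)
  (fun x _ => comp2_le a b x) (@domA_L2H10 _ a b) (@domA_lin _ a b)
  (@opA_L2H10 _ a b) (domA_gen ab C0S normS genA) (gen_domA ab C0S normS genA)
  (fun x _ => erefl) T
  ((betaF * k^-1 ^+ 2 + betap) * c1 + betap * (normL2 u0 + r)) (normL2 v0 + r)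
  (forcing betaF betap u (fun s => (y s).2)) (fun t => y t - shift) (x0 - shift)
  (domA_0 ab) (clD_dom sn (@domA_L2H10 _ a b) initial_state_dom) forcing_closure _ (fun s _ => f2 s)
  mild_shift_L2H10 comp1_bound my3 t h t0 h0 thT.
rewrite /comp2 => H; apply: le_trans (H _).
  rewrite le_eqVlt; apply/orP; left; apply/eqP; congr (Defs.normL2 _ _ _).
  apply/funext => x.
  rewrite -[LHS]/((y (t + h)).2 x - (y t).2 x).
  rewrite -[RHS]/((y (t + h)).2 x - theta2 - ((y t).2 x - theta2)).
  by rewrite opprB addrA subrK.
move=> s sT'; rewrite norm_comp1//.
exact: (forcing_L2 sT').2.
Qed.

End OneSolution.
Section TwoSolutions.
Variables (u1 u2 q : R -> R -> R) (y1 y2 : R -> @state R).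
Variables (eta alpha Q Hq Cs Tmax V : R).
Hypotheses (Cu1 : C_ball a b T u0 r u1) (Cu2 : C_ball a b T u0 r u2).
Hypotheses (my1 : mild u1 y1) (my2 : mild u2 y2).
Hypothesis eta0 : 0 < eta.
Hypothesis alpha01 : 0 < alpha < 1.
Hypothesis u12 : forall s, 0 <= s <= T -> forall x, u1 s x - u2 s x = eta * q s x.
Hypothesis qH2 : forall s, 0 <= s <= T -> H2 a b (q s) /\ normH2 a b (q s) <= Q.
Hypothesis q_holder : forall t h, 0 <= t -> 0 < h -> t + h <= T ->
  normH2 a b (q (t + h) - q t) <= h `^ alpha * Hq.
Hypothesis Hq0 : 0 <= Hq.
Hypothesis Cs0 : 0 < Cs.
Hypothesis sobolevs : forall f, H1 f ->
  ('N[mu]_+oo[EFin \o f] <= (Cs * normH1 f)%:E)%E.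
Hypothesis TTmax : T <= Tmax.
Hypothesis vV : normL2 v0 + r <= V.

Let M00 : 0 <= M0 := sg_M0 sg.
Let i := k^-1.
Let i0 : 0 <= i. Proof. by rewrite invr_ge0 ltW. Qed.
Let mm := 2 * i ^+ 3.
Let mm0 : 0 <= mm. Proof. by rewrite mulr_ge0// exprn_ge0. Qed.
Let f1 := forcing betaF betap u1 (fun s => (y1 s).2).
Let f2 := forcing betaF betap u2 (fun s => (y2 s).2).
Let g s : @state R := f1 s - f2 s.
Let z t : @state R := y1 t - y2 t.

Lemma forcing_L2H10 u y s : C_ball a b T u0 r u -> mild u y -> 0 <= s <= T ->
  L2H10 (forcing betaF betap u (fun s => (y s).2) s).
Proof.
move=> Cu my sT; split; first exact: (forcing_L2 Cu my sT).1.
exact: (H10_0 ab).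
Qed.

Lemma forcing_diff_L2H10 s : 0 <= s <= T -> L2H10 (g s).
Proof.
by move=> sT; exact: (snB sn (forcing_L2H10 Cu1 my1 sT) (forcing_L2H10 Cu2 my2 sT)).
Qed.

Lemma diff_shift t : z t = (y1 t - shift) - (y2 t - shift).
Proof. by rewrite opprB addrA subrK. Qed.

Lemma diff_L2H10 t : 0 <= t <= T -> L2H10 (z t).
Proof.
move=> tT; rewrite diff_shift.
exact: (snB sn (mild_shift_L2H10 my1 tT) (mild_shift_L2H10 my2 tT)).
Qed.

Lemma diff_bounded t : 0 <= t <= T -> N (z t) <= r + r.
Proof.
move=> tT; have [X1 N1] := mild_dist_initial my1 tT; have [X2 N2] := mild_dist_initial my2 tT.
have -> : z t = (y1 t - x0) - (y2 t - x0) by rewrite opprB addrA subrK.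
exact: (le_trans (sn_triB sn X1 X2) (lerD N1 N2)).
Qed.

Lemma diff_mild t : 0 <= t <= T ->
  is_integral N (fun s => S (t - s) (g s)) t (z t).
Proof.
move=> tT; have /andP[t0 tleT] := tT.
have XS0 : L2H10 (S t (x0 - shift)).
  exact: (sg_X sg t0 (domA_L2H10 initial_state_dom)).
have [_ _ /(_ t tT) I1] := my1; have [_ _ /(_ t tT) I2] := my2.
apply: (is_integralB sn _ _ _ _ I1 I2).
- move=> s st; have /andP[s0 slet] := st.
  have sT : 0 <= s <= T by rewrite s0 (le_trans slet).
  have ts0 : 0 <= t - s by rewrite subr_ge0.
  have X1 := forcing_L2H10 Cu1 my1 sT; have X2 := forcing_L2H10 Cu2 my2 sT.
  split; first exact: (eqN_sym sn (eq_sgB sn sg ts0 X1 X2)).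
  by split; [exact: (sg_X sg ts0 X1)|exact: (sg_X sg ts0 X2)].
- exact: (snB sn (mild_shift_L2H10 my1 tT) XS0).
- exact: (snB sn (mild_shift_L2H10 my2 tT) XS0).
have -> : y1 t - shift - S t (x0 - shift) - (y2 t - shift - S t (x0 - shift)) = z t.
  by rewrite opprB addrA subrK -diff_shift.
exact: (eqN_refl sn (diff_L2H10 tT)).
Qed.

Lemma norm_state0 (f : @state R) : f.2 = 0 -> N f = normL2 f.1.
Proof. by case: f => f1' f2' /= ->; rewrite norm_comp1. Qed.

Lemma forcing_diff_comp1 s x : 0 <= s <= T -> (g s).1 x =
  - betaF * ((y1 s).2 x ^- 2 - (y2 s).2 x ^- 2) + betap * eta * q s x.
Proof.
move=> sT; rewrite -mulrA -u12//.
rewrite -[LHS]/((- betaF * (y1 s).2 x ^- 2 + betap * (u1 s x - 1)) -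
  (- betaF * (y2 s).2 x ^- 2 + betap * (u2 s x - 1))).
by ring.
Qed.

Lemma forcing_diff_le s : 0 <= s <= T ->
  N (g s) <= betap * eta * Q + betaF * mm * N (z s).
Proof.
move=> sT; rewrite norm_state0; last by rewrite -[LHS]/(0 - 0 : R -> R) subrr.
have [Hqs Nqs] := qH2 sT; have Lq := H1_L2 (H2_H1 Hqs).
have [Lg _] := forcing_diff_L2H10 sT; have [_ [[Lz _] _]] := diff_L2H10 sT; have L1 := L2_cst a b 1.
have c10 : 0 <= betaF * mm by rewrite mulr_ge0// ltW.
have c20 : 0 <= betap * eta by rewrite mulr_ge0// ltW.
have [] := @L2_dom3 _ a b (g s).1 (z s).2 (q s) (cst 1) (betaF * mm)
  (betap * eta) 0 (L2_measurable Lg) Lz Lq L1 c10 c20 (lexx 0).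
  apply: ae_imp2 (comp2_lower_bound my1 sT) (comp2_lower_bound my2 sT) => x kw1 kw2.
  rewrite mul0r addr0 forcing_diff_comp1//; apply: le_trans (ler_normD _ _) _.
  rewrite !normrM normrN (gtr0_norm betaF0) (gtr0_norm betap0) (gtr0_norm eta0).
  rewrite lerD2r -mulrA ler_wpM2l ?(ltW betaF0)//.
  exact: (invsq_lipschitz k0 kw2 kw1).
move=> _ /le_trans; apply; rewrite mul0r addr0 addrC; apply: lerD.
  by rewrite ler_wpM2l//; apply: le_trans (normL2_le_H2 _ _ _) Nqs.
by rewrite ler_wpM2l//; exact: (comp2_le a b (z s)).
Qed.

(** The factor [z (s + h)] multiplying the increments of [w1] and [w2] is taken
    in the supremum norm, by the Sobolev inequality, and these increments in L^2,
    where their Lipschitz constant is [V]. *)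
Lemma forcing_diff_increment s h : 0 <= s -> 0 < h -> s + h <= T ->
  N (g (s + h) - g s) <=
  betap * eta * (h `^ alpha * Hq) +
  betaF * (3 * i ^+ 4 * (Cs * N (z (s + h)))) * (2 * (h * V)) +
  betaF * mm * N (z (s + h) - z s).
Proof.
move=> s0 h0 shT; have sT : 0 <= s <= T.
  by rewrite s0 (le_trans _ shT)// lerDl ltW.
have shT' : 0 <= s + h <= T by rewrite shT andbT addr_ge0// ltW.
rewrite norm_state0; last first.
  by rewrite -[LHS]/((0 - 0) - (0 - 0) : R -> R) !subrr.
have [Hqs _] := qH2 sT; have [Hqs' _] := qH2 shT'.
have Hqd := snB (H2_seminorm ab) Hqs' Hqs; have Lq := H1_L2 (H2_H1 Hqd).
have Xgd := snB sn (forcing_diff_L2H10 shT') (forcing_diff_L2H10 sT); have [Lg _] := Xgd.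
have Xzd := snB sn (diff_L2H10 shT') (diff_L2H10 sT); have [_ [[Lz _] _]] := Xzd.
have [_ [Hz' _]] := diff_L2H10 shT'.
have sL := L2_seminorm a b.
have Lw1 := snB sL (comp2_L2 my1 shT') (comp2_L2 my1 sT).
have Lw2 := snB sL (comp2_L2 my2 shT') (comp2_L2 my2 sT).
have [La1 Na1] := L2_norm Lw1; have [La2 Na2] := L2_norm Lw2.
pose n1 x := `|((y1 (s + h)).2 - (y1 s).2) x|.
pose n2 x := `|((y2 (s + h)).2 - (y2 s).2) x|.
have Lg3 : L2 (n1 + n2) := snD sL La1 La2.
have V0 : normL2 (n1 + n2) <= 2 * (h * V).
  apply: le_trans (sn_tri sL La1 La2) _.
  have l1 := comp2_lipschitz Cu1 my1 s0 (ltW h0) shT.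
  have l2 := comp2_lipschitz Cu2 my2 s0 (ltW h0) shT.
  by have := ler_wpM2l (ltW h0) vV; lra.
pose zeta := Cs * normH1 (z (s + h)).2.
have zeta0 : 0 <= zeta by rewrite mulr_ge0 ?(ltW Cs0)// sqrtr_ge0.
have zN : zeta <= Cs * N (z (s + h)).
  by rewrite ler_wpM2l ?(ltW Cs0)//; exact: (normH1_le a b (z (s + h))).
have i40 : 0 <= 3 * i ^+ 4 by rewrite mulr_ge0// exprn_ge0.
have c10 : 0 <= betaF * mm by rewrite mulr_ge0// ltW.
have c20 : 0 <= betap * eta by rewrite mulr_ge0// ltW.
have c30 : 0 <= betaF * (3 * i ^+ 4 * zeta) by rewrite mulr_ge0 ?(ltW betaF0)// mulr_ge0.
have [] := @L2_dom3 _ a b (g (s + h) - g s).1 (z (s + h) - z s).2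
  (q (s + h) - q s) (n1 + n2) (betaF * mm) (betap * eta)
  (betaF * (3 * i ^+ 4 * zeta)) (L2_measurable Lg) Lz Lq Lg3 c10 c20 c30.
  have W1 := ae_imp2 (fun x => @conj _ _) (comp2_lower_bound my1 sT) (comp2_lower_bound my1 shT').
  have W2 := ae_imp2 (fun x => @conj _ _) (comp2_lower_bound my2 sT) (comp2_lower_bound my2 shT').
  have W := ae_imp2 (fun x => @conj _ _) W1 W2.
  apply: ae_imp2 W (Noo_ae ab (sobolevs Hz')) => x [[kw1 kw1'] [kw2 kw2']] zx.
  rewrite -[(g (s + h) - g s).1 x]/((g (s + h)).1 x - (g s).1 x) !forcing_diff_comp1//.
  have -> : - betaF * ((y1 (s + h)).2 x ^- 2 - (y2 (s + h)).2 x ^- 2) +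
      betap * eta * q (s + h) x -
      (- betaF * ((y1 s).2 x ^- 2 - (y2 s).2 x ^- 2) + betap * eta * q s x) =
    - betaF * (((y1 (s + h)).2 x ^- 2 - (y2 (s + h)).2 x ^- 2) -
      ((y1 s).2 x ^- 2 - (y2 s).2 x ^- 2)) +
    betap * eta * (q (s + h) x - q s x) by ring.
  apply: le_trans (ler_normD _ _) _.
  rewrite !normrM normrN (gtr0_norm betaF0) (gtr0_norm betap0) (gtr0_norm eta0).
  rewrite [leRHS]addrAC; apply: lerD; last exact: lexx.
  set X := `|(z _ - z _).2 x|; set Y := `|(n1 + n2) x|.
  have -> : betaF * mm * X + betaF * (3 * i ^+ 4 * zeta) * Y =
            betaF * (mm * X + 3 * i ^+ 4 * Y * zeta) by ring.
  rewrite ler_wpM2l ?(ltW betaF0)//.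
  apply: le_trans (invsq_second_difference k0 kw1 kw2 kw1' kw2') _.
  apply: lerD; first exact: lexx.
  apply: ler_pM; [|exact: normr_ge0| |exact: zx].
    by rewrite mulr_ge0// addr_ge0.
  rewrite ler_wpM2l//; exact: ler_norm.
move=> _ Hn; apply: (le_trans Hn).
have HA := ler_wpM2l c10 (comp2_le a b (z (s + h) - z s)).
have HB := ler_wpM2l c20 (le_trans (normL2_le_H2 a b _) (q_holder s0 h0 shT)).
have HC : betaF * (3 * i ^+ 4 * zeta) * normL2 (n1 + n2) <=
    betaF * (3 * i ^+ 4 * (Cs * N (z (s + h)))) * (2 * (h * V)).
  apply: ler_pM => //; first exact: normL2_ge0.
  exact: (ler_wpM2l (ltW betaF0) (ler_wpM2l i40 zN)).
rewrite [leRHS]addrC addrA; apply: lerD; last exact: HC.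
by apply: lerD; [exact: HA|exact: HB].
Qed.

Let K1 := lipschitz_const kappa betaF betap M0 Tmax.
Let E := growth_const kappa betaF M0 Tmax.
Let Q0 : 0 <= Q.
Proof.
have T00 : 0 <= (0 : R) <= T by apply/andP.
have [Hq00 qQ] := qH2 T00.
exact: (le_trans (sn_ge0 (H2_seminorm ab) Hq00) qQ).
Qed.
Let Tmax0 : 0 <= Tmax. Proof. exact: le_trans TTmax. Qed.
Let bmm0 : 0 <= betaF * mm. Proof. by rewrite mulr_ge0// ltW. Qed.
Let exp_le : expR ((2 * (M0 * (betaF * mm)) + 1) * T) <= E.
Proof.
rewrite ler_expR ler_wpM2l// addr_ge0// mulr_ge0// mulr_ge0//.
Qed.

Lemma diff_le t : 0 <= t <= T -> N (z t) <= K1 * (eta * Q).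
Proof.
move=> tT; have a0 : 0 <= betap * eta * Q by rewrite !mulr_ge0// ltW.
have H := mild_gronwall sn sg bmm0 forcing_diff_L2H10 diff_L2H10 diff_bounded
  diff_mild a0 forcing_diff_le tT.
apply: (le_trans H).
have -> : K1 * (eta * Q) = 2 * (Tmax * (M0 * (betap * eta * Q))) * E.
  by rewrite /K1 /lipschitz_const -/E; ring.
apply: ler_pM; [|exact: expR_ge0| |exact: exp_le].
  by rewrite mulr_ge0// mulr_ge0// mulr_ge0.
by rewrite ler_wpM2l// ler_wpM2r// mulr_ge0.
Qed.

Lemma le_powR_split h : 0 < h -> h <= T -> h <= h `^ alpha * Tmax `^ (1 - alpha).
Proof.
move=> h0 hT; have /andP[al0 al1] := alpha01.
rewrite -[leLHS](powRr1 (ltW h0)) -{1}(subrK alpha 1) addrC powRD; last first.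
  by rewrite (gt_eqF h0) implybT.
rewrite ler_wpM2l ?powR_ge0//; apply: ge0_ler_powR.
- by rewrite subr_ge0 ltW.
- by rewrite nnegrE ltW.
- by rewrite nnegrE.
- exact: le_trans hT TTmax.
Qed.

(** Terms proportional to [h] are brought to the order [h `^ alpha] by
    [le_powR_split]; only the increments of [q] carry their Hölder constant, and
    their integral contributes the factor [T]. *)
Lemma diff_holder t h : 0 <= t -> 0 < h -> t + h <= T ->
  N (z (t + h) - z t) <=
  eta * (h `^ alpha * holder_const alpha kappa betaF betap M0 Tmax V Cs * (Q + T * Hq)).
Proof.
move=> t0 h0 thT; have hT : h <= T by apply: le_trans thT; rewrite lerDr.
have hT' : 0 <= h <= T by rewrite ltW.
pose tau := Tmax `^ (1 - alpha); pose ha := h `^ alpha.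
have htau : h <= ha * tau := le_powR_split h0 hT.
have ha0 : 0 <= ha by exact: powR_ge0.
have tau0 : 0 <= tau by exact: powR_ge0.
have K10 : 0 <= K1.
  by rewrite /K1 /lipschitz_const mulr_ge0 ?expR_ge0// !mulr_ge0// ltW.
have V0 : 0 <= V.
  apply: le_trans vV; rewrite addr_ge0 ?normL2_ge0//.
  by have /andP[/ltW] := r_bound.
have i40 : 0 <= 3 * i ^+ 4 by rewrite mulr_ge0// exprn_ge0.
pose G := (betap + betaF * mm * K1) * (eta * Q).
have eQ0 : 0 <= eta * Q by rewrite mulr_ge0// ltW.
have G0 : 0 <= G by rewrite mulr_ge0// addr_ge0 ?(ltW betap0)// mulr_ge0.
have gG s : 0 <= s <= T -> N (g s) <= G.
  move=> sT; apply: (le_trans (forcing_diff_le sT)).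
  have := ler_wpM2l bmm0 (diff_le sT); rewrite /G; lra.
pose W := betaF * (3 * i ^+ 4 * (Cs * (K1 * (eta * Q)))) * 2 * V.
have CsK0 : 0 <= Cs * K1 := mulr_ge0 (ltW Cs0) K10.
have CsQ0 : 0 <= Cs * (K1 * (eta * Q)) := mulr_ge0 (ltW Cs0) (mulr_ge0 K10 eQ0).
have V20 : 0 <= 2 * V by rewrite mulr_ge0.
have W0 : 0 <= W.
  by rewrite /W -mulrA mulr_ge0// mulr_ge0 ?(ltW betaF0)// mulr_ge0.
pose A := betap * eta * (ha * Hq) + h * W.
have be0 : 0 <= betap * eta := mulr_ge0 (ltW betap0) (ltW eta0).
have A0 : 0 <= A.
  exact: (addr_ge0 (mulr_ge0 be0 (mulr_ge0 ha0 Hq0)) (mulr_ge0 (ltW h0) W0)).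
have gA s : 0 <= s -> s + h <= T ->
    N (g (s + h) - g s) <= A + betaF * mm * N (z (s + h) - z s).
  move=> s0 shT; apply: (le_trans (forcing_diff_increment s0 h0 shT)).
  have shT' : 0 <= s + h <= T by rewrite shT andbT addr_ge0// ltW.
  apply: lerD; last exact: lexx.
  rewrite /A; apply: lerD; first exact: lexx.
  have -> : h * W = betaF * (3 * i ^+ 4 * (Cs * (K1 * (eta * Q)))) * (2 * (h * V)).
    by rewrite /W; ring.
  apply: ler_wpM2r; first by rewrite !mulr_ge0 ?(ltW h0).
  apply: (ler_wpM2l (ltW betaF0)); apply: (ler_wpM2l i40).
  exact: (ler_wpM2l (ltW Cs0) (diff_le shT')).
have H := mild_gronwall_shift sn sg bmm0 forcing_diff_L2H10 diff_L2H10
  diff_bounded diff_mild hT' G0 A0 gG gA t0 thT.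
apply: (le_trans H).
have -> : eta * (h `^ alpha * holder_const alpha kappa betaF betap M0 Tmax V Cs *
    (Q + T * Hq)) =
  2 * (ha * (tau * M0 * (betap + betaF * mm * K1) +
     tau * (Tmax * (M0 * (betaF * (3 * i ^+ 4 * (Cs * K1)) * (2 * V)))) +
     M0 * betap) * (eta * (Q + T * Hq))) * E.
  by rewrite /holder_const -/K1 -/E -/tau -/ha -/k -/i -/mm; ring.
have eTH0 : 0 <= eta * (T * Hq) := mulr_ge0 (ltW eta0) (mulr_ge0 T0 Hq0).
pose L1 := tau * M0 * (betap + betaF * mm * K1).
pose L2' := tau * (Tmax * (M0 * (betaF * (3 * i ^+ 4 * (Cs * K1)) * (2 * V)))).
have L10 : 0 <= L1.
  exact: (mulr_ge0 (mulr_ge0 tau0 M00) (addr_ge0 (ltW betap0) (mulr_ge0 bmm0 K10))).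
have L20 : 0 <= L2'.
  have F0 : 0 <= betaF * (3 * i ^+ 4 * (Cs * K1)).
    by rewrite mulr_ge0 ?(ltW betaF0)// mulr_ge0.
  exact: (mulr_ge0 tau0 (mulr_ge0 Tmax0 (mulr_ge0 M00 (mulr_ge0 F0 V20)))).
have L30 : 0 <= M0 * betap by rewrite mulr_ge0// ltW.
have S1 : h * (M0 * G) <= ha * L1 * (eta * Q).
  have -> : ha * L1 * (eta * Q) = ha * tau * (M0 * G) by rewrite /L1 /G; ring.
  by rewrite ler_wpM2r// mulr_ge0.
have S2 : T * (M0 * A) <= ha * (M0 * betap) * (eta * (T * Hq)) + ha * L2' * (eta * Q).
  have -> : T * (M0 * A) = ha * (M0 * betap) * (eta * (T * Hq)) + T * (h * (M0 * W)).
    by rewrite /A; ring.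
  rewrite lerD2l.
  have -> : ha * L2' * (eta * Q) = Tmax * (ha * tau * (M0 * W)).
    by rewrite /L2' /W; ring.
  have MW : 0 <= M0 * W by rewrite mulr_ge0.
  apply: ler_pM => //; first by rewrite mulr_ge0// ltW.
  by rewrite ler_wpM2r.
rewrite -/L1 -/L2'.
apply: ler_pM; [|exact: expR_ge0| |exact: exp_le].
  rewrite mulr_ge0// addr_ge0//; apply: mulr_ge0; rewrite ?(ltW h0)//; exact: mulr_ge0.
rewrite ler_wpM2l//.
have P1 : 0 <= ha * L1 * (eta * (T * Hq)) by rewrite mulr_ge0// mulr_ge0.
have P2 : 0 <= ha * L2' * (eta * (T * Hq)) by rewrite mulr_ge0// mulr_ge0.
have P3 : 0 <= ha * (M0 * betap) * (eta * Q) by rewrite mulr_ge0// mulr_ge0.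
have -> : ha * (L1 + L2' + M0 * betap) * (eta * (Q + T * Hq)) =
  ha * L1 * (eta * Q) + ha * L1 * (eta * (T * Hq)) +
  (ha * L2' * (eta * Q) + ha * L2' * (eta * (T * Hq))) +
  (ha * (M0 * betap) * (eta * Q) + ha * (M0 * betap) * (eta * (T * Hq))) by ring.
lra.
Qed.

End TwoSolutions.
End MildSolutions.

(** * The derivative as a limit of differences of solutions *)

Lemma path_continuity_lin (R : realType) (V : lmodType R) (Y : set V) (N : V -> R)
    (sn : seminorm_on Y N) (T : R) (F G H : R -> V) (c d : R) :
  (forall t, 0 <= t <= T -> Y (F t)) -> (forall t, 0 <= t <= T -> Y (G t)) ->
  (forall s t, H s - H t = c *: (F s - F t) + d *: (G s - G t)) ->
  (forall t, 0 <= t <= T ->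
     N (F s - F t) @[s --> within `[0, T] (nbhs t)] --> (0 : R)) ->
  (forall t, 0 <= t <= T ->
     N (G s - G t) @[s --> within `[0, T] (nbhs t)] --> (0 : R)) ->
  forall t, 0 <= t <= T ->
     N (H s - H t) @[s --> within `[0, T] (nbhs t)] --> (0 : R).
Proof.
move=> YF YG HE cF cG t tT.
have lim0 : `|c| * N (F s - F t) + `|d| * N (G s - G t)
    @[s --> within `[0, T] (nbhs t)] --> (0 : R).
  have H0 := cvgD (cvgM (cvg_cst `|c|) (cF t tT)) (cvgM (cvg_cst `|d|) (cG t tT)).
  by rewrite !mulr0 addr0 in H0; exact: H0.
apply: (@squeeze_cvgr _ _ _ _ (fun=> 0) _ _ _ _ (cvg_cst _) lim0).
rewrite near_withinE; apply: nearW => s /=; rewrite in_itv/= => sT.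
have YFd := snB sn (YF _ sT) (YF _ tT); have YGd := snB sn (YG _ sT) (YG _ tT).
rewrite HE (sn_ge0 sn) /=; last by apply: (snD sn); exact: (snZ sn).
by rewrite -!(sn_homo sn)//; apply: (sn_tri sn); exact: (snZ sn).
Qed.

Section FrechetDerivative.
Context {R : realType}.
Variables (a b T r Qb : R) (u0 : R -> R) (u q : R -> R -> R).
Local Notation H2 := (H2 a b).
Local Notation normH2 := (normH2 a b).
Local Notation H2D := (H2D a b).
Local Notation L2H10 := (L2H10 a b).
Local Notation N := (normL2H1 a b).
Hypothesis ab : a < b.
Hypothesis T0 : 0 <= T.
Hypothesis r0 : 0 < r.
Hypothesis Hu0 : H2 u0.
Hypothesis Cu : C_ball a b T u0 r u.
Hypothesis Cq : C_path H2D normH2 T q.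
Hypothesis qQ : forall t, 0 <= t <= T -> normH2 (q t) <= Qb.

Let s2 := H2_seminorm ab.
Let Hu t : 0 <= t <= T -> H2 (u t). Proof. by have [[H _] _] := Cu; exact: H. Qed.
Let Hq t : 0 <= t <= T -> H2 (q t). Proof. by have [H _] := Cq => /H[]. Qed.

(** The directions [inward d] point from [u] into the ball, also when [u] lies on
    its boundary, and their differences recover [q]. *)
Definition inward (d : R) : R -> R -> R := fun t => (u0 - u t) + d *: q t.

Lemma inward_path d : C_path H2D normH2 T (inward d).
Proof.
have [[_ cu] Bu] := Cu; have [Dq cq] := Cq; split=> [t tT|].
  rewrite /inward addrC; apply: H2D_lin; first exact: Dq.
  have [_ [ya [yb [tu tu0]]] _] := Bu t tT.
  have H2d := snB s2 Hu0 (Hu tT).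
  split; first exact: H2d.
  split; first exact: (H2_H1 H2d).
  have := trace_lin (-1) tu tu0.
  by rewrite !mulN1r !addNr scaleN1r addrC.
apply: (path_continuity_lin s2 (c := -1) (d := d) Hu Hq _ cu cq).
move=> s t; rewrite scaleN1r opprB scalerBr /inward opprD addrACA.
by congr (_ + _); rewrite opprB addrC addrA subrK.
Qed.

Lemma inward_le d t : 0 <= d -> d * Qb <= r -> 0 <= t <= T ->
  normH2 (inward d t) <= 2 * r.
Proof.
move=> d0 dQ tT; have [_ Bu] := Cu; have [_ _ Nu] := Bu t tT.
have H1' := snB s2 Hu0 (Hu tT); have H2' := snZ s2 d (Hq tT).
apply: (le_trans (sn_tri s2 H1' H2')).
have A2 : normH2 (d *: q t) <= r.
  rewrite (sn_homo s2 _ (Hq tT)) ger0_norm//; apply: le_trans dQ.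
  exact: (ler_wpM2l d0 (qQ tT)).
have A1 : normH2 (u0 - u t) <= r.
  exact: (eq_ind_r (fun v => v <= r) Nu (sn_distC s2 Hu0 (Hu tT))).
by apply: (le_trans (lerD A1 A2)); rewrite mulr_natl mulr2n.
Qed.

Lemma inward_ball d e : 0 <= d -> d * Qb <= r -> 0 <= e <= 1 ->
  C_ball a b T u0 r (u + e *: inward d).
Proof.
move=> d0 dQ /andP[e0 e1]; have [[_ cu] Bu] := Cu; have [Dq cq] := Cq.
have [Dk _] := inward_path d.
have HX t : 0 <= t <= T -> H2 ((u + e *: inward d) t).
  move=> tT; apply: (snD s2 (Hu tT)); apply: (snZ s2).
  by have [] := Dk t tT.
split; first (split; first exact: HX).
  apply: (path_continuity_lin s2 (c := 1 - e) (d := e * d) Hu Hq _ cu cq) => s t.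
  apply/funext => x.
  rewrite -[LHS]/((u s x + e * (u0 x - u s x + d * q s x)) -
                  (u t x + e * (u0 x - u t x + d * q t x))).
  rewrite -[RHS]/((1 - e) * (u s x - u t x) + e * d * (q s x - q t x)).
  by ring.
move=> t tT; have [_ [ya [yb [tu tu0]]] Nu] := Bu t tT.
split; first exact: HX.
  exists ya, yb; split; last exact: tu0.
  have [_ [_ tk]] := Dk t tT.
  by have := trace_lin e tk tu; rewrite !mulr0 !add0r addrC.
have Hd := snB s2 (Hu tT) Hu0.
have -> : (u + e *: inward d) t - u0 = (1 - e) *: (u t - u0) + (e * d) *: q t.
  apply/funext => x.
  rewrite -[LHS]/((u t x + e * (u0 x - u t x + d * q t x)) - u0 x).
  by rewrite -[RHS]/((1 - e) * (u t x - u0 x) + e * d * q t x); ring.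
apply: (le_trans (sn_tri s2 (snZ s2 _ Hd) (snZ s2 _ (Hq tT)))).
rewrite (sn_homo s2 _ Hd) (sn_homo s2 _ (Hq tT)) !ger0_norm ?subr_ge0// ?mulr_ge0//.
have A : (1 - e) * normH2 (u t - u0) <= (1 - e) * r.
  by apply: (ler_wpM2l _ Nu); rewrite subr_ge0.
have B : e * d * normH2 (q t) <= e * r.
  rewrite -mulrA ler_wpM2l//; apply: le_trans dQ.
  exact: (ler_wpM2l d0 (qQ tT)).
by apply: (le_trans (lerD A B)); rewrite -mulrDl subrK mul1r.
Qed.

Variables (W : (R -> R -> R) -> R -> @state R) (D : (R -> R -> R) -> R -> @state R).
Hypothesis WX : forall v w, C_ball a b T u0 r v -> C_ball a b T u0 r w ->
  forall t, 0 <= t <= T -> L2H10 (W v t - W w t).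
Hypothesis FD : frechet_derivative a b T u0 r W u D.

Let sn := L2H10_seminorm ab.

Lemma frechet_expansion d e : 0 <= d -> d * Qb <= r -> 0 < e ->
  exists2 e1, 0 < e1 & forall eps, 0 < eps -> eps <= e1 -> eps <= 1 ->
  forall t, 0 <= t <= T ->
  N (W (u + eps *: inward d) t - W u t - D (eps *: inward d) t) <= eps * e.
Proof.
move=> d0 dQ e0; have [_ _ _ FDe] := FD.
have r20 : 0 < 2 * r by rewrite mulr_gt0.
have [d1 d10 Hd1] := FDe (e / (2 * r)) (divr_gt0 e0 r20).
exists (d1 / (2 * r)) => [|eps eps0 epse eps1 t tT]; first exact: divr_gt0.
have [Dk ck] := inward_path d.
have Ck : C_path H2D normH2 T (eps *: inward d).
  split=> [s sT|].
    have := H2D_lin eps (Dk s sT) (H2D_0 ab).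
    by rewrite addr0.
  have Hk s : 0 <= s <= T -> H2 (inward d s) by move=> /Dk[].
  apply: (path_continuity_lin s2 (c := eps) (d := 0) Hk Hk _ ck ck) => x y.
  by rewrite scale0r addr0 -[LHS]/(eps *: inward d x - eps *: inward d y) scalerBr.
have Cb : C_ball a b T u0 r (u + eps *: inward d).
  by apply: inward_ball => //; rewrite (ltW eps0).
have supk : (sup_norm normH2 T (eps *: inward d) <= (eps * (2 * r))%:E)%E.
  apply: ge_ereal_sup => y /= [s sI <-].
  have sT : 0 <= s <= T by move: sI; rewrite in_itv.
  rewrite lee_fin -[X in normH2 X]/(eps *: inward d s).
  rewrite (sn_homo s2); last by have [] := Dk s sT.
  by rewrite gtr0_norm// ler_wpM2l ?(ltW eps0)// inward_le.
have supd : (sup_norm normH2 T (eps *: inward d) <= d1%:E)%E.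
  by apply: (le_trans supk); rewrite lee_fin -ler_pdivlMr.
have := Hd1 _ Ck Cb supd.
set rem := (W _ - _ - _) => Hrem.
have : ((N (rem t))%:E <= sup_norm N T rem)%E.
  by apply: ereal_sup_ubound; exists t => //=; rewrite in_itv.
move=> /le_trans/(_ Hrem) H; rewrite -lee_fin; apply: (le_trans H).
apply: (@le_trans _ _ ((e / (2 * r))%:E * (eps * (2 * r))%:E)%E).
  by apply: lee_wpmul2l => //; rewrite lee_fin ltW// divr_gt0.
rewrite -EFinM lee_fin le_eqVlt; apply/orP; left; apply/eqP.
by field; rewrite gt_eqF.
Qed.

Lemma frechet_difference d e : 0 <= d -> d * Qb <= r -> 0 < e ->
  exists2 eps, 0 < eps <= 1 & forall t, 0 <= t <= T ->
  N ((W (u + eps *: inward d) t - W (u + eps *: inward 0) t) -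
     (eps * d) *: D q t) <= eps * e.
Proof.
move=> d0 dQ e0; have e20 : 0 < e / 2 by rewrite divr_gt0.
have dQ0 : 0 * Qb <= r by rewrite mul0r ltW.
have [e1 e10 H1'] := frechet_expansion d0 dQ e20.
have [e2 e2_0 H2'] := frechet_expansion (lexx 0) dQ0 e20.
pose eps := Num.min 1 (Num.min e1 e2).
have eps0 : 0 < eps by rewrite !lt_min ltr01 e10.
have [l1 [l2 l3]] : eps <= 1 /\ eps <= e1 /\ eps <= e2.
  by rewrite /eps !ge_min !lexx !orbT.
exists eps => [|t tT]; first by rewrite eps0.
have {}H1' := H1' eps eps0 l2 l1 t tT; have {}H2' := H2' eps eps0 l3 l1 t tT.
have epsI : 0 <= eps <= 1 by rewrite (ltW eps0).
have C1 := inward_ball d0 dQ epsI; have C2 := inward_ball (lexx 0) dQ0 epsI.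
have [DX Dl _ _] := FD.
have Ck c : C_path H2D normH2 T (eps *: inward c).
  have [Dk ck] := inward_path c; split=> [s sT|].
    by have := H2D_lin eps (Dk s sT) (H2D_0 ab); rewrite addr0.
  have Hk s : 0 <= s <= T -> H2 (inward c s) by move=> /Dk[].
  apply: (path_continuity_lin s2 (c := eps) (d := 0) Hk Hk _ ck ck) => x y.
  by rewrite scale0r addr0 -[LHS]/(eps *: inward c x - eps *: inward c y) scalerBr.
have kE : eps *: inward d = (eps * d) *: q + eps *: inward 0.
  apply/funext => s; apply/funext => x.
  rewrite -[LHS]/(eps * (u0 x - u s x + d * q s x)).
  by rewrite -[RHS]/(eps * d * q s x + eps * (u0 x - u s x + 0 * q s x)); ring.
have X1 := (DX _ (Ck d)).1 t tT; have X2 := (DX _ (Ck 0)).1 t tT.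
have Xq := (DX _ Cq).1 t tT.
have XqZ := snZ sn (eps * d) Xq.
have E : eqN L2H10 N (D (eps *: inward d) t) ((eps * d) *: D q t + D (eps *: inward 0) t).
  have Dl' := Dl (eps * d) q _ Cq (Ck 0) t tT; rewrite -kE in Dl'.
  exact: (aeq2_eqN ab X1 (snD sn XqZ X2) Dl').
have XW1 := WX C1 Cu tT; have XW2 := WX C2 Cu tT.
set A := W _ t in H1' XW1 *; set B := W (u + _ *: inward 0) t in H2' XW2 *.
set Z := W u t in H1' H2' XW1 XW2 *.
set d1 := D (eps *: inward d) t in H1' X1 E; set d2 := D (eps *: inward 0) t in H2' X2 E.
have XAB : L2H10 (A - B) := WX C1 C2 tT.
have -> : N (A - B - (eps * d) *: D q t) = N ((A - Z - d1) - (B - Z - d2)).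
  apply: (eqN_norm sn); apply: (eqN_sym sn).
  have -> : A - Z - d1 - (B - Z - d2) = (A - Z - (B - Z)) - (d1 - d2).
    by rewrite opprD addrACA -opprD.
  have -> : A - Z - (B - Z) = A - B by rewrite opprB addrA subrK.
  apply: (eqNB sn (eqN_refl sn XAB)).
  rewrite -[X in eqN _ _ _ X](addrK d2).
  exact: (eqNB sn E (eqN_refl sn X2)).
apply: (le_trans (sn_triB sn (snB sn XW1 X1) (snB sn XW2 X2))).
by apply: (le_trans (lerD H1' H2')); rewrite -mulrDr -splitr.
Qed.

End FrechetDerivative.

(** * The Hölder estimate for the derivative *)

Lemma holder_norm_fin (R : realType) (V : lmodType R) (N : V -> R) (alpha T : R)
    (F : R -> V) : (forall x, 0 <= N x) -> 0 < T ->
  (holder_norm alpha N T F < +oo)%E ->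
  exists Q Hq : R, [/\ sup_norm N T F = Q%:E, holder_seminorm alpha N T F = Hq%:E,
    0 <= Q /\ 0 <= Hq,
    forall t, 0 <= t <= T -> N (F t) <= Q &
    forall t h, 0 <= t -> 0 < h -> t + h <= T ->
      N (F (t + h) - F t) <= h `^ alpha * Hq].
Proof.
move=> N0 T0 fin; set s := sup_norm N T F; set hs := holder_seminorm alpha N T F.
have sup_le t : 0 <= t <= T -> ((N (F t))%:E <= s)%E.
  by move=> tT; apply: ereal_sup_ubound; exists t => //=; rewrite in_itv.
have hol_le t h : 0 <= t -> 0 < h -> t + h <= T ->
    ((h `^ (- alpha) * N (F (t + h) - F t))%:E <= hs)%E.
  by move=> t0 h0 thT; apply: ereal_sup_ubound; exists t, h.
have s0 : (0 <= s)%E.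
  have I0 : 0 <= (0 : R) <= T by rewrite lexx ltW.
  by apply: le_trans (sup_le 0 I0); rewrite lee_fin.
have hs0 : (0 <= hs)%E.
  have T0T : 0 + T <= T by rewrite add0r.
  by apply: le_trans (hol_le 0 T (lexx 0) T0 T0T); rewrite lee_fin mulr_ge0 ?powR_ge0.
have sf : s \is a fin_num.
  rewrite ge0_fin_numE//; apply: le_lt_trans fin.
  exact: leeDl.
have hsf : hs \is a fin_num.
  rewrite ge0_fin_numE//; apply: le_lt_trans fin.
  exact: leeDr.
exists (fine s), (fine hs); split; rewrite ?fineK//.
- by rewrite !fine_ge0.
- by move=> t tT; rewrite -lee_fin fineK// sup_le.
- move=> t h t0 h0 thT; have := hol_le t h t0 h0 thT.
  rewrite -[hs]fineK// lee_fin powRN ler_pdivrMl//.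
  by rewrite powR_gt0.
Qed.

Theorem corollary4p3 (R : realType) (a b alpha M0 T0 nv0 nw0 kappa betaF betap : R)
    (hab : a < b) (halpha : 0 < alpha < 1) (hT0 : 0 < T0) (hkappa : 0 < kappa)
    (hbetaF : 0 < betaF) (hbetap : 0 < betap) :
  exists2 LM : R, 0 < LM &
  forall (theta1 theta2 sigma : R) (u0 v0 w0 : R -> R) (C r : R)
    (S : R -> state -> state),
  0 < theta1 -> 0 < theta2 -> 0 < sigma < 2^-1 ->
  H2s a b sigma u0 -> has_trace a b u0 theta1 theta1 ->
  H10 a b v0 -> normL2 a b v0 = nv0 ->
  H2 a b w0 -> has_trace a b w0 theta2 theta2 -> normH1 a b w0 = nw0 ->
  ess_inf (muO a b) (EFin \o w0) = kappa%:E ->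
  0 < C ->
  (forall f, H1 a b f ->
     ('N[muO a b]_+oo[EFin \o f] <= (C * normH1 a b f)%:E)%E) ->
  0 < r < kappa / (2 * C) ->
  C0_semigroup a b S -> generated_by_A a b S ->
  ereal_sup [set op_norm a b (S t) | t in [set t | 0 <= t]] = M0%:E ->
  (forall T u, 0 < T < T0 -> C_ball a b T u0 r u ->
     unique_mild_solution a b S betaF betap theta2 r v0 w0 T u) ->
  forall (T : R) (W : (R -> R -> R) -> R -> state),
  0 < T < T0 ->
  (forall u, C_ball a b T u0 r u ->
     mild_solution a b S betaF betap theta2 r v0 w0 T u (W u)) ->
  forall (u : R -> R -> R) (W' : (R -> R -> R) -> R -> state),
  holder_ball a b alpha T u0 r u ->
  frechet_derivative a b T u0 r W u W' ->
  forall h : R, 0 < h <= T ->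
  forall q, holder_ball a b alpha T (fun x => u0 x - theta1) r q ->
  (ereal_sup [set (normL2H1 a b (W' q (t + h)%R - W' q t)%R)%:E |
       t in [set t : R | (0 <= t)%R && (t + h <= T)%R]] <=
     (h `^ alpha * LM)%:E * sup_norm (normH2 a b) T q +
     (h `^ alpha * T * LM)%:E * holder_norm alpha (normH2 a b) T q)%E.
Proof.
pose sobolev C := forall f, H1 a b f ->
  ('N[muO a b]_+oo[EFin \o f] <= (C * normH1 a b f)%:E)%E.
(* The constant may depend on the interval but not on [C]: fix any Sobolev
   constant of the interval beforehand. *)
have [Cs Cs0 HCs] : exists2 Cs : R, 0 < Cs & forall C, 0 < C -> sobolev C -> sobolev Cs.
  have [[C [C0 HC]]|nC] := pselect (exists C, 0 < C /\ sobolev C); first by exists C.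
  by exists 1 => // C C0 HC; exfalso; apply: nC; exists C.
pose LM0 := holder_const alpha kappa betaF betap M0 T0 (nv0 + nw0 / 2) Cs.
(* The maximum only ensures positivity. *)
pose LM := Num.max 1 LM0.
have LM_ge : LM0 <= LM by rewrite le_max lexx orbT.
have LM_gt0 : 0 < LM by rewrite lt_max ltr01.
exists LM; first exact: LM_gt0.
move=> theta1 theta2 sigma u0 v0 w0 C r S _ _ _ [Hu0 _] tu0 Hv0 nv0E Hw0 tw0 nw0E.
move=> inf_w0 C0 HC r_bound C0S genA normS _ T W /andP[T_gt0 TltT0] HW u W'.
move=> [[Cu _] Bu] FD h /andP[h0 hT] q [[Cq fin_q] Bq].
have T_ge0 := ltW T_gt0; have r0 : 0 < r by case/andP: r_bound.
have CBu : C_ball a b T u0 r u := conj Cu Bu.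
have s2 := H2_seminorm hab.
have normH2_ge0 f : 0 <= normH2 a b f by exact: sqrtr_ge0.
have [Q [Hq [QE HqE [Q0 Hq0] qQ q_hol]]] := holder_norm_fin normH2_ge0 T_gt0 fin_q.
have [Hq2 cq] := Cq.
have Cq' : C_path (H2D a b) (normH2 a b) T q.
  split; last exact: cq.
  move=> t tT; have Hqt := Hq2 t tT; split; first exact: Hqt.
  split; first exact: (H2_H1 Hqt).
  have [_ [ya [yb [tq tu]]] _] := Bq t tT.
  have tu' : has_trace a b (fun x => u0 x - theta1) 0 0.
    have := trace_lin (-1) (trace_cst a b theta1) tu0.
    by rewrite mulN1r addNr scaleN1r addrC.
  by have [ya0 yb0] := trace_unique hab tu tu'; rewrite ya0 yb0 in tq.
have WX v w : C_ball a b T u0 r v -> C_ball a b T u0 r w ->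
    forall t, 0 <= t <= T -> L2H10 a b (W v t - W w t).
  move=> Cv Cw t tT; exact: (diff_L2H10 hab (HW v Cv) (HW w Cw) tT).
have sn := L2H10_seminorm hab.
have [DX _ _ _] := FD; have XD := (DX q Cq').1.
have vV : normL2 a b v0 + r <= nv0 + nw0 / 2.
  rewrite nv0E lerD2l ltW// -nw0E.
  exact: (radius_lt hab Hw0 inf_w0 C0 HC r_bound).
(* Small enough for [u0 + d *: q] to stay in the ball; [Q] may vanish. *)
pose d := r / (Q + 1); have Q10 : 0 < Q + 1 by rewrite ltr_wpDl.
have d0 : 0 < d by exact: divr_gt0.
have dQ : d * Q <= r.
  by rewrite /d mulrAC -mulrA ler_piMr ?(ltW r0)// ler_pdivrMr// mul1r lerDl.
have main t : 0 <= t -> t + h <= T -> normL2H1 a b (W' q (t + h) - W' q t) <=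
    h `^ alpha * LM0 * (Q + T * Hq).
  move=> t0 thT; apply/ler_addgt0Pr => e e0.
  have tT : 0 <= t <= T by rewrite t0 (le_trans _ thT)// lerDl ltW.
  have thT' : 0 <= t + h <= T by rewrite thT andbT addr_ge0// ltW.
  (* The error is met twice, at [t] and at [t + h], and divided by [eps * d]. *)
  have e'0 : 0 < e * d / 2 by rewrite divr_gt0// mulr_gt0.
  have [eps /andP[eps0 eps1] Heps] :=
    frechet_difference hab r0 Hu0 CBu Cq' qQ WX FD (ltW d0) dQ e'0.
  have epsI : 0 <= eps <= 1 by rewrite (ltW eps0).
  have dQ0 : 0 * Q <= r by rewrite mul0r ltW.
  have C1 := inward_ball hab Hu0 CBu Cq' qQ (ltW d0) dQ epsI.
  have C2 := inward_ball hab Hu0 CBu Cq' qQ (lexx 0) dQ0 epsI.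
  set u1 := u + eps *: inward u0 u q d in C1 Heps.
  set u2 := u + eps *: inward u0 u q 0 in C2 Heps.
  have eta0 : 0 < eps * d by rewrite mulr_gt0.
  have u12 s : 0 <= s <= T -> forall x, u1 s x - u2 s x = eps * d * q s x.
    move=> _ x; rewrite -[LHS]/((u s x + eps * (u0 x - u s x + d * q s x)) -
      (u s x + eps * (u0 x - u s x + 0 * q s x))).
    by ring.
  have qH2 s : 0 <= s <= T -> H2 a b (q s) /\ normH2 a b (q s) <= Q.
    by move=> sT; split; [exact: Hq2|exact: qQ].
  have zh := diff_holder hab hkappa hbetaF hbetap T_ge0 Hu0 Hv0 Hw0 tw0 inf_w0 C0 HC
    r_bound C0S genA normS C1 C2 (HW _ C1) (HW _ C2) eta0 halpha u12 qH2 q_hol Hq0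
    Cs0 (HCs C C0 HC) (ltW TltT0) vV t0 h0 thT.
  have Z1 := Heps _ thT'; have Z2 := Heps _ tT.
  have XZ1 := WX _ _ C1 C2 _ thT'; have XZ2 := WX _ _ C1 C2 _ tT.
  set z1 := W u1 (t + h) - W u2 (t + h) in zh Z1 XZ1.
  set z2 := W u1 t - W u2 t in zh Z2 XZ2.
  set p1 := W' q (t + h) in Z1 *; set p2 := W' q t in Z2 *.
  have Xp1 : L2H10 a b p1 := XD _ thT'; have Xp2 : L2H10 a b p2 := XD _ tT.
  pose eta := eps * d.
  have Xe1 := snZ sn eta Xp1; have Xe2 := snZ sn eta Xp2.
  have : normL2H1 a b (eta *: p1 - eta *: p2) <=
      normL2H1 a b (z1 - eta *: p1) + normL2H1 a b (z1 - z2) +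
      normL2H1 a b (z2 - eta *: p2).
    apply: (le_trans (sn_dist sn Xe1 XZ2 Xe2)); rewrite lerD2r.
    apply: (le_trans (sn_dist sn Xe1 XZ1 XZ2)); rewrite lerD2r.
    by rewrite (sn_distC sn Xe1 XZ1).
  rewrite -scalerBr (sn_homo sn _ (snB sn Xp1 Xp2)) gtr0_norm// => Hd.
  rewrite -(ler_pM2l eta0).
  apply: (le_trans Hd); apply: (le_trans (lerD (lerD Z1 zh) Z2)).
  rewrite -/LM0 le_eqVlt; apply/orP; left; apply/eqP; by field.
apply: ge_ereal_sup => y /= [t /andP[t0 thT] <-].
rewrite /holder_norm QE HqE.
rewrite -[leRHS]/((h `^ alpha * LM * Q + h `^ alpha * T * LM * (Q + Hq))%:E) lee_fin.
apply: (le_trans (main t t0 thT)).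
have ha0 : 0 <= h `^ alpha by exact: powR_ge0.
apply: (@le_trans _ _ (h `^ alpha * LM * (Q + T * Hq))).
  apply: ler_wpM2r; first by rewrite addr_ge0// mulr_ge0.
  exact: (ler_wpM2l ha0 LM_ge).
have P0 : 0 <= h `^ alpha * T * LM * Q.
  by rewrite mulr_ge0// mulr_ge0 ?(ltW LM_gt0)// mulr_ge0.
rewrite mulrDr; lra.
Qed.
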